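(* Equip $\mathfrak{l}^\infty_+=\varprojlim_n\mathfrak{l}^n_+$ with the pre-Lie product $\circ$ obtained as the inverse limit of the pre-Lie products on the $\mathfrak{l}^n_+$ (these are compatible with the projections $\mathfrak{l}^{n+1}_+\to\mathfrak{l}^n_+$), and equip $\widehat{\mathcal{H}}^+_c$ with the Connes–Kreimer insertion pre-Lie product. Then $\mathcal{P}\mathfrak{l}^\infty_+$ is a pre-Lie subalgebra of $\mathfrak{l}^\infty_+$ and $\Phi:\widehat{\mathcal{H}}_c^+\to\mathcal{P}\mathfrak{l}^\infty_+$ is an isomorphism of pre-Lie algebras.
   Context: $\mathbb{K}$ is a field of characteristic zero. Graphs: a graph $\Gamma$ is a finite set of half-edges with a partition $E(\Gamma)$ into 2-element sets (edges), a partition $V(\Gamma)$ (vertices, valency = cardinality), and a subset $V_{\mathrm{ext}}(\Gamma)$ of the 1-valent vertices (external vertices); the others are internal, $V_{\mathrm{int}}(\Gamma)$. An edge is external if it contains the half-edge of an external vertex, internal otherwise; $E_{\mathrm{ext}}(\Gamma)$ denotes the external edges. The empty graph is not connected. $\mathcal{H}_n$ is spanned by isomorphism classes of graphs with $n$ edges, $\widehat{\mathcal{H}}=\prod_n\mathcal{H}_n$, and $\widehat{\mathcal{H}}^+_c$ is the space of formal linear combinations of connected graphs with at least one internal edge. Insertion pre-Lie product: for connected graphs $\Gamma_1,\Gamma_2$ with at least one internal edge, an internal vertex $v$ of $\Gamma_1$ and a bijection $\sigma$ from the half-edges of $v$ to $E_{\mathrm{ext}}(\Gamma_2)$ (if the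 valency of $v$ differs from $|E_{\mathrm{ext}}(\Gamma_2)|$ the contribution is $0$): each external edge $e$ of $\Gamma_2$ is $\{h'_{0},h'_e\}$ with $h'_0$ the half-edge of an external vertex and $h'_e$ lying in an internal vertex $v_e$ of $\Gamma_2$. The graph $\Gamma_1\circ_{v,\sigma}\Gamma_2$ has edges $E(\Gamma_1)\sqcup(E(\Gamma_2)\setminus E_{\mathrm{ext}}(\Gamma_2))$; its vertices are the vertices of $\Gamma_1$ other than $v$, together with the internal vertices of $\Gamma_2$ in which each half-edge $h'_{\sigma(h)}$ is replaced by the half-edge $h\in v$ (so $h$ becomes attached to $v_{\sigma(h)}$); its external vertices are those of $\Gamma_1$. Then $\Gamma_1\circ\Gamma_2=\sum_{v\in V_{\mathrm{int}}(\Gamma_1)}\sum_\sigma\Gamma_1\circ_{v,\sigma}\Gamma_2$, extended bilinearly and continuously to $\widehat{\mathcal{H}}^+_c$. Tensors: for $n\ge1$, $V_n=\mathbb{K}^n$ with basis $x_i$, form $\langle x_i,x_j\rangle=\delta_{ij}$, orthogonal group $O(n)$, dual basis $x_i^*$, inverse form $\langle x_i^*,x_j^*\rangle^{-1}=\delta_{ij}$. For such $V$: $\widehat{\mathfrak{h}}[V]=\prod_{d\ge0}S^d(V^* )$, $\widehat{\mathfrak{h}}_{\ge1}[V]=\prod_{d\ge1}S^d(V^* )$, $\mathfrak{h}[V]=S(V^* )$, $\widehat{S}(W)=\prod_dW^{\hat\otimes d}/\mathbb{S}_d$, $A[V]=\widehat{S}(\widehat{\mathfrak{h}}_{\ge1}[V])\hat\otimes\widehat{\mathfrak{h}}[V]$,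 $\mathfrak{l}[V]=A[V]^{O(V)}$, $\mathfrak{l}^n=\mathfrak{l}[V_n]$, $\mathfrak{l}^\infty=\varprojlim\mathfrak{l}^n$ (maps induced by restriction along $V_n\to V_{n+1}$, $x_i\mapsto x_i$). $A_{Nk}$ is the part of total tensor degree $2N$ in $V^*$ and degree $k$ in the factor $\widehat{\mathfrak{h}}[V]$; $A_+=\prod_{N>k\ge0}A_{Nk}$, $\mathfrak{l}_+[V]=A_+^{O(V)}$, $\mathfrak{l}^n_+=\mathfrak{l}_+[V_n]$, $\mathfrak{l}^\infty_+=\varprojlim\mathfrak{l}^n_+$. Pre-Lie product on $\mathfrak{l}_+[V]$: for $b_i,f_i\in V^*$ let $\langle\!\langle b_1\cdots b_l,f_1\cdots f_k\rangle\!\rangle=\delta_{kl}\sum_{\sigma\in\mathbb{S}_k}\prod_i\langle b_{\sigma(i)},f_i\rangle^{-1}$; for $w\in\widehat{\mathfrak{h}}[V]$ let $\partial_w$ be the continuous derivation of $\widehat{S}(\widehat{\mathfrak{h}}_{\ge1}[V])$ with $\partial_w(y)=\langle\!\langle w,y\rangle\!\rangle$ for $y\in\widehat{\mathfrak{h}}_{\ge1}[V]$; set $(P\otimes q)\circ(R\otimes w)=(R\cdot\partial_wP)\otimes q$, extended linearly and continuously to $A_+$ (convergent), and restricted to $O(V)$-invariants. Bialgebra $(\mathfrak{l}^\infty,\mu,\delta)$: $\mu$ is the product of $\widehat{S}(\widehat{\mathfrak{h}}_{\ge1}[V])\hat\otimes\widehat{\mathfrak{h}}[V]$ on invariants; $\delta$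 is induced by $\delta_1\hat\otimes\delta_2$ ($\delta_1$ the coproduct of $\widehat{S}(\widehat{\mathfrak{h}}_{\ge1}[V])$ with $\widehat{\mathfrak{h}}_{\ge1}[V]$ primitive, $\delta_2$ that of $\widehat{S}(V^* )$ with $V^*$ primitive) followed by $\pi_m\hat\otimes\pi_n:\ \mathfrak{l}^{m+n}\to\mathfrak{l}^m\hat\otimes\mathfrak{l}^n$, where $\pi_m(x_i^* )=x_i^*,\pi_m(x_{m+i}^* )=0$, $\pi_n(x_i^* )=0,\pi_n(x_{m+i}^* )=x_i^*$; these assemble to $\delta:\mathfrak{l}^\infty\to\mathfrak{l}^\infty\hat\otimes\mathfrak{l}^\infty$. $\mathcal{P}\mathfrak{l}^\infty$ is the space of primitive elements ($\delta x=x\otimes1+1\otimes x$), $\mathcal{P}\mathfrak{l}^\infty_+=\mathcal{P}\mathfrak{l}^\infty\cap\mathfrak{l}^\infty_+$. The map $\Phi$: for a graph $\Gamma$ with internal vertices $v_1,\dots,v_m$ and external vertices $u_1,\dots,u_{k_0}$, $\Phi^n(\Gamma)=\sum_{\ell:E(\Gamma)\to\{1,\dots,n\}}\big(\prod_{j=1}^m\prod_{h\in v_j}x^*_{\ell(h)}\big)\otimes\big(\prod_{r=1}^{k_0}x^*_{\ell(u_r)}\big)\in\mathfrak{l}^n$, where $\ell(h)$ is the label of the edge containing $h$, $\ell(u_r)$ that of the edge at $u_r$, each inner product is a monomial in $\mathfrak{h}_{\ge1}[V_n]$ and the product over $j$ is in $S^m(\mathfrak{h}_{\ge1}[V_n])$;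 extended linearly and continuously, these are compatible and define $\Phi:\widehat{\mathcal{H}}\to\mathfrak{l}^\infty$.
   Formalization: The products on the l^n_+ are not compatible with the projections on all of l^∞_+ (closed loops give factors of n), so ∘ is taken levelwise on families, and its values are claimed to be compatible families only for elements of P l^∞_+. *)

(* Defs.v *)
From HB Require Import structures.
From mathcomp Require Import all_boot all_order all_algebra all_fingroup.
From mathcomp Require Import finmap multiset.
From mathcomp Require boolp classical_sets fsbigop.

Set Implicit Arguments.
Unset Strict Implicit.
Unset Printing Implicit Defensive.
Import GRing.Theory.
Local Open Scope ring_scope.

Module FSum.
Import classical_sets fsbigop.
(* Convergent ("continuous") sum of a family indexed by a choiceType:
   the sum over its (finite) support; 0 by convention if the support is
   infinite (never the case for the sums used below on the relevant
   inputs). *)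
Definition fsum (K : fieldType) (T : choiceType) (f : T -> K) : K :=
  \sum_(i \in @classical_sets.setT T) f i.
End FSum.
Notation fsum := FSum.fsum.

Section Defs.
Variable K : fieldType.

(* Tensors.  Variables x*_1, x*_2, ... are indexed by 0, 1, 2, ...      *)
(* A commutative monomial in the x*_i is a multiset of indices; a basis *)
(* element of A[V] = S^(h_{>=1}[V]) (x) h^[V] is a pair (P, q) with P a *)
(* multiset of (nonconstant) monomials (a monomial basis element of the *)
(* symmetric algebra on the monomial basis of h_{>=1}) and q a monomial.*)
(* An element of the completed space is its coefficient function.       *)
Definition mono := multiset nat.
Definition basis := (multiset mono * mono)%type.
Definition one_b : basis := (mset0, mset0).

Definition mdeg (y : mono) : nat := size (enum_mset y).
Definition bdeg (b : basis) : nat := (\sum_(y <- enum_mset b.1) mdeg y + mdeg b.2)%N.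

Definition b_all (p : pred nat) (b : basis) : bool :=
  all (fun y : mono => all p (enum_mset y)) (enum_mset b.1) && all p (enum_mset b.2).

Definition b_in (N : nat) (b : basis) : bool :=
  (mset0 \notin b.1) && b_all (fun i => (i < N)%N) b.
(* b lies in A_{N k} with N > k  (total degree 2N, second factor degree k) *)
Definition b_plus (b : basis) : bool :=
  ~~ odd (bdeg b) && (2 * mdeg b.2 < bdeg b)%N.

Definition supp_plus (N : nat) (F : basis -> K) : Prop :=
  forall b, F b != 0 -> b_in N b && b_plus b.

Definition bshape (b : basis) : seq nat :=
  rcons [seq mdeg y | y <- enum_mset b.1] (mdeg b.2).
Definition blabels (b : basis) : seq nat :=
  flatten [seq enum_mset y | y <- enum_mset b.1] ++ enum_mset b.2.
Definition of_labels (s l : seq nat) : basis :=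
  let bl := reshape s l in
  (seq_mset [seq seq_mset y | y <- take (size s).-1 bl], seq_mset (last [::] bl)).

Definition gent n (g : 'M[K]_n.+1) (i j : nat) : K :=
  if (i < n.+1)%N && (j < n.+1)%N then g (inord i) (inord j) else 0.

(* coefficient of b' in g.b, where g acts on V^* by x*_j |-> sum_i g_ij x*_i
   and on A[V] by the induced algebra automorphisms *)
Definition act_coef n (g : 'M[K]_n.+1) (b b' : basis) : K :=
  let l := blabels b in
  \sum_(k : (size l).-tuple 'I_n.+1)
     (of_labels (bshape b) (map val k) == b')%:R *
     \prod_(p < size l) gent g (tnth k p) (nth 0%N l p).

Definition act n (g : 'M[K]_n.+1) (F : basis -> K) : basis -> K :=
  fun b' => fsum (fun b => F b * act_coef g b b').

Definition Oinv n (F : basis -> K) : Prop :=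
  forall g : 'M[K]_n.+1, g *m g^T = 1%:M -> forall b, act g F b = F b.

(* --- l^oo_+ as compatible families: x n is the component in l^{n+1}_+ --- *)
Definition Linf := nat -> basis -> K.

Definition in_linf_plus (x : Linf) : Prop :=
  forall n, supp_plus n.+1 (x n) /\ Oinv n (x n) /\
    (* restriction along V_{n+1} -> V_{n+2} maps x (n+1) to x n *)
    (forall b, b_all (fun i => (i < n.+1)%N) b -> x n.+1 b = x n b).

(* << b_1...b_l , f_1...f_k >> for monomials, with <x*_i,x*_j>^{-1} = delta_ij *)
Definition pairing (w y : mono) : K :=
  let ws := enum_mset w in let ys := enum_mset y in
  if size ws == size ys then
    \sum_(s : 'S_(size ys)) \prod_(i < size ys) (nth 0%N ws (s i) == nth 0%N ys i)%:R
  else 0.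

(* coefficient of b in (P (x) q) o (R (x) w) = (R . d_w P) (x) q,
   with d_w (y_1 ... y_r) = sum_i <<w, y_i>> prod_{j<>i} y_j *)
Definition circ_coef (b1 b2 b : basis) : K :=
  (b1.2 == b.2)%:R *
  \sum_(i < size (enum_mset b1.1))
     pairing b2.2 (nth mset0 (enum_mset b1.1) i) *
     (msetD b2.1 (msetB b1.1 (msetn 1 (nth mset0 (enum_mset b1.1) i))) == b.1)%:R.

Definition circ (F G : basis -> K) : basis -> K :=
  fun b => fsum (fun p : basis * basis => F p.1 * G p.2 * circ_coef p.1 p.2 b).

Definition circ_inf (x y : Linf) : Linf := fun n => circ (x n) (y n).

Definition shift_mono (m : nat) (y : mono) : mono :=
  seq_mset [seq (i - m)%N | i <- enum_mset y].
Definition shift_b (m : nat) (b : basis) : basis :=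
  (seq_mset [seq shift_mono m y | y <- enum_mset b.1], shift_mono m b.2).

(* coefficient of b' (x) b'' in (pi_m (x) pi_n)(delta_1 (x) delta_2)(b) *)
Definition delta_coef (m : nat) (b b' b'' : basis) : K :=
  let Ps := enum_mset b.1 in let qs := enum_mset b.2 in
  \sum_(I : {set 'I_(size Ps)}) \sum_(J : {set 'I_(size qs)})
    let c1 : basis := (seq_mset [seq nth mset0 Ps (val i) | i <- enum I],
                       seq_mset [seq nth 0%N qs (val j) | j <- enum J]) in
    let c2 : basis := (seq_mset [seq nth mset0 Ps (val i) | i <- enum (~: I)],
                       seq_mset [seq nth 0%N qs (val j) | j <- enum (~: J)]) in
    [&& b_all (fun i => (i < m)%N) c1, b_all (fun i => (m <= i)%N) c2,
        c1 == b' & shift_b m c2 == b'']%:R.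

Definition delta (m : nat) (F : basis -> K) (b' b'' : basis) : K :=
  fsum (fun b => F b * delta_coef m b b' b'').

(* delta x = x (x) 1 + 1 (x) x, componentwise in (m, n) = (a+1, c+1) *)
Definition primitive (x : Linf) : Prop :=
  forall a c b' b'',
    delta a.+1 (x (a + c)%N.+1) b' b'' =
      x a b' * (b'' == one_b)%:R + (b' == one_b)%:R * x c b''.

Definition Pl (x : Linf) : Prop := in_linf_plus x /\ primitive x.

(* Graphs: on a finite type T of half-edges, a domain D of half-edges,  *)
(* the edge partition E, the vertex partition V, the external vertices X*)
Definition pregraph (T : finType) :=
  ({set T} * {set {set T}} * {set {set T}} * {set {set T}})%type.
Section Graph.
Variable T : finType.
Implicit Type G : pregraph T.
Definition hD G : {set T} := G.1.1.1.
Definition hE G : {set {set T}} := G.1.1.2.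
Definition hV G : {set {set T}} := G.1.2.
Definition hX G : {set {set T}} := G.2.

Definition wf_graph G : bool :=
  [&& partition (hE G) (hD G), [forall e in hE G, #|e| == 2%N],
      partition (hV G) (hD G), hX G \subset hV G &
      [forall u in hX G, #|u| == 1%N]].

Definition Vint G : {set {set T}} := hV G :\: hX G.
Definition ext_edge G (e : {set T}) : bool := [exists u in hX G, u \subset e].
Definition Eext G : {set {set T}} := [set e in hE G | ext_edge G e].
Definition has_int_edge G : bool := [exists e in hE G, ~~ ext_edge G e].

Definition hadj G : rel T := fun h h' =>
  [&& h \in hD G, h' \in hD G &
      [exists B in hV G :|: hE G, (h \in B) && (h' \in B)]].
Definition connectedg G : bool :=
  (hD G != set0) && [forall h in hD G, forall h' in hD G, connect (hadj G) h h'].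

(* Phi^{n+1}(G) coefficient: edge labellings by {1..n+1} (indices 0..n) *)
Definition lab_ok n G (l : {ffun T -> 'I_n.+1}) : bool :=
  [forall e in hE G, forall h in e, forall h' in e, l h == l h'] &&
  [forall h in ~: hD G, l h == ord0].
Definition lab_basis n G (l : {ffun T -> 'I_n.+1}) : basis :=
  (seq_mset [seq seq_mset [seq val (l h) | h <- enum v] | v : {set T} <- enum (Vint G)],
   seq_mset [seq val (l h) | u : {set T} <- enum (hX G), h : T <- enum u]).
Definition PhiG n G (b : basis) : K :=
  #|[set l : {ffun T -> 'I_n.+1} | lab_ok G l && (lab_basis G l == b)]|%:R.
End Graph.

Definition giso (T T' : finType) (G : pregraph T) (G' : pregraph T') : bool :=
  [exists f : {ffun T -> T'},
    [&& [forall x in hD G, forall y in hD G, (f x == f y) ==> (x == y)],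
        f @: hD G == hD G',
        [set f @: e | e : {set T} in hE G] == hE G',
        [set f @: v | v : {set T} in hV G] == hV G' &
        [set f @: u | u : {set T} in hX G] == hX G']].

Definition insertg (T1 T2 : finType) (G1 : pregraph T1) (G2 : pregraph T2)
    (v : {set T1}) (s : {ffun T1 -> {set T2}}) : pregraph (T1 + T2)%type :=
  let Hext := \bigcup_(e in Eext G2) (e : {set T2}) in
  let Xh := \bigcup_(u in hX G2) (u : {set T2}) in
  let inner (e : {set T2}) := e :\: Xh in
  ((@inl T1 T2 @: hD G1 :|: @inr T1 T2 @: (hD G2 :\: Hext),
    [set @inl T1 T2 @: e | e : {set T1} in hE G1] :|: [set @inr T1 T2 @: e | e : {set T2} in hE G2 :\: Eext G2]),
   [set @inl T1 T2 @: w | w : {set T1} in hV G1 :\: [set v]] :|: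
   [set (@inr T1 T2 @: (w :\: Hext)) :|:
        (@inl T1 T2 @: [set h in v | inner (s h) :&: w != set0]) | w : {set T2} in Vint G2],
   [set @inl T1 T2 @: u | u : {set T1} in hX G1]).

Definition valid_s (T1 T2 : finType) (G2 : pregraph T2) (v : {set T1})
    (s : {ffun T1 -> {set T2}}) : bool :=
  [&& [forall h in v, s h \in Eext G2],
      [forall h in v, forall h' in v, (s h == s h') ==> (h == h')],
      [forall e in Eext G2, exists h in v, s h == e] &
      [forall h in ~: v, s h == set0]].

(* \hat H^+_c: a formal series of isomorphism classes of graphs is      *)
(* encoded by an isomorphism-invariant coefficient function on graphs   *)
(* whose half-edge set is exactly 'I_h (h = 2 * #edges).                *)
Definition Hser := forall h : nat, pregraph 'I_h -> K.

Definition in_Hc (c : Hser) : Prop :=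
  (forall h (G : pregraph 'I_h), c h G != 0 ->
     [&& wf_graph G, hD G == setT, connectedg G & has_int_edge G]) /\
  (forall h (G G' : pregraph 'I_h), giso G G' -> c h G = c h G').

Definition ncls h (G : pregraph 'I_h) : K := #|[set G' : pregraph 'I_h | giso G G']|%:R.

(* Phi(sum_C c(C) C) = sum_C c(C) Phi(C): summing over labelled graphs
   with weight 1/#class amounts to summing over isomorphism classes *)
Definition Phi (c : Hser) : Linf :=
  fun n b => fsum (fun h : nat =>
    \sum_(G : pregraph 'I_h) c h G / ncls G * PhiG n G b).

(* Connes--Kreimer insertion product: coefficient of the class of G in
   C1 o C2 = sum_{v,s} [C1 o_{v,s} C2] *)
Definition Hcirc (c1 c2 : Hser) : Hser := fun h G =>
  [&& wf_graph G & hD G == setT]%:R *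
  fsum (fun h1 : nat => fsum (fun h2 : nat =>
    \sum_(G1 : pregraph 'I_h1) \sum_(G2 : pregraph 'I_h2)
      (c1 h1 G1 / ncls G1) * (c2 h2 G2 / ncls G2) *
      #|[set vs : {set 'I_h1} * {ffun 'I_h1 -> {set 'I_h2}} |
          [&& vs.1 \in Vint G1, valid_s G2 vs.1 vs.2 &
              giso (insertg G1 G2 vs.1 vs.2) G]]|%:R)).

End Defs.

(* Main.v *)
Require Import Defs.
From HB Require Import structures.
From mathcomp Require Import all_boot all_order all_algebra all_fingroup.
From mathcomp Require Import finmap multiset zify ring.
From mathcomp Require boolp fsbigop.
Set Implicit Arguments.
Unset Strict Implicit.
Unset Printing Implicit Defensive.
Import GRing.Theory.
Local Open Scope ring_scope.

(* A graph is recovered from a labelling of its edges by distinct labels: the value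
   of a family x at the corresponding basis element, in which every label occurs
   twice, is the coefficient of that graph up to a nonzero factor.  This gives the
   injectivity of Phi, and also surjectivity once an invariant family is known to be
   determined by these values.  For the latter, suppose that x vanishes at all such
   elements and argue by descending induction on the number of distinct labels of b.
   A label of odd multiplicity is killed by a change of sign.  If a label a has even
   multiplicity m > 2, choose a label c not occurring in b, which is possible since n
   may be increased, and apply the reflection with entries 3/5 and 4/5 in the plane
   (a, c): by induction only b and its copy with c in place of a contribute, so
   x(b) = ((3/5)^m + (4/5)^m) x(b), and x(b) = 0.
   Invariance of Phi(G) is the identity g g^T = 1 applied to each edge.  Primitivity
   of x says that x vanishes on products of two nontrivial elements with disjoint
   labels, that is, on disconnected graphs, and x lies in the plus part exactly when
   its graphs have an internal edge.  Finally a labelling of an inserted graph is a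
   pair of labellings that agree along the chosen bijection sigma, and the pairing
   << , >> counts these bijections; hence Phi is a morphism, and the primitive
   elements are closed under the product because they are the image of Phi. *)

(** * Convergent sums with finite support *)

Section FiniteSums.
Variable K : fieldType.

(** The ground field is an arbitrary field of characteristic zero, so the orthogonal matrices that
    test invariance must be rational. Signed permutations only detect the parity of a multiplicity;
    the reflection comes from the Pythagorean triple (3, 4, 5), because (3/5)^m + (4/5)^m equals 1
    at m = 2 and is smaller than 1 for every m > 2. It needs a label not yet in use, which the
    inverse limit supplies. A second obstacle is convergence. Elements of completed spaces are
    coefficient functions, and [fsum] is 0 by convention on an infinite support, so each sum must
    first be cut down to a finite list. For the product on tensors the cut-off comes from the
    condition N > k, for the insertion product from counting half-edges. Finally, graphs consist of
    sets while basis elements are multisets. The two are compared through [labB]: every basis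
    element without constant factors is the value of some labelling, and two labellings with the
    same value are related by a bijection of half-edges that respects the vertices ([labB_lift]). *)

Lemma fsum_seq (T : choiceType) (f : T -> K) (s : seq T) :
  uniq s -> (forall i, f i != 0 -> i \in s) -> fsum f = \sum_(i <- s) f i.
Proof.
move=> us fs; rewrite /fsum (fsbigop.fsbigTE [fset x | x in s]%fset).
  by apply: perm_big; apply: uniq_perm => // i; rewrite !inE.
by move=> i; rewrite !inE /= => /negP ns; apply/eqP/negPn/negP => /fs /ns.
Qed.

Lemma eq_fsum (T : choiceType) (f g : T -> K) : f =1 g -> fsum f = fsum g.
Proof. by move=> /boolp.funext ->. Qed.

Lemma fsum1 (T : choiceType) (f : T -> K) (t : T) :
  (forall i, i != t -> f i = 0) -> fsum f = f t.
Proof.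
move=> ft; rewrite (@fsum_seq _ _ [:: t]) ?big_seq1 // => i fi.
by rewrite inE; apply: contraNT fi => /ft ->.
Qed.

Lemma fsum0 (T : choiceType) (f : T -> K) : (forall i, f i = 0) -> fsum f = 0.
Proof.
move=> f0; rewrite (@fsum_seq _ _ [::]) ?big_nil // => i.
by rewrite f0 eqxx.
Qed.

Lemma fsum_ord (f : nat -> K) N :
  (forall i, (N <= i)%N -> f i = 0) -> fsum f = \sum_(i < N) f i.
Proof.
move=> fN; rewrite (@fsum_seq _ _ (iota 0 N)) ?iota_uniq.
- by rewrite -(big_mkord xpredT f) /index_iota subn0.
- by [].
- move=> i fi; rewrite mem_iota /= add0n.
  by rewrite ltnNge; apply: contraNN fi => /fN ->.
Qed.

(** Meant for [I] a finite set of labelled graphs and [p] the basis element of each: a functional of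
    a series of graphs becomes a sum over labellings, with no need to know the fibres of [p]. *)
Lemma fsum_delta (T : choiceType) (I : finType) (w : I -> K) (p : I -> T)
    (F : T -> K) :
  fsum (fun t => \sum_i w i * (p i == t)%:R * F t) = \sum_i w i * F (p i).
Proof.
rewrite (@fsum_seq _ _ (undup (map p (enum I)))) ?undup_uniq //; last first.
  move=> t; rewrite mem_undup; apply: contraNT => /mapP nt.
  rewrite big1 // => i _; case: eqP => [pi|_]; last by rewrite mulr0 mul0r.
  by case: nt; exists i; rewrite ?mem_enum.
rewrite exchange_big /=; apply: eq_bigr => i _.
rewrite (bigD1_seq (p i)) ?undup_uniq //=; last first.
  by rewrite mem_undup; apply: map_f; rewrite mem_enum.
rewrite eqxx mulr1 big1 ?addr0 // => t /negPf nt.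
by rewrite eq_sym nt mulr0 mul0r.
Qed.

End FiniteSums.

(** * Bijections from equalities of multisets *)

Section Bijections.

Lemma perm_of_eq (A : eqType) (s s' : seq A) : s = s' -> perm_eq s s'.
Proof. by move=> ->. Qed.

Lemma perm_map_preim (B R : eqType) (F : B -> R) (r : seq R) (s : seq B) (b0 : B) :
  perm_eq r (map F s) -> exists2 t, r = map F t & perm_eq t s.
Proof.
move=> /(perm_iotaP (F b0))[I pI rE]; exists (map (nth b0 s) I).
  rewrite rE -map_comp; apply/eq_in_map => i; rewrite (perm_mem pI) mem_iota.
  by rewrite /= size_map => ilt; rewrite (nth_map b0).
rewrite size_map in pI; rewrite (permPl (perm_map _ pI)).
by rewrite map_nth_iota0 // take_size.
Qed.

(** This is what turns an equality of multisets of labels into a bijection between the labelled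
    objects. The default [b0] is the value of [f] outside [s]. *)
Lemma perm_map_fun (A B R : eqType) (F : A -> R) (F' : B -> R) s s' (b0 : B) :
  uniq s -> uniq s' -> perm_eq (map F s) (map F' s') ->
  exists f : A -> B, [/\ {in s &, injective f}, perm_eq (map f s) s' &
    {in s, forall x, F' (f x) = F x}].
Proof.
move=> us us' /(perm_map_preim b0)[t Et pt].
have st : size t = size s by rewrite -(size_map F s) Et size_map.
have ut : uniq t by rewrite (perm_uniq pt).
pose f x := nth b0 t (index x s).
have fE : map f s = t.
  apply: (@eq_from_nth _ b0); rewrite size_map // => i ilt.
  case: s us Et st @f ilt {pt} => // a s us Et st f ilt.
  by rewrite (nth_map a) // /f index_uniq.
exists f; split; last 2 first.
- by rewrite fE.
- case: s us Et st @f fE {pt} => // a s us Et st f fE x xs.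
  rewrite /f -(nth_map b0 (F a)) ?st ?index_mem // -Et.
  by rewrite (nth_map a) ?index_mem // nth_index.
- move=> x y xs ys /eqP; rewrite /f nth_uniq ?st ?index_mem // => /eqP.
  by move=> e; rewrite -(nth_index x xs) e nth_index.
Qed.

Lemma perm_enum_imset (A B : finType) (f : A -> B) (S : {set A}) :
  {in S &, injective f} -> perm_eq (enum (f @: S)) (map f (enum S)).
Proof.
move=> fI; apply: uniq_perm; first exact: enum_uniq.
  by rewrite map_inj_in_uniq ?enum_uniq // => x y; rewrite !mem_enum; apply: fI.
move=> y; rewrite mem_enum; apply/imsetP/mapP => -[x xS ->];
  by exists x; rewrite ?mem_enum // -mem_enum.
Qed.

Lemma imset_inj_in (A B : finType) (f : A -> B) (D : {set A}) :
  {in D &, injective f} ->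
  {in [pred S : {set A} | S \subset D] &, injective (fun S : {set A} => f @: S)}.
Proof.
move=> fI S S' SD SD'.
have aux (U W : {set A}) : U \subset D -> W \subset D -> f @: U = f @: W ->
    {subset U <= W}.
  move=> UD WD e x xU; have: f x \in f @: W by rewrite -e imset_f.
  case/imsetP => y yW /fI xy.
  by rewrite xy //; [apply: (subsetP UD) | apply: (subsetP WD)].
move=> e; apply/setP => x; apply/idP/idP; first exact: aux.
by apply: aux.
Qed.

End Bijections.

(** * Basis elements of labelled graphs *)

Section Labels.

Definition mkb (ys : seq (seq nat)) (q : seq nat) : basis :=
  (seq_mset (map (fun y => seq_mset y : mono) ys), seq_mset q).

Lemma mkb_id (b : basis) :
  mkb [seq enum_mset y | y <- enum_mset b.1] (enum_mset b.2) = b.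
Proof.
case: b => P q; rewrite /mkb /= seq_mset_id; congr pair.
rewrite -map_comp -[RHS]seq_mset_id; congr seq_mset.
by rewrite -[RHS]map_id; apply: eq_map => y /=; rewrite seq_mset_id.
Qed.

Section Graph.
Variable T : finType.
Implicit Type G : pregraph T.

(** The basis element of a labelling depends on the vertices only. Leaving the edges out of the
    hypotheses makes the lemmas available for [Gpos], whose blocks of equal labels need not have two
    elements. *)
Definition vwf G := [&& partition (hV G) (hD G), hX G \subset hV G &
  [forall u in hX G, #|u| == 1%N]].

Lemma wf_vwf G : wf_graph G -> vwf G.
Proof. by case/and5P => _ _ p s x; apply/and3P. Qed.

(** The label function need not be constant on edges, since the orthogonal action produces arbitrary
    labels of half-edges. *)
Definition labB G (l : T -> nat) : basis :=
  mkb [seq [seq l h | h <- enum v] | v : {set T} <- enum (Vint G)]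
      [seq l h | h <- enum (cover (hX G))].

Section Vwf.
Variable G : pregraph T.
Hypothesis vG : vwf G.

Lemma vwf_part : partition (hV G) (hD G). Proof. by case/and3P: vG. Qed.
Lemma vwf_sub : hX G \subset hV G. Proof. by case/and3P: vG. Qed.
Lemma vwf_card1 u : u \in hX G -> #|u| = 1%N.
Proof. by case/and3P: vG => _ _ /forall_inP h /h /eqP. Qed.
Lemma vwf_subD v : v \in hV G -> v \subset hD G.
Proof.
by move=> vV; rewrite -(cover_partition vwf_part); apply: (bigcup_max v).
Qed.
Lemma vint_subD v : v \in Vint G -> v \subset hD G.
Proof. by case/setDP => /vwf_subD. Qed.
Lemma coverX_sub : cover (hX G) \subset hD G.
Proof.
apply/bigcupsP => u uX; apply: vwf_subD; exact: (subsetP vwf_sub).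
Qed.
Lemma coverXE h : (h \in cover (hX G)) = ([set h] \in hX G).
Proof.
apply/bigcupP/idP => [[u uX hu]|uX]; last by exists [set h]; rewrite ?inE.
suff -> : [set h] = u by [].
apply/eqP; rewrite eqEcard sub1set hu /= (vwf_card1 uX).
by rewrite cards1.
Qed.

Lemma perm_enum_coverX :
  perm_eq [seq h | u : {set T} <- enum (hX G), h : T <- enum u]
          (enum (cover (hX G))).
Proof.
apply: uniq_perm; last 2 first.
- exact: enum_uniq.
- move=> h; rewrite mem_enum; apply/allpairsPdep/bigcupP.
    by case=> u [h' []]; rewrite !mem_enum => uX hu ->; exists u.
  by case=> u uX hu; exists u, h; rewrite !mem_enum.
apply: allpairs_uniq_dep.
- exact: enum_uniq.
- by move=> u _; exact: enum_uniq.
move=> [u h] [u' h'] /allpairsPdep[u1 [h1 []]] + + /= [e1 e2].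
rewrite -e1 -e2 !mem_enum => {e1 e2 u1 h1} uX hu.
move=> /allpairsPdep[u1 [h1 []]] + + /= [e1 e2].
rewrite -e1 -e2 !mem_enum => {e1 e2 u1 h1} uX' hu' e.
move: uX uX' hu hu'; rewrite e => /vwf_card1/eqP/cards1P[x ->].
by move=> /vwf_card1/eqP/cards1P[y ->]; rewrite !inE => /eqP -> /eqP ->.
Qed.

Lemma vint_or_X h : h \in hD G ->
  (h \in cover (hX G)) (+) [exists v in Vint G, h \in v].
Proof.
have tV := partition_trivIset vwf_part.
rewrite -(cover_partition vwf_part) => /bigcupP[v vV hv].
case: (boolP (h \in cover (hX G))) => /= hX.
  apply/exists_inP => -[w /setDP[wV wX] hw].
  move: hX; rewrite coverXE => hX.
  have := (subsetP vwf_sub) _ hX => hV.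
  have : w = [set h].
    apply/eqP/negPn/negP => /(trivIsetP tV _ _ wV hV).
    by rewrite -setI_eq0 => /eqP/setP/(_ h); rewrite !inE hw eqxx.
  by move=> e; rewrite e hX in wX.
apply/exists_inP; exists v => //; rewrite /Vint inE vV andbT.
by apply: contraNN hX => vX; apply/bigcupP; exists v.
Qed.

End Vwf.

Lemma lab_basisE n G (l : {ffun T -> 'I_n.+1}) : vwf G ->
  lab_basis G l = labB G (fun h => val (l h)).
Proof.
move=> vG; congr pair; first by rewrite -map_comp.
apply/eq_seq_msetP; rewrite -(permPr (perm_map _ (perm_enum_coverX vG))).
by rewrite map_allpairs.
Qed.

Lemma eq_labB G (l l' : T -> nat) : vwf G -> {in hD G, l =1 l'} ->
  labB G l = labB G l'.
Proof.
move=> vG ll; rewrite /labB; congr mkb.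
  apply/eq_in_map => v; rewrite mem_enum => vV.
  apply/eq_in_map => h; rewrite mem_enum => hv; apply: ll.
  by apply: (subsetP (vint_subD vG vV)).
apply/eq_in_map => h; rewrite mem_enum => hX; apply: ll.
exact: (subsetP (coverX_sub vG)).
Qed.

End Graph.

Definition viso (T T' : finType) (G : pregraph T) (G' : pregraph T')
    (f : T -> T') :=
  [/\ {in hD G &, injective f}, f @: hD G = hD G',
      [set f @: v | v : {set T} in hV G] = hV G' &
      [set f @: u | u : {set T} in hX G] = hX G'].

Section Iso.
Variables (T T' : finType) (G : pregraph T) (G' : pregraph T').
Hypotheses (vG : vwf G) (vG' : vwf G').

Lemma viso_Vint f : viso G G' f -> [set f @: v | v : {set T} in Vint G] = Vint G'.
Proof.
case=> fI fD fV fX; rewrite /Vint -fV -fX; apply/setP => w.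
apply/imsetP/setDP.
  case=> v /setDP[vV vX ->]; split; first exact: imset_f.
  apply: contraNN vX => /imsetP[u uX e].
  have uV := subsetP (vwf_sub vG) _ uX.
  by rewrite (imset_inj_in fI _ _ e) // inE /= vwf_subD.
case=> /imsetP[v vV ->] wX; exists v => //; rewrite inE vV andbT.
by apply: contraNN wX => vX; apply: imset_f.
Qed.

Lemma viso_labB f (l' : T' -> nat) : viso G G' f ->
  labB G' l' = labB G (fun h => l' (f h)).
Proof.
move=> vf; case: (vf) => fI fD fV fX; rewrite /labB /mkb; congr pair.
  rewrite -!map_comp -(viso_Vint vf); apply/eq_seq_msetP.
  have fI2 : {in Vint G &, injective (fun S : {set T} => f @: S)}.
    by move=> v w vV wV; apply: (imset_inj_in fI); rewrite inE /= vint_subD.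
  rewrite (permPl (perm_map _ (perm_enum_imset fI2))) -map_comp.
  have -> : [seq ((fun y : seq nat => seq_mset y) \o
     (fun v : {set T'} => [seq l' h | h <- enum v])) (f @: w) | w : {set T} <- enum (Vint G)]
    = [seq ((fun y : seq nat => seq_mset y) \o
     (fun v : {set T} => [seq l' (f h) | h <- enum v])) w | w : {set T} <- enum (Vint G)].
    apply/eq_in_map => v; rewrite mem_enum => vV /=; apply/eq_seq_msetP.
    rewrite (map_comp l' f); apply: perm_map; apply: perm_enum_imset.
    move=> x y xv yv; apply: fI; exact: (subsetP (vint_subD vG vV)).
  exact: perm_refl.
apply/eq_seq_msetP; rewrite (map_comp l' f); apply: perm_map.
have -> : cover (hX G') = f @: cover (hX G).
  rewrite -fX; apply/setP => y; apply/bigcupP/imsetP.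
    case=> _ /imsetP[u uX ->] /imsetP[x xu ->]; exists x => //.
    by apply/bigcupP; exists u.
  by case=> x /bigcupP[u uX xu] ->; exists (f @: u); rewrite imset_f.
apply: perm_enum_imset => x y xX yX.
by apply: fI; apply: (subsetP (coverX_sub vG)).
Qed.

(** Equal multisets of vertex monomials match the internal vertices, equality of two matched
    monomials matches their half-edges, and equality of the second factors matches the external
    half-edges. These bijections glue because each half-edge is either external or in exactly one
    internal vertex. *)
Lemma labB_lift (t0 : T') (l : T -> nat) (l' : T' -> nat) :
  labB G l = labB G' l' ->
  exists2 f : T -> T', viso G G' f & {in hD G, forall h, l' (f h) = l h}.
Proof.
rewrite /labB /mkb => -[/eq_seq_msetP e1 /eq_seq_msetP e2].
rewrite -!map_comp in e1.
have [f1 [f1I f1p f1l]] := perm_map_fun set0 (enum_uniq _) (enum_uniq _) e1.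
have [fX [fXI fXp fXl]] := perm_map_fun t0 (enum_uniq _) (enum_uniq _) e2.
have f1V v : v \in Vint G -> f1 v \in Vint G'.
  by move=> vV; rewrite -mem_enum -(perm_mem f1p) map_f // mem_enum.
have hyp v : exists fv : T -> T', v \in Vint G ->
    [/\ {in v &, injective fv}, fv @: v = f1 v & {in v, forall h, l' (fv h) = l h}].
  case: (boolP (v \in Vint G)) => vV; last by exists (fun _ => t0).
  have /f1l/eq_seq_msetP : v \in enum (Vint G) by rewrite mem_enum.
  rewrite perm_sym => p.
  have [fv [fvI fvp fvl]] := perm_map_fun t0 (enum_uniq _) (enum_uniq _) p.
  exists fv => _; split; first by move=> x y xv yv; apply: fvI; rewrite mem_enum.
    apply/setP => y; rewrite -[RHS]mem_enum -(perm_mem fvp).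
    by apply/imsetP/mapP => -[x xv ->]; exists x; rewrite ?mem_enum // -mem_enum.
  by move=> h hv; apply: fvl; rewrite mem_enum.
have [fv fvP] := fin_all_exists hyp.
(* [fX] is the bijection of external half-edges and [fv v] the one on the internal vertex [v]. *)
pose f h := if h \in cover (hX G) then fX h else fv (pblock (hV G) h) h.
have tV := partition_trivIset (vwf_part vG).
have tV' := partition_trivIset (vwf_part vG').
have fvE v h : v \in Vint G -> h \in v -> f h = fv v h.
  move=> vV hv; rewrite /f.
  have /(vint_or_X vG) : h \in hD G by apply: (subsetP (vint_subD vG vV)).
  have -> : [exists v in Vint G, h \in v] by apply/exists_inP; exists v.
  rewrite addbT => /negPf ->.
  by rewrite (def_pblock tV _ hv) //; case/setDP: vV.
have fE v : v \in Vint G -> f @: v = f1 v.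
  move=> vV; have [_ <- _] := fvP _ vV.
  by apply: eq_in_imset => h hv; apply: fvE.
have fXc h : h \in cover (hX G) -> fX h \in cover (hX G').
  by move=> hx; rewrite -mem_enum -(perm_mem fXp) map_f // mem_enum.
have fXE : [set f @: u | u : {set T} in hX G] = hX G'.
  apply/setP => w; apply/imsetP/idP.
    case=> u uX ->; have /eqP/cards1P[h Eu] := vwf_card1 vG uX.
    have hx : h \in cover (hX G) by rewrite coverXE // -Eu.
    by rewrite Eu imset_set1 /f hx -coverXE // fXc.
  move=> wX; have /eqP/cards1P[h Ew] := vwf_card1 vG' wX.
  have : h \in enum (cover (hX G')) by rewrite mem_enum coverXE // -Ew.
  rewrite -(perm_mem fXp) => /mapP[x]; rewrite mem_enum => xX hx.
  exists [set x]; first by rewrite -coverXE.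
  by rewrite imset_set1 /f xX Ew hx.
have fVE : [set f @: v | v : {set T} in Vint G] = Vint G'.
  apply/setP => w; apply/imsetP/idP; first by case=> v vV ->; rewrite fE // f1V.
  rewrite -mem_enum -(perm_mem f1p) => /mapP[v]; rewrite mem_enum => vV ->.
  by exists v; rewrite ?fE.
have VXU (U : finType) (H : pregraph U) : vwf H -> hV H = Vint H :|: hX H.
  move=> vH; rewrite /Vint; apply/setP => v; rewrite !inE.
  case: (boolP (v \in hX H)) => //= vX; last by rewrite orbF.
  exact: (subsetP (vwf_sub vH)).
have fallV : [set f @: v | v : {set T} in hV G] = hV G'.
  by rewrite (VXU _ _ vG) (VXU _ _ vG') imsetU fVE fXE.
exists f; last first.
  move=> h hd; have := vint_or_X vG hd.
  case: (boolP (h \in cover (hX G))) => /= hx; last first.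
    by case/exists_inP => v vV hv; rewrite (fvE _ _ vV hv); case: (fvP _ vV) => _ _ ->.
  by rewrite /f hx fXl // mem_enum.
split=> //; last first.
  rewrite -(cover_partition (vwf_part vG)) -(cover_partition (vwf_part vG')).
  rewrite -fallV; apply/setP => y; apply/imsetP/bigcupP.
    by case=> x /bigcupP[v vV xv] ->; exists (f @: v); rewrite imset_f.
  case=> _ /imsetP[v vV ->] /imsetP[x xv ->]; exists x => //.
  by apply/bigcupP; exists v.
have fcov h : h \in hD G -> (h \in cover (hX G)) = (f h \in cover (hX G')).
  move=> hd; have := vint_or_X vG hd.
  case: (boolP (h \in cover (hX G))) => /= hx; first by rewrite /f hx fXc.
  case/exists_inP => v vV hv.
  have wV : f @: v \in Vint G' by rewrite fE // f1V.
  have fhv : f h \in f @: v by rewrite imset_f.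
  have /(vint_or_X vG') : f h \in hD G' by apply: (subsetP (vint_subD vG' wV)).
  have -> : [exists v in Vint G', f h \in v] by apply/exists_inP; exists (f @: v).
  by rewrite addbT => /negPf ->.
move=> h h' hd hd' e.
have := vint_or_X vG hd; have := vint_or_X vG hd'.
have := fcov h hd; rewrite e -(fcov _ hd').
case: (boolP (h' \in cover (hX G))) => [hx'|hx'] hx.
  by move=> _ _; apply: fXI; rewrite ?mem_enum //; move: e; rewrite /f hx' hx.
rewrite hx /= => /exists_inP[v' vV' hv'] /exists_inP[v vV hv].
have fh : f h \in f @: v by rewrite imset_f.
have fh' : f h \in f @: v' by rewrite e imset_f.
have wV : f @: v \in hV G' by rewrite -fallV imset_f //; case/setDP: vV.
have wV' : f @: v' \in hV G' by rewrite -fallV imset_f //; case/setDP: vV'.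
have ee : f @: v = f @: v'.
  by rewrite -(def_pblock tV' wV fh) -(def_pblock tV' wV' fh').
rewrite !fE // in ee; have vv' : v = v' by apply: f1I; rewrite ?mem_enum.
rewrite -vv' in hv'; have [fvI _ _] := fvP _ vV.
by apply: fvI => //; rewrite -!fvE.
Qed.

End Iso.
End Labels.

(** * Labels and positions *)

Section BasisLabels.

Lemma bdegE b : bdeg b = size (blabels b).
Proof.
rewrite /bdeg /blabels size_cat size_flatten /shape -map_comp.
by rewrite sumn_map /mdeg /=.
Qed.

Lemma b_allE p b : b_all p b = all p (blabels b).
Proof.
rewrite /b_all /blabels all_cat; congr (_ && _).
by elim: (enum_mset b.1) => //= y s ->; rewrite all_cat.
Qed.

Lemma perm_flatten_mset (ys : seq (seq nat)) :
  perm_eq (flatten [seq enum_mset y | y <-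
    enum_mset (seq_mset [seq (seq_mset y : mono) | y <- ys])]) (flatten ys).
Proof.
rewrite (permPl (perm_flatten (perm_map _ (perm_eq_seq_mset _)))) -map_comp.
elim: ys => //= y ys IH; apply: perm_cat => //; exact: perm_eq_seq_mset.
Qed.

Lemma perm_blabels_mkb ys q : perm_eq (blabels (mkb ys q)) (flatten ys ++ q).
Proof.
by apply: perm_cat; [exact: perm_flatten_mset | exact: perm_eq_seq_mset].
Qed.

Lemma sumn_bshape b : sumn (bshape b) = size (blabels b).
Proof.
rewrite /bshape -cats1 sumn_cat /= addn0 -bdegE /bdeg.
by rewrite sumn_map.
Qed.

Section OfGraph.
Variables (T : finType) (G : pregraph T).
Hypothesis vG : vwf G.

Lemma perm_enum_vertices :
  perm_eq (flatten [seq enum v | v : {set T} <- enum (Vint G)]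
           ++ enum (cover (hX G))) (enum (hD G)).
Proof.
have tV := partition_trivIset (vwf_part vG).
apply: uniq_perm; last 2 first.
- exact: enum_uniq.
- move=> h; rewrite mem_cat !mem_enum; apply/orP/idP.
    case; last exact: (subsetP (coverX_sub vG)).
    case/flattenP => s /mapP[v]; rewrite mem_enum => vV ->.
    by rewrite mem_enum; apply: (subsetP (vint_subD vG vV)).
  move=> hd; have := vint_or_X vG hd; case: (h \in cover _) => /=; first by right.
  case/exists_inP => v vV hv; left; apply/flattenP; exists (enum v).
    by apply: map_f; rewrite mem_enum.
  by rewrite mem_enum.
rewrite cat_uniq enum_uniq andbT; apply/andP; split.
  have : uniq [seq (v, h).2 | v : {set T} <- enum (Vint G), h : T <- enum v].
    apply: allpairs_uniq_dep; first exact: enum_uniq.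
      by move=> v _; exact: enum_uniq.
    move=> [v h] [v' h'] /allpairsPdep[u1 [h1 []]] + + /= [e1 e2].
    rewrite -e1 -e2 !mem_enum => {e1 e2 u1 h1} vV hv.
    move=> /allpairsPdep[u1 [h1 []]] + + /= [e1 e2].
    rewrite -e1 -e2 !mem_enum => {e1 e2 u1 h1} vV' hv' e.
    move: e => /= e; subst h'; suff -> : v = v' by [].
    have := def_pblock tV _ hv; have := def_pblock tV _ hv'.
    by case/setDP: vV => vV _; case/setDP: vV' => vV' _ <- // <-.
  congr uniq; congr flatten; apply: eq_map => v; exact: map_id.
apply/hasPn => h; rewrite mem_enum => hx; apply/flattenP.
case=> s /mapP[v]; rewrite mem_enum => vV -> ; rewrite mem_enum => hv.
have := vint_or_X vG (subsetP (coverX_sub vG) _ hx); rewrite hx /=.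
by move/exists_inP; case; exists v.
Qed.

Lemma perm_blabels_labB l : perm_eq (blabels (labB G l)) (map l (enum (hD G))).
Proof.
rewrite /labB (permPl (perm_blabels_mkb _ _)).
rewrite -(permPr (perm_map l perm_enum_vertices)) map_cat map_flatten.
by rewrite -map_comp.
Qed.

Lemma bdeg_labB l : bdeg (labB G l) = #|hD G|.
Proof. by rewrite bdegE (perm_size (perm_blabels_labB l)) size_map cardE. Qed.

Lemma mdeg_labB2 l : mdeg (labB G l).2 = #|hX G|.
Proof.
rewrite /mdeg (perm_size (perm_eq_seq_mset _)) size_map -cardE.
have tX : trivIset (hX G).
  apply: trivIsetS (partition_trivIset (vwf_part vG)); exact: vwf_sub.
rewrite -(eqP tX) (eq_bigr (fun _ => 1%N)) ?sum1_card // => u.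
exact: vwf_card1.
Qed.

Lemma labB_nmset0 l : mset0 \notin (labB G l).1.
Proof.
apply/negP; rewrite (perm_mem (perm_eq_seq_mset _)) => /mapP[y /mapP[v]].
rewrite mem_enum => /setDP[vV _] -> e.
have : size (enum_mset (seq_mset [seq l h | h <- enum v])) = 0%N.
  by rewrite -e enum_mset0.
rewrite (perm_size (perm_eq_seq_mset _)) size_map -cardE => /eqP.
rewrite cards_eq0 => /eqP v0; move: vV; rewrite v0 => vV.
by have /and3P[_ _ /negP] := vwf_part vG.
Qed.

Lemma b_in_labB n (l : T -> 'I_n.+1) : b_in n.+1 (labB G (fun h => val (l h))).
Proof.
rewrite /b_in labB_nmset0 /= b_allE (perm_all _ (perm_blabels_labB _)).
by rewrite all_map; apply/allP => h _ /=.
Qed.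

End OfGraph.

Lemma uniq_flatten_blocks (T : eqType) (B : seq (seq T)) :
  [::] \notin B -> uniq (flatten B) ->
  uniq B /\ (forall y z x, y \in B -> z \in B -> x \in y -> x \in z -> y = z).
Proof.
elim: B => [|y B' IH] //; rewrite inE negb_or => /andP[ny nB'].
rewrite /= cat_uniq => /and3P[uy /hasPn dy uB'].
have {IH}[uB IH] := IH nB' uB'.
have aux z x : z \in B' -> x \in y -> x \in z -> False.
  by move=> zB xy xz; have /dy/negP : x \in flatten B'; [apply/flattenP; exists z|].
split.
  rewrite uB andbT; apply/negP => yB; case: y ny uy dy aux yB => // a y _ _ _ aux yB.
  by apply: (aux _ a yB); rewrite inE eqxx.
move=> z w x; rewrite !inE => /predU1P[->|zB] /predU1P[->|wB] // xz xw.
- by case: (aux _ _ wB xz xw).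
- by case: (aux _ _ zB xw xz).
- exact: IH xz xw.
Qed.

Section Blocks.
Variables (T : finType) (B : seq (seq T)) (Q : seq T) (E : {set {set T}}).
Hypotheses (uBQ : uniq (flatten B ++ Q)) (allBQ : forall x, x \in flatten B ++ Q)
  (neB : [::] \notin B).

Let mkset (y : seq T) : {set T} := [set x in y].

(** Each list in [B] becomes an internal vertex and each entry of [Q] a univalent external one; the
    edges remain a free parameter. *)
Definition Gof : pregraph T :=
  (([set: T], E), [set v : {set T} in map mkset B ++ map set1 Q],
   [set u : {set T} in map set1 Q]).

Let XE : hX Gof = [set u : {set T} in map set1 Q]. Proof. by []. Qed.

Let disj y x : y \in B -> x \in y -> x \notin Q.
Proof.
move=> yB xy; move: uBQ; rewrite cat_uniq => /and3P[_ /hasPn h _].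
by apply/negP => /h /negP; apply; apply/flattenP; exists y.
Qed.

Let BnX y : y \in B -> mkset y \notin map set1 Q.
Proof.
move=> yB; apply/negP => /mapP[x xQ /setP/(_ x)]; rewrite !inE eqxx => xy.
by move: (disj yB xy); rewrite xQ.
Qed.

Let VintE : Vint Gof = [set v : {set T} in map mkset B].
Proof.
rewrite /Vint; apply/setP => v; rewrite !inE mem_cat.
case: (boolP (v \in map mkset B)) => [/mapP[y yB ->]|] /=.
  by rewrite (negPf (BnX yB)).
by rewrite andNb.
Qed.

Let uniqB : uniq B /\ (forall y z x, y \in B -> z \in B -> x \in y -> x \in z -> y = z).
Proof.
by apply: uniq_flatten_blocks => //; move: uBQ; rewrite cat_uniq => /and3P[].
Qed.

Lemma Gof_vwf : vwf Gof.
Proof.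
have [uB iB] := uniqB.
apply/and3P; split; last 2 first.
- by apply/subsetP => u; rewrite !inE mem_cat orbC => ->.
- by apply/forall_inP => u; rewrite inE => /mapP[x _ ->]; rewrite cards1.
apply/and3P; split.
- apply/eqP/setP => x; rewrite inE; apply/bigcupP.
  have := allBQ x; rewrite mem_cat => /orP[/flattenP[y yB xy]|xQ].
    by exists (mkset y); rewrite !inE ?mem_cat ?map_f.
  by exists [set x]; rewrite !inE ?mem_cat // [X in _ || X]map_f ?orbT.
- apply/trivIsetP => v w; rewrite !inE !mem_cat => hv hw.
  move=> vw; apply/pred0Pn => -[x /= /andP[xv xw]]; case/negP: vw.
  move: hv hw => /orP[] /mapP[y yB vE] /orP[] /mapP[z zB wE]; subst v w.
  + by move: xv xw; rewrite !inE => xv xw; rewrite (iB _ _ _ yB zB xv xw).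
  + move: xv xw; rewrite !inE => xv /eqP xw; subst x.
    by move: (disj yB xv); rewrite zB.
  + move: xv xw; rewrite !inE => /eqP xv xw; subst x.
    by move: (disj zB xw); rewrite yB.
  + by move: xv xw; rewrite !inE => /eqP -> /eqP ->.
- rewrite !inE mem_cat; apply/norP; split.
    apply/mapP => -[y yB /setP e]; case: y yB e => [|a y yB /(_ a)].
      by rewrite (negPf neB).
    by rewrite !inE eqxx.
  by apply/mapP => -[x _ /setP/(_ x)]; rewrite !inE eqxx.
Qed.

Lemma Gof_labB l : labB Gof l = mkb (map (map l) B) (map l Q).
Proof.
have [uB iB] := uniqB.
have uQ : uniq Q by move: uBQ; rewrite cat_uniq => /and3P[].
have ufl : uniq (flatten B) by move: uBQ; rewrite cat_uniq => /and3P[].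
have uy y : y \in B -> uniq y.
  move=> yB; move: ufl; case: (path.splitPr yB) => s1 s2.
  by rewrite flatten_cat cat_uniq /= cat_uniq => /and3P[_ _ /and3P[]].
have sI : {in B &, injective mkset}.
  move=> y z yB zB /setP e; case: y yB e => [|a y] yB e.
    by move: neB; rewrite yB.
  by apply: (iB _ _ a) => //; have := e a; rewrite !inE eqxx // => <-.
rewrite /labB /mkb; congr pair; apply/eq_seq_msetP; last first.
  apply: perm_map; apply: uniq_perm => //; first exact: enum_uniq.
  move=> x; rewrite mem_enum XE; apply/bigcupP/idP.
    by case=> u; rewrite !inE => /mapP[y yQ ->]; rewrite inE => /eqP ->.
  by move=> xQ; exists [set x]; rewrite !inE // map_f.
have p : perm_eq (enum (Vint Gof)) (map mkset B).
  apply: uniq_perm; first exact: enum_uniq.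
    by rewrite map_inj_in_uniq.
  by move=> v; rewrite mem_enum VintE inE.
rewrite -!map_comp (permPl (perm_map _ p)) -map_comp.
apply: perm_of_eq; apply/eq_in_map => y yB /=; apply/eq_seq_msetP; apply: perm_map.
apply: uniq_perm; [exact: enum_uniq | exact: uy|].
by move=> x; rewrite mem_enum inE.
Qed.
End Blocks.

Lemma of_labels_id (b : basis) : of_labels (bshape b) (blabels b) = b.
Proof.
rewrite /of_labels.
have -> : reshape (bshape b) (blabels b) =
    rcons [seq enum_mset y | y <- enum_mset b.1] (enum_mset b.2).
  rewrite /bshape /blabels.
  have -> : rcons [seq mdeg y | y <- b.1] (mdeg b.2) =
    shape (rcons [seq enum_mset y | y <- enum_mset b.1] (enum_mset b.2)).
    by rewrite /shape map_rcons -map_comp.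
  by rewrite -flatten_rcons flattenK.
rewrite last_rcons /bshape size_rcons size_map /= -cats1 take_size_cat ?size_map //.
exact: mkb_id.
Qed.

Section Positions.
Variable b : basis.
Hypothesis bn0 : mset0 \notin b.1.
Local Notation N := (size (blabels b)).

Definition pos_blocks := reshape (bshape b) (enum 'I_N).
Definition blab (i : 'I_N) : nat := nth 0%N (blabels b) i.

(* The half-edges are the positions in [blabels b]; two of them form an edge when
   they carry the same label. *)
Definition Gpos : pregraph 'I_N :=
  Gof (take (size (bshape b)).-1 pos_blocks) (last [::] pos_blocks)
      (preim_partition blab setT).

Lemma shape_pos : shape pos_blocks = bshape b.
Proof. by rewrite /pos_blocks reshapeKl // size_enum_ord sumn_bshape. Qed.

Lemma take_last (A : Type) (x0 : A) (s : seq A) k :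
  size s = k.+1 -> take k s ++ [:: last x0 s] = s.
Proof.
case/lastP: s => // s x; rewrite size_rcons => -[<-].
by rewrite last_rcons -cats1 take_size_cat.
Qed.

Lemma pos_flatten : flatten (take (size (bshape b)).-1 pos_blocks) ++
   last [::] pos_blocks = enum 'I_N.
Proof.
have sz : size pos_blocks = (size (bshape b)).-1.+1.
  by rewrite -(size_map size) -/(shape _) shape_pos /bshape size_rcons.
rewrite -[RHS](reshapeKr (sh := bshape b)) ?size_enum_ord ?sumn_bshape //.
rewrite -/pos_blocks -[in RHS](take_last [::] sz) flatten_cat /= cats0 //.
Qed.

Lemma pos_uniq : uniq (flatten (take (size (bshape b)).-1 pos_blocks) ++
   last [::] pos_blocks).
Proof. by rewrite pos_flatten enum_uniq. Qed.

Lemma pos_all x : x \in flatten (take (size (bshape b)).-1 pos_blocks) ++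
   last [::] pos_blocks.
Proof. by rewrite pos_flatten mem_enum. Qed.

(** A constant monomial in the first factor would give an empty vertex, which a partition does not
    allow; [bn0] excludes it. *)
Lemma pos_ne : [::] \notin take (size (bshape b)).-1 pos_blocks.
Proof.
apply/negP => h.
have : 0%N \in shape (take (size (bshape b)).-1 pos_blocks).
  by apply/mapP; exists [::].
rewrite /shape map_take -/(shape _) shape_pos {h}.
rewrite /bshape size_rcons /= -cats1 take_size_cat //.
case/mapP => y yb /esym/size0nil y0; case/negP: bn0.
suff -> : mset0 = y by [].
by rewrite -(seq_mset_id y) y0; apply/msetP => x; rewrite mset_seqE mset0E.
Qed.

Lemma Gpos_vwf : vwf Gpos.
Proof. exact: Gof_vwf pos_uniq pos_all pos_ne. Qed.

Lemma map_reshape (A C : Type) (f : A -> C) (sh : seq nat) (s : seq A) :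
  map (map f) (reshape sh s) = reshape sh (map f s).
Proof. by elim: sh s => //= k sh IH s; rewrite IH map_take map_drop. Qed.

Lemma Gpos_labB (l : 'I_N -> nat) :
  labB Gpos l = of_labels (bshape b) (map l (enum 'I_N)).
Proof.
rewrite /Gpos Gof_labB ?pos_uniq ?pos_ne // /of_labels -map_reshape.
rewrite -/pos_blocks /mkb map_take; congr (_, seq_mset _).
exact: esym (last_map (map l) _ [::]).
Qed.

(** Hence statements about basis elements, such as the formula for [act_coef], reduce to statements
    about labellings of the graph of positions. *)
Lemma Gpos_blab : labB Gpos blab = b.
Proof.
rewrite Gpos_labB.
have -> : map blab (enum 'I_N) = blabels b.
  rewrite /blab (map_comp (nth 0%N (blabels b)) val) val_enum_ord.
  by rewrite map_nth_iota0 // take_size.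
exact: of_labels_id.
Qed.

End Positions.
End BasisLabels.

(** * Labellings and the orthogonal action *)

Section Labellings.
Variable n : nat.

(** Labellings are functions on the whole type; a fixed value outside the half-edges of the graph
    makes each labelling count once. *)
Definition offz (T : finType) (D : {set T}) (l : {ffun T -> 'I_n.+1}) :=
  [forall h in ~: D, l h == ord0].
Definition econst (T : finType) (E : {set {set T}}) (l : {ffun T -> 'I_n.+1}) :=
  [forall e in E, forall h in e, forall h' in e, l h == l h'].

Lemma offzP (T : finType) (D : {set T}) (l : {ffun T -> 'I_n.+1}) :
  reflect (forall h, h \notin D -> l h = ord0) (offz D l).
Proof.
apply: (iffP forall_inP) => H h hD; apply/eqP; first by apply: H; rewrite inE.
by rewrite H //; rewrite inE in hD.
Qed.

Lemma econstP (T : finType) (E : {set {set T}}) (l : {ffun T -> 'I_n.+1}) :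
  reflect (forall e h h', e \in E -> h \in e -> h' \in e -> l h = l h') (econst E l).
Proof.
apply: (iffP forall_inP) => [H e h h' eE he he'|H e eE].
  by have /forall_inP/(_ _ he)/forall_inP/(_ _ he')/eqP := H _ eE.
by apply/forall_inP => h he; apply/forall_inP => h' he'; apply/eqP; exact: H he he'.
Qed.

Section Pull.
Variables (T T' : finType) (D : {set T}) (D' : {set T'}) (f : T -> T').
Hypotheses (fI : {in D &, injective f}) (fD : f @: D = D').

Definition pull (k : {ffun T' -> 'I_n.+1}) : {ffun T -> 'I_n.+1} :=
  [ffun h => if h \in D then k (f h) else ord0].
Definition push (k : {ffun T -> 'I_n.+1}) : {ffun T' -> 'I_n.+1} :=
  [ffun y => if [pick x in D | f x == y] is Some x then k x else ord0].

Lemma pull_offz k : offz D (pull k).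
Proof. by apply/offzP => h /negPf hD; rewrite ffunE hD. Qed.

Lemma push_offz k : offz D' (push k).
Proof.
apply/offzP => y yD; rewrite ffunE; case: pickP => // x /andP[xD /eqP fx].
by case/negP: yD; rewrite -fD -fx imset_f.
Qed.

Lemma pushK k : offz D k -> pull (push k) = k.
Proof.
move=> /offzP ok; apply/ffunP => h; rewrite !ffunE; case: ifPn => hD; last by rewrite ok.
case: pickP => [x /andP[xD /eqP /fI -> //]|/(_ h)]; by rewrite hD eqxx.
Qed.

Lemma pullK k : offz D' k -> push (pull k) = k.
Proof.
move=> /offzP ok; apply/ffunP => y; rewrite ffunE.
case: pickP => [x /andP[xD /eqP <-]|H]; first by rewrite ffunE xD.
rewrite ok // -fD; apply/imsetP => -[x xD e]; have := H x.
by rewrite xD e eqxx.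
Qed.

Lemma sum_pull (R : nmodType) (P : pred {ffun T -> 'I_n.+1})
   (F : {ffun T -> 'I_n.+1} -> R) :
  \sum_(k | offz D k && P k) F k =
  \sum_(k | offz D' k && P (pull k)) F (pull k).
Proof.
rewrite (reindex_onto pull push) /=; last by move=> k /andP[/pushK].
apply: eq_bigl => k; rewrite pull_offz /= andbC; congr (_ && _).
apply/eqP/idP => [<-|/pullK //]; exact: push_offz.
Qed.

End Pull.

Section PhiSum.
Variable K : fieldType.

Lemma PhiGE (T : finType) (G : pregraph T) b : vwf G ->
  PhiG K n G b = \sum_(l : {ffun T -> 'I_n.+1} | offz (hD G) l && econst (hE G) l)
     (labB G (fun h => val (l h)) == b)%:R.
Proof.
move=> vG; rewrite /PhiG -sum1_card natr_sum big_mkcond /=.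
rewrite [RHS]big_mkcond /=; apply: eq_bigr => l _.
rewrite inE /lab_ok lab_basisE // -/(econst _ _) -/(offz _ _).
by case: (econst _ _); case: (offz _ _) => //=; case: (_ == b).
Qed.

Lemma PhiG_bdeg (T : finType) (G : pregraph T) b : vwf G -> bdeg b != #|hD G| ->
  PhiG K n G b = 0.
Proof.
move=> vG bD; rewrite PhiGE // big1 // => l _; case: eqP => // e.
by rewrite -e bdeg_labB // eqxx in bD.
Qed.

Definition eiso (T T' : finType) (G : pregraph T) (G' : pregraph T') (f : T -> T') :=
  viso G G' f /\ [set f @: e | e : {set T} in hE G] = hE G'.

Lemma edge_subD (T : finType) (G : pregraph T) e :
  wf_graph G -> e \in hE G -> e \subset hD G.
Proof.
case/and5P => pE _ _ _ _ eE; rewrite -(cover_partition pE).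
exact: (bigcup_max e).
Qed.

Lemma PhiG_iso (T T' : finType) (G : pregraph T) (G' : pregraph T') f b :
  wf_graph G -> wf_graph G' -> eiso G G' f -> PhiG K n G b = PhiG K n G' b.
Proof.
move=> wG wG' [vf fE]; case: (vf) => fI fD fV fX.
have vG := wf_vwf wG; have vG' := wf_vwf wG'.
rewrite !PhiGE // (sum_pull fI fD) /=; apply: eq_big.
  move=> k; congr (_ && _); apply/econstP/econstP => H e h h' eE he he'.
    move: eE he he'; rewrite -fE => /imsetP[e0 e0E ->].
    move=> /imsetP[x xe ->] /imsetP[y ye ->].
    have := H _ _ _ e0E xe ye; rewrite !ffunE.
    by rewrite !(subsetP (edge_subD wG e0E)).
  rewrite !ffunE !(subsetP (edge_subD wG eE)) //.
  by apply: (H (f @: e)); rewrite -?fE imset_f.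
move=> k _; congr (_ == _)%:R; rewrite [RHS](viso_labB vG _ vf).
by apply: eq_labB => // h hd; rewrite ffunE hd.
Qed.

Lemma gisoP (T T' : finType) (G : pregraph T) (G' : pregraph T') :
  reflect (exists f, eiso G G' f) (giso G G').
Proof.
apply: (iffP existsP) => [[f /and5P[fI /eqP fD /eqP fE /eqP fV /eqP fX]]|].
  exists f; split=> //; split=> // x y xD yD e.
  have /forall_inP/(_ _ xD)/forall_inP/(_ _ yD)/implyP := fI.
  by rewrite e eqxx => /(_ isT)/eqP.
case=> f [[fI fD fV fX] fE].
have im (S : {set T}) : [ffun x => f x] @: S = f @: S.
  by apply: eq_imset => x; rewrite ffunE.
have im2 (S : {set {set T}}) : [set [ffun x => f x] @: e | e : {set T} in S] =
    [set f @: e | e : {set T} in S] by apply: eq_imset => e; rewrite im.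
exists [ffun x => f x]; rewrite !im2 im fD fV fX fE !eqxx !andbT.
apply/forall_inP => x xD; apply/forall_inP => y yD; apply/implyP.
by rewrite !ffunE => /eqP /fI ->.
Qed.

Section Action.
Variable g : 'M[K]_n.+1.

(** [act_coef] sums over tuples indexed by the positions in [blabels]. The bijection of [labB_lift]
    between [G] and the graph of positions reindexes this sum by labellings of the half-edges of
    [G]. *)
Lemma act_coef_labB (T : finType) (G : pregraph T) (l : T -> 'I_n.+1) b' :
  vwf G -> hD G != set0 ->
  act_coef g (labB G (fun h => val (l h))) b' =
  \sum_(k : {ffun T -> 'I_n.+1} | offz (hD G) k)
    (labB G (fun h => val (k h)) == b')%:R * \prod_(h in hD G) g (k h) (l h).
Proof.
move=> vG D0; set b := labB G _.
have bn : mset0 \notin b.1 by apply: labB_nmset0.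
have sz : size (blabels b) = #|hD G| by rewrite -bdegE bdeg_labB.
have t0 : 'I_(size (blabels b)).
  by have D1 : (0 < size (blabels b))%N; [rewrite sz card_gt0 | exact: Ordinal D1].
have vP := Gpos_vwf bn.
have eb : labB G (fun h => val (l h)) = labB (Gpos b) (@blab b).
  by rewrite Gpos_blab.
have [f vf fl] := labB_lift vG vP t0 eb.
case: (vf) => fI fD fV fX.
rewrite (eq_bigl (fun k => offz (hD G) k && true)); last by move=> k; rewrite andbT.
rewrite (sum_pull fI fD predT) /= /act_coef.
rewrite (reindex (fun k : {ffun 'I_(size (blabels b)) -> 'I_n.+1} =>
   [tuple k i | i < size (blabels b)])) /=; last first.
  exists (fun t : (size (blabels b)).-tuple 'I_n.+1 => [ffun i => tnth t i]).
    by move=> k _; apply/ffunP => i; rewrite ffunE tnth_mktuple.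
  by move=> t _; apply: eq_from_tnth => i; rewrite tnth_mktuple ffunE.
apply: eq_big => [k|k _].
  by rewrite andbT; apply/esym/offzP => h; rewrite inE.
apply: (f_equal2 *%R).
  apply: (f_equal (fun x : basis => (x == b')%:R : K)).
  rewrite /= -map_comp -Gpos_labB // (viso_labB vG _ vf) //.
  by apply: eq_labB => // h hd; rewrite /= ffunE hd.
rewrite (eq_bigl (fun p => p \in f @: hD G)); last by move=> p; rewrite fD inE.
rewrite big_imset //=; apply: eq_bigr => h hd.
rewrite tnth_mktuple ffunE hd /gent -/(blab (f h)) fl //.
by rewrite !ltn_ord /= !inord_val.
Qed.

Hypothesis gO : g *m g^T = 1%:M.

Lemma sum_labels_orth (T : finType) (G : pregraph T) (k : {ffun T -> 'I_n.+1}) :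
  wf_graph G ->
  \sum_(l : {ffun T -> 'I_n.+1} | offz (hD G) l && econst (hE G) l)
     \prod_(h in hD G) g (k h) (l h) = (econst (hE G) k)%:R.
Proof.
move=> wG; case/and5P: (wG) => pE /forall_inP cE _ _ _.
have tE := partition_trivIset pE.
(* A labelling constant on edges is the same as a function on the set of edges; [toL] and [toM] are
   the two directions, with [ord0] as value off the edges. *)
pose toL (m : {ffun {set T} -> 'I_n.+1}) : {ffun T -> 'I_n.+1} :=
  [ffun h => if h \in hD G then m (pblock (hE G) h) else ord0].
pose toM (l : {ffun T -> 'I_n.+1}) : {ffun {set T} -> 'I_n.+1} :=
  [ffun e => if e \in hE G then (if [pick h in e] is Some h then l h else ord0) else ord0].
have ne e : e \in hE G -> exists h, h \in e.
  by move=> /cE/eqP ce; apply/card_gt0P; rewrite ce.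
have pb h : h \in hD G -> pblock (hE G) h \in hE G.
  by move=> hd; rewrite pblock_mem // (cover_partition pE).
have hpb h : h \in hD G -> h \in pblock (hE G) h.
  by move=> hd; rewrite mem_pblock (cover_partition pE).
rewrite (reindex_onto toL toM) /=; last first.
  move=> l /andP[/offzP lo /econstP lc]; apply/ffunP => h; rewrite !ffunE.
  case: ifPn => hd; last by rewrite lo.
  rewrite pb //; case: pickP => [x xe|/(_ h)]; last by rewrite hpb.
  by apply: (lc _ _ _ (pb _ hd) xe); apply: hpb.
have toLE m h e : e \in hE G -> h \in e -> toL m h = m e.
  move=> eE he; rewrite ffunE (subsetP (edge_subD wG eE)) //.
  by rewrite (def_pblock tE eE he).
transitivity (\sum_(m in pffun_on (ord0 : 'I_n.+1) (mem (hE G)) predT)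
   \prod_(e in hE G) \prod_(h in e) g (k h) (m e)).
  apply: eq_big => [m|m _]; last first.
    rewrite -(cover_partition pE) big_trivIset //=; apply: eq_bigr => e eE.
    by apply: eq_bigr => h he; rewrite (toLE _ _ _ eE he).
  have -> : offz (hD G) (toL m).
    by apply/offzP => h /negPf hd; rewrite ffunE hd.
  have -> : econst (hE G) (toL m).
    by apply/econstP => e h h' eE he he'; rewrite !(toLE _ _ _ eE).
  rewrite /=; apply/eqP/pffun_onP.
    move=> <-; split; last by move=> x _.
    by apply/subsetP => e; rewrite !inE ffunE; case: ifP; rewrite ?eqxx.
  case=> /subsetP sm _; apply/ffunP => e; rewrite ffunE; case: ifPn => eE.
    case: pickP => [h he|H]; first by rewrite (toLE _ _ _ eE he).
    by have [h he] := ne _ eE; have := H h; rewrite he.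
  by apply/eqP; rewrite eq_sym; apply: contraNT eE => /sm.
(* The sum of products over the edges becomes a product over the edges of sums over one label, and
   the factor of the edge {x, y} is the entry of g g^T at (k x, k y). *)
rewrite -(big_distr_big _ (mem (hE G)) predT (fun e i => \prod_(h in e) g (k h) i)) /=.
have edge e : e \in hE G -> \sum_i \prod_(h in e) g (k h) i =
    [forall h in e, forall h' in e, k h == k h']%:R.
  move=> eE; have /cards2P[x [y [xy ->]]] := cE _ eE.
  transitivity ((g *m g^T) (k x) (k y)).
    rewrite mxE; apply: eq_bigr => i _; rewrite mxE.
    by rewrite big_setU1 ?inE //= big_set1.
  rewrite gO mxE; congr (_ %:R); congr nat_of_bool.
  apply/eqP/forall_inP => [kxy h|H].
    rewrite !inE => hxy; apply/forall_inP => h'; rewrite !inE => hxy'.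
    by move: hxy hxy' => /orP[] /eqP -> /orP[] /eqP ->; rewrite ?kxy.
  have /forall_inP H' := H x (set21 _ _).
  by apply/eqP; apply: H'; rewrite set22.
case: (boolP (econst (hE G) k)) => [/forall_inP ek|].
  by rewrite big1 // => e eE; rewrite edge // ek.
rewrite negb_forall_in => /exists_inP[e eE /negPf ne'].
by rewrite (bigD1 e) //= edge // ne' mul0r.
Qed.

Lemma act_PhiG (T : finType) (G : pregraph T) b' : wf_graph G -> hD G != set0 ->
  \sum_(l : {ffun T -> 'I_n.+1} | offz (hD G) l && econst (hE G) l)
     act_coef g (labB G (fun h => val (l h))) b' = PhiG K n G b'.
Proof.
move=> wG D0; have vG := wf_vwf wG.
under eq_bigr do rewrite act_coef_labB //.
rewrite exchange_big /= PhiGE // big_mkcondr /=; apply: eq_bigr => k _.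
rewrite -mulr_sumr sum_labels_orth //.
by case: (econst _ _); rewrite ?mulr1 ?mulr0.
Qed.

End Action.
End PhiSum.
End Labellings.

(** * Graphs, connectedness and isomorphism *)

Section GraphTheory.

Lemma wf_partE (T : finType) (G : pregraph T) : wf_graph G -> partition (hE G) (hD G).
Proof. by case/and5P. Qed.
Lemma wf_card2 (T : finType) (G : pregraph T) e : wf_graph G -> e \in hE G -> #|e| = 2%N.
Proof. by case/and5P => _ /forall_inP H _ _ _ /H/eqP. Qed.

Lemma block_uniq (T : finType) (P : {set {set T}}) D B C x :
  partition P D -> B \in P -> C \in P -> x \in B -> x \in C -> B = C.
Proof.
move=> /partition_trivIset tP BP CP xB xC.
by rewrite -(def_pblock tP BP xB) (def_pblock tP CP xC).
Qed.

Lemma in_block (T : finType) (P : {set {set T}}) (D : {set T}) x :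
  partition P D -> x \in D -> exists2 B, B \in P & x \in B.
Proof. by move=> pP; rewrite -(cover_partition pP) => /bigcupP[B]; exists B. Qed.

Section Partner.
Variables (T : finType) (G : pregraph T).
Hypothesis wG : wf_graph G.

Lemma edgeP e x y : e \in hE G -> x \in e -> y \in e -> x != y -> e = [set x; y].
Proof.
move=> eE xe ye xy; apply/esym/eqP; rewrite eqEcard (wf_card2 wG eE) cards2 xy.
by rewrite andbT subUset !sub1set xe ye.
Qed.

Lemma card_D : #|hD G| = (2 * #|hE G|)%N.
Proof.
rewrite (card_partition (wf_partE wG)) (eq_bigr (fun _ => 2%N)); last first.
  by move=> e; apply: wf_card2.
by rewrite sum_nat_const mulnC.
Qed.

(** A union of connected components. Connectedness is established and used through such sets, so
    that no path has to be transported along an isomorphism or through an insertion. *)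
Definition block_closed (S : {set T}) := forall B h h', B \in hV G :|: hE G ->
  h \in B -> h' \in B -> h \in S -> h' \in S.

Lemma block_subD B : B \in hV G :|: hE G -> B \subset hD G.
Proof. by case/setUP => [/(vwf_subD (wf_vwf wG))|/(edge_subD wG)]. Qed.

Lemma connected_closed (S : {set T}) : connectedg G -> S \subset hD G -> S != set0 ->
  block_closed S -> S = hD G.
Proof.
move=> /andP[_ /forall_inP cG] SD /set0Pn[x xS] cl.
have cS : closed (hadj G) (mem S).
  move=> h h' /and3P[_ _ /existsP[B /and3P[BP hB hB']]].
  by apply/idP/idP; apply: (cl B).
apply/eqP; rewrite eqEsubset SD /=; apply/subsetP => y yD.
have /forall_inP/(_ _ yD) := cG _ (subsetP SD _ xS).
by move=> /(closed_connect cS); rewrite [RHS]/= => <-.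
Qed.

Lemma closed_connected : hD G != set0 ->
  (forall S : {set T}, S \subset hD G -> S != set0 -> block_closed S -> S = hD G) ->
  connectedg G.
Proof.
move=> D0 H; rewrite /connectedg D0 /=; apply/forall_inP => x xD.
apply/forall_inP => y yD.
have : [set z in hD G | connect (hadj G) x z] = hD G.
  apply: H.
  - by apply/subsetP => z; rewrite inE => /andP[].
  - by apply/set0Pn; exists x; rewrite inE xD connect0.
  - move=> B h h' BP hB hB'; rewrite !inE => /andP[hd ch].
    have hd' := subsetP (block_subD BP) _ hB'.
    rewrite hd' /=; apply: (connect_trans ch); apply: connect1.
    by rewrite /hadj hd hd' /=; apply/exists_inP; exists B => //; rewrite hB.
by move/setP/(_ y); rewrite inE yD.
Qed.

Hypotheses (cG : connectedg G) (iG : has_int_edge G).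

(** An edge with two external ends is a connected component by itself, hence the whole graph, which
    then has no internal edge. *)
Lemma ext_edge1 e x y : e \in hE G -> x \in e -> y \in e ->
  x \in cover (hX G) -> y \in cover (hX G) -> x = y.
Proof.
move=> eE xe ye; have vG := wf_vwf wG; rewrite !coverXE // => xX yX.
apply/eqP/negPn/negP => xy; have eE2 := edgeP eE xe ye xy.
have eD : e = hD G.
  apply: connected_closed => //; first exact: edge_subD.
    by apply/set0Pn; exists x.
  move=> B h h' /setUP[] BP hB hB' he; last first.
    by rewrite -(block_uniq (wf_partE wG) BP eE hB he).
  have hV1 z : [set z] \in hX G -> z \in B -> B = [set z].
    move=> zX zB; apply: (block_uniq (vwf_part vG) BP _ zB); last by rewrite inE.
    exact: (subsetP (vwf_sub vG)).
  move: (he); rewrite eE2 !inE => /orP[] /eqP e1; subst h.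
    by move: hB'; rewrite (hV1 _ xX hB) inE => ->.
  by move: hB'; rewrite (hV1 _ yX hB) inE orbC => ->.
case/exists_inP: iG => e' eE' /negP; apply.
have /card_gt0P[z ze'] : (0 < #|e'|)%N by rewrite (wf_card2 wG).
have ze : z \in e by rewrite eD (subsetP (edge_subD wG eE')).
rewrite -(block_uniq (wf_partE wG) eE eE' ze ze').
by apply/exists_inP; exists [set x]; rewrite ?sub1set.
Qed.

(** Sending an external half-edge to its edge is injective by [ext_edge1] and misses an internal
    edge. This is the inequality N > k for graphs. *)
Lemma card_X_lt_E : (#|hX G| < #|hE G|)%N.
Proof.
have vG := wf_vwf wG; have pE := wf_partE wG.
have cX : #|hX G| = #|cover (hX G)|.
  have tX : trivIset (hX G).
    apply: trivIsetS (partition_trivIset (vwf_part vG)); exact: vwf_sub.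
  rewrite -(eqP tX) (eq_bigr (fun _ => 1%N)) ?sum1_card // => u.
  exact: vwf_card1.
have inD x : x \in cover (hX G) -> x \in cover (hE G).
  by move=> /(subsetP (coverX_sub vG)); rewrite (cover_partition pE).
case/exists_inP: iG => e0 eE0 ne0.
rewrite cX -(card_in_imset (f := pblock (hE G))); last first.
  move=> x y xX yX e; apply: (@ext_edge1 (pblock (hE G) x)) => //.
  - by apply: pblock_mem; apply: inD.
  - by rewrite mem_pblock inD.
  - by rewrite e mem_pblock inD.
rewrite (cardsD1 e0 (hE G)) eE0 add1n ltnS; apply: subset_leq_card.
apply/subsetP => _ /imsetP[x xX ->]; rewrite !inE.
have xe : x \in pblock (hE G) x by rewrite mem_pblock inD.
rewrite pblock_mem ?inD // andbT; apply: contraNneq ne0 => <-.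
by apply/exists_inP; exists [set x]; rewrite ?sub1set // -coverXE.
Qed.

End Partner.

Section Eiso.

Lemma eiso_trans (T T' T'' : finType) (G : pregraph T) (G' : pregraph T')
   (G'' : pregraph T'') f g :
  eiso G G' f -> eiso G' G'' g -> eiso G G'' (g \o f).
Proof.
move=> [[fI fD fV fX] fE] [[gI gD gV gX] gE].
have comp (P : {set {set T}}) : [set (g \o f) @: v | v : {set T} in P] =
    [set g @: v | v : {set T'} in [set f @: v | v : {set T} in P]].
  by rewrite -imset_comp; apply: eq_imset => v /=; rewrite imset_comp.
split; last by rewrite comp fE.
split; [|by rewrite imset_comp fD|by rewrite comp fV|by rewrite comp fX].
by move=> x y xD yD /gI e; apply: fI => //; apply: e; rewrite -fD imset_f.
Qed.

(** Inverting a map only requires the blocks of [G] to lie in its domain. This weak hypothesis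
    serves to pull well-formedness back from [G'] to [G], where it cannot be presupposed. *)
Lemma eiso_sym_sub (T T' : finType) (t0 : T) (G : pregraph T) (G' : pregraph T') f :
  (forall S, S \in hE G :|: hV G :|: hX G -> S \subset hD G) ->
  eiso G G' f -> exists g, eiso G' G g.
Proof.
move=> sub [[fI fD fV fX] fE].
pose g y := odflt t0 [pick x in hD G | f x == y].
have gK x : x \in hD G -> g (f x) = x.
  move=> xD; rewrite /g; case: pickP => [z /andP[zD /eqP /fI -> //]|/(_ x)].
  by rewrite xD eqxx.
have gim (S : {set T}) : S \subset hD G -> g @: (f @: S) = S.
  move=> SD; rewrite -imset_comp; apply/setP => x; apply/imsetP/idP.
    by case=> y yS -> /=; rewrite gK // (subsetP SD).
  by move=> xS; exists x; rewrite //= gK // (subsetP SD).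
have gim2 (P : {set {set T}}) : (forall S, S \in P -> S \subset hD G) ->
    [set g @: v | v : {set T'} in [set f @: v | v : {set T} in P]] = P.
  move=> PD; rewrite -imset_comp; apply/setP => x; apply/imsetP/idP.
    by case=> y yS -> /=; rewrite gim // PD.
  by move=> xS; exists x; rewrite //= gim // PD.
exists g; split; last by rewrite -fE gim2 // => S SE; apply: sub; rewrite !inE SE.
split.
- by move=> y y'; rewrite -fD => /imsetP[x xD ->] /imsetP[x' xD' ->]; rewrite !gK // => ->.
- by rewrite -fD gim.
- by rewrite -fV gim2 // => S SE; apply: sub; rewrite !inE SE orbT.
- by rewrite -fX gim2 // => S SE; apply: sub; rewrite !inE SE orbT.
Qed.

Lemma eiso_sym (T T' : finType) (t0 : T) (G : pregraph T) (G' : pregraph T') f :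
  wf_graph G -> eiso G G' f -> exists g, eiso G' G g.
Proof.
move=> wG; apply: eiso_sym_sub => // S; rewrite !inE => /orP[/orP[]|].
- exact: edge_subD.
- exact: vwf_subD (wf_vwf wG) _.
- by move=> SX; apply: vwf_subD (wf_vwf wG) _ _; apply: (subsetP (vwf_sub (wf_vwf wG))).
Qed.

Lemma eiso_id (T : finType) (G : pregraph T) : eiso G G id.
Proof.
have im (P : {set {set T}}) : [set id @: v | v : {set T} in P] = P.
  rewrite -[RHS]imset_id; apply: eq_imset => v; exact: imset_id.
by split; rewrite ?im //; split; rewrite ?im ?imset_id.
Qed.

Lemma partition_imset (T T' : finType) (f : T -> T') (P : {set {set T}}) (D : {set T}) :
  {in D &, injective f} -> partition P D ->
  partition [set f @: v | v : {set T} in P] (f @: D).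
Proof.
move=> fI pP; have sub v : v \in P -> v \subset D.
  by move=> vP; rewrite -(cover_partition pP); apply: (bigcup_max v).
apply/and3P; split.
- apply/eqP/setP => y; apply/bigcupP/imsetP.
    case=> _ /imsetP[v vP ->] /imsetP[x xv ->]; exists x => //.
    exact: (subsetP (sub _ vP)).
  case=> x /(in_block pP)[v vP xv] ->; exists (f @: v); exact: imset_f.
- apply/trivIsetP => _ _ /imsetP[v vP ->] /imsetP[w wP ->].
  apply: contraR => /pred0Pn[_ /= /andP[/imsetP[x xv ->] /imsetP[y yw e]]].
  rewrite (block_uniq pP vP wP xv) // (fI _ _ _ _ e) //.
    exact: (subsetP (sub _ vP)).
  exact: (subsetP (sub _ wP)).
- apply/imsetP => -[v vP /esym/eqP]; rewrite imset_eq0 => /eqP v0.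
  by case/and3P: pP; rewrite -v0 vP.
Qed.

Lemma eiso_wf (T T' : finType) (G : pregraph T) (G' : pregraph T') f :
  wf_graph G -> eiso G G' f -> wf_graph G'.
Proof.
move=> wG [[fI fD fV fX] fE]; have vG := wf_vwf wG.
have card (v : {set T}) : v \subset hD G -> #|f @: v| = #|v|.
  by move=> vD; apply: card_in_imset => x y xv yv; apply: fI; apply: (subsetP vD).
apply/and5P; split.
- by rewrite -fE -fD partition_imset // wf_partE.
- apply/forall_inP => e; rewrite -fE => /imsetP[e0 e0E ->].
  by rewrite card ?(wf_card2 wG e0E) // edge_subD.
- by rewrite -fV -fD partition_imset // vwf_part.
- by rewrite -fV -fX imsetS // vwf_sub.
- apply/forall_inP => u; rewrite -fX => /imsetP[u0 u0X ->].
  rewrite card ?(vwf_card1 vG u0X) // vwf_subD //.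
  exact: (subsetP (vwf_sub vG)).
Qed.

Lemma eiso_connected (T T' : finType) (G : pregraph T) (G' : pregraph T') f :
  wf_graph G -> eiso G G' f -> connectedg G -> connectedg G'.
Proof.
move=> wG eI cG; have wG' := eiso_wf wG eI; case: eI => [[fI fD fV fX] fE].
apply: closed_connected => //.
  by rewrite -fD imset_eq0; case/andP: cG.
move=> S SD S0 cl; pose S1 := [set x in hD G | f x \in S].
have : S1 = hD G.
  apply: connected_closed => //.
  - by apply/subsetP => x; rewrite inE => /andP[].
  - case/set0Pn: S0 => y yS; have := subsetP SD _ yS; rewrite -fD.
    by case/imsetP => x xD e; apply/set0Pn; exists x; rewrite inE xD -e.
  - move=> B h h' BP hB hB'; rewrite !inE => /andP[hd fh].
    rewrite (subsetP (block_subD wG BP)) //=.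
    apply: (cl (f @: B) (f h)) => //; try exact: imset_f.
    by rewrite -fV -fE -imsetU imset_f.
move=> S1D; apply/eqP; rewrite eqEsubset SD; apply/subsetP => y.
by rewrite -fD => /imsetP[x xD ->]; move: xD; rewrite -S1D inE => /andP[].
Qed.

Lemma eiso_int_edge (T T' : finType) (G : pregraph T) (G' : pregraph T') f :
  wf_graph G -> eiso G G' f -> has_int_edge G -> has_int_edge G'.
Proof.
move=> wG eI; have wG' := eiso_wf wG eI; case: eI => [[fI fD fV fX] fE].
have vG := wf_vwf wG.
case/exists_inP => e eE /negP ne; apply/exists_inP; exists (f @: e).
  by rewrite -fE imset_f.
apply/negP => /exists_inP[w]; rewrite -fX => /imsetP[u uX ->] /subsetP ue.
apply: ne; apply/exists_inP; exists u => //; apply/subsetP => x xu.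
have /ue/imsetP[y ye /fI ->//] : f x \in f @: u by apply: imset_f.
  apply: (subsetP (coverX_sub vG)); by apply/bigcupP; exists u.
exact: (subsetP (edge_subD wG eE)).
Qed.

Lemma eiso_D (T T' : finType) (G : pregraph T) (G' : pregraph T') f :
  eiso G G' f -> #|hD G'| = #|hD G|.
Proof. by case=> [[fI fD fV fX] fE]; rewrite -fD card_in_imset. Qed.

Definition exact_lab (T : finType) (G : pregraph T) (l : T -> nat) :=
  forall h h', h \in hD G -> h' \in hD G ->
    (l h == l h') = (pblock (hE G) h == pblock (hE G) h').

(** Under the vertex bijection of [labB_lift] the two ends of an edge of [G'] carry equal labels, so
    exactness of [l] puts them on one edge of [G]. Every edge of [G] is reached because the numbers
    of half-edges, hence of edges, agree. *)
Lemma exact_eiso (T T' : finType) (G : pregraph T) (G' : pregraph T') (t0 : T)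
    (l : T -> nat) (l' : T' -> nat) :
  wf_graph G -> wf_graph G' -> exact_lab G l ->
  (forall e h h', e \in hE G' -> h \in e -> h' \in e -> l' h = l' h') ->
  labB G' l' = labB G l -> exists f, eiso G' G f.
Proof.
move=> wG wG' ex lc e.
have [f vf fl] := labB_lift (wf_vwf wG') (wf_vwf wG) t0 e.
exists f; split=> //; case: (vf) => fI fD fV fX.
have pE := wf_partE wG.
have imI : {in hE G' &, injective (fun e : {set T'} => f @: e)}.
  by move=> v w vE wE; apply: (imset_inj_in fI); rewrite inE /= edge_subD.
apply/eqP; rewrite eqEcard card_in_imset //; apply/andP; split.
  apply/subsetP => _ /imsetP[e' eE' ->].
  have /eqP/cards2P[x [y [xy e'E]]] := wf_card2 wG' eE'.
  have xe : x \in e' by rewrite e'E set21.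
  have ye : y \in e' by rewrite e'E set22.
  have xD := subsetP (edge_subD wG' eE') _ xe.
  have yD := subsetP (edge_subD wG' eE') _ ye.
  have fxD : f x \in hD G by rewrite -fD imset_f.
  have fyD : f y \in hD G by rewrite -fD imset_f.
  have : l (f x) == l (f y) by rewrite !fl // (lc _ _ _ eE' xe ye).
  rewrite ex // => /eqP pxy.
  have pbE : pblock (hE G) (f x) \in hE G by rewrite pblock_mem // (cover_partition pE).
  rewrite e'E imsetU !imset_set1 -(edgeP wG pbE) //.
  - by rewrite mem_pblock (cover_partition pE).
  - by rewrite pxy mem_pblock (cover_partition pE).
  - by apply: contra_neq xy => /fI ->.
rewrite -(leq_pmul2l (isT : (0 < 2)%N)) -!card_D // -fD card_in_imset //.
Qed.

Lemma exact_lab_const (T : finType) (G : pregraph T) l e h h' :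
  wf_graph G -> exact_lab G l -> e \in hE G -> h \in e -> h' \in e -> l h = l h'.
Proof.
move=> wG ex eE he he'; have tE := partition_trivIset (wf_partE wG).
have sD := subsetP (edge_subD wG eE).
by apply/eqP; rewrite ex ?sD // (def_pblock tE eE he) (def_pblock tE eE he').
Qed.

End Eiso.
End GraphTheory.

(** * The map Phi *)

Section PhiTheory.
Variable K : fieldType.
Hypothesis charK : [pchar K] =i pred0.

Lemma natK_neq0 k : (0 < k)%N -> k%:R != 0 :> K.
Proof. by move=> k0; have /pcharf0P -> := charK; rewrite -lt0n. Qed.

Lemma giso_refl (T : finType) (G : pregraph T) : giso G G.
Proof. by apply/gisoP; exists id; apply: eiso_id. Qed.

Lemma giso_sym (T T' : finType) (t0 : T) (G : pregraph T) (G' : pregraph T') :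
  wf_graph G -> giso G G' -> giso G' G.
Proof.
by move=> wG /gisoP[f fI]; apply/gisoP; apply: eiso_sym fI.
Qed.

Lemma giso_trans (T T' T'' : finType) (G : pregraph T) (G' : pregraph T')
    (G'' : pregraph T'') : giso G G' -> giso G' G'' -> giso G G''.
Proof.
move=> /gisoP[f fI] /gisoP[g gI]; apply/gisoP; exists (g \o f).
exact: eiso_trans fI gI.
Qed.

Lemma giso_wf (T T' : finType) (G : pregraph T) (G' : pregraph T') :
  giso G G' -> wf_graph G -> wf_graph G'.
Proof. by move=> /gisoP[f fI] wG; apply: eiso_wf wG fI. Qed.

Lemma ncls_neq0 h (G : pregraph 'I_h) : ncls K G != 0.
Proof.
by apply: natK_neq0; apply/card_gt0P; exists G; rewrite inE giso_refl.
Qed.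

Lemma ncls_iso h (t0 : 'I_h) (G G' : pregraph 'I_h) :
  wf_graph G -> giso G G' -> ncls K G' = ncls K G.
Proof.
move=> wG GG'; rewrite /ncls; congr (_%:R); apply: eq_card => H; rewrite !inE.
apply/idP/idP; first exact: giso_trans.
by apply: giso_trans; apply: giso_sym.
Qed.

(** The weights 1/#class add up to 1 over a class; characteristic zero makes the class size
    invertible. *)
Lemma sum_class h (t0 : 'I_h) (G : pregraph 'I_h) (F : pregraph 'I_h -> K) :
  wf_graph G -> (forall G', giso G G' -> F G' = F G) ->
  \sum_(G' | giso G G') F G' / ncls K G' = F G.
Proof.
move=> wG FI; rewrite (eq_bigr (fun _ => F G / ncls K G)); last first.
  by move=> G' GG'; rewrite FI // (ncls_iso t0 wG GG').
rewrite sumr_const -[#|_|](cardsE (giso G)) -mulr_natr -/(ncls K G).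
by rewrite mulfVK // ncls_neq0.
Qed.

(** The part of [in_Hc] that makes [Phi] a finite sum. It is immediate for [inv_Phi] and for
    [Hcirc], before these are known to consist of connected graphs with an internal edge. *)
Definition wsupp (c : Hser K) := forall h (G : pregraph 'I_h), c h G != 0 ->
  wf_graph G && (hD G == setT).
Definition isoinv (c : Hser K) := forall h (G G' : pregraph 'I_h),
  giso G G' -> c h G = c h G'.

Lemma in_Hc_wsupp c : in_Hc c -> wsupp c.
Proof. by case=> H _ h G /H/and4P[-> ->]. Qed.

(** The degree of a basis element is the number of half-edges of every graph contributing to it, so
    a single [h] survives. *)
Lemma Phi_bdeg c n b h : wsupp c -> bdeg b = h ->
  Phi c n b = \sum_(G : pregraph 'I_h) c h G / ncls K G * PhiG K n G b.
Proof.
move=> wc bh; rewrite /Phi (fsum1 (t := h)) // => h' hh'.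
rewrite big1 // => G _; have [->|cG] := eqVneq (c h' G) 0; first by rewrite !mul0r.
have /andP[wG /eqP DG] := wc _ _ cG.
rewrite PhiG_bdeg ?mulr0 ?wf_vwf // DG cardsT card_ord bh.
by rewrite eq_sym.
Qed.

Lemma Phi_witness c n b : wsupp c -> Phi c n b != 0 ->
  exists h (G : pregraph 'I_h) (l : {ffun 'I_h -> 'I_n.+1}),
   [/\ c h G != 0, wf_graph G, hD G = setT, econst (hE G) l &
       b = labB G (fun i => val (l i))].
Proof.
move=> wc; rewrite (Phi_bdeg n wc (erefl _)) => P0.
suff [G cG] : exists G : pregraph 'I_(bdeg b), c _ G / ncls K G * PhiG K n G b != 0.
  have cG0 : c _ G != 0 by apply: contraNneq cG => ->; rewrite !mul0r.
  have /andP[wG /eqP DG] := wc _ _ cG0.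
  have : PhiG K n G b != 0 by apply: contraNneq cG => ->; rewrite mulr0.
  rewrite PhiGE ?wf_vwf // => S0.
  have [l /andP[lo lc] lb] : exists2 l : {ffun 'I_(bdeg b) -> 'I_n.+1},
     offz (hD G) l && econst (hE G) l & labB G (fun i => val (l i)) == b.
    apply/exists_inP; apply: contraNT S0 => /exists_inPn H.
    by rewrite big1 // => l /H /negPf ->.
  by exists (bdeg b), G, l; rewrite (eqP lb).
apply/existsP; apply: contraNT P0 => /existsPn H.
by rewrite big1 // => G _; apply/eqP; rewrite -[_ == _]negbK; apply: H.
Qed.

Lemma b_plus_labB (T : finType) (G : pregraph T) l :
  wf_graph G -> connectedg G -> has_int_edge G -> b_plus (labB G l).
Proof.
move=> wG cG iG; rewrite /b_plus bdeg_labB ?mdeg_labB2 ?wf_vwf // card_D //.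
by rewrite oddM /= ltn_pmul2l //; apply: card_X_lt_E.
Qed.

Lemma Phi_supp (c : Hser K) n : in_Hc c -> supp_plus n.+1 (Phi c n).
Proof.
move=> hc b /(Phi_witness (in_Hc_wsupp hc))[h [G [l [cG wG DG _ ->]]]].
have [/(_ _ _ cG) /and4P[_ _ coG iG] _] := hc.
by rewrite b_in_labB ?wf_vwf //= b_plus_labB.
Qed.

Lemma perm_blabels_of_labels b k : size k = size (blabels b) ->
  perm_eq (blabels (of_labels (bshape b) k)) k.
Proof.
move=> sk; rewrite (permPl (perm_blabels_mkb _ _)).
set r := reshape _ _.
have sz : size r = (size (bshape b)).-1.+1.
  by rewrite size_reshape /bshape size_rcons.
have -> : flatten (take (size (bshape b)).-1 r) ++ last [::] r = flatten r.
  by rewrite -[in RHS](take_last [::] sz) flatten_cat /= cats0.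
by rewrite reshapeKr ?sk ?sumn_bshape.
Qed.

Lemma act_coef_bdeg n (g : 'M[K]_n.+1) b b' : act_coef g b b' != 0 -> bdeg b = bdeg b'.
Proof.
move=> a0.
have [k /eqP kb] : exists k : (size (blabels b)).-tuple 'I_n.+1,
    of_labels (bshape b) (map val k) == b'.
  apply/existsP; apply: contraNT a0 => /existsPn H.
  by rewrite /act_coef big1 // => k _; rewrite (negPf (H k)) mul0r.
by rewrite -kb !bdegE (perm_size (perm_blabels_of_labels _)) ?size_map ?size_tuple.
Qed.

Lemma Phi_Oinv (c : Hser K) n : in_Hc c -> Oinv n (Phi c n).
Proof.
move=> hc g gO b'; have wc := in_Hc_wsupp hc; rewrite /act.
set H := bdeg b'.
(* Graph and labelling form one index, with weight 0 for labellings that are not admissible, so that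
   [fsum_delta] applies. *)
pose w (i : pregraph 'I_H * {ffun 'I_H -> 'I_n.+1}) : K :=
  if offz (hD i.1) i.2 && econst (hE i.1) i.2 then c H i.1 / ncls K i.1 else 0.
transitivity (fsum (fun b => \sum_i w i *
   (labB i.1 (fun h => val (i.2 h)) == b)%:R * act_coef g b b')).
  apply: eq_fsum => b.
  (* The action preserves the degree, so all contributing [b] see the same set of graphs, those on
     [H] half-edges. *)
  have [->|a0] := eqVneq (act_coef g b b') 0.
    by rewrite mulr0 big1 // => i _; rewrite mulr0.
  rewrite -mulr_suml; congr (_ * _).
  rewrite (Phi_bdeg n wc (act_coef_bdeg a0)) -/H.
  rewrite -(pair_bigA _ (fun G l => w (G, l) * (labB G (fun h => val (l h)) == b)%:R)) /=.
  apply: eq_bigr => G _.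
  have [c0|cG] := eqVneq (c H G) 0.
    rewrite c0 !mul0r big1 // => l _; rewrite /w /= c0 mul0r.
    by rewrite if_same mul0r.
  have /andP[wG _] := wc _ _ cG.
  rewrite PhiGE ?wf_vwf // mulr_sumr big_mkcond /=; apply: eq_bigr => l _.
  by rewrite /w /=; case: ifP; rewrite ?mul0r.
rewrite fsum_delta (Phi_bdeg n wc (erefl _)) -/H.
rewrite -(pair_bigA _ (fun G l => w (G, l) * act_coef g (labB G (fun h => val (l h))) b')) /=.
apply: eq_bigr => G _.
have [c0|cG] := eqVneq (c H G) 0.
  rewrite c0 !mul0r big1 // => l _; rewrite /w /= c0 mul0r.
  by rewrite if_same mul0r.
have [/(_ _ _ cG) /and4P[wG _ coG _] _] := hc.
rewrite -(act_PhiG gO) //; last by case/andP: coG.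
rewrite mulr_sumr [RHS]big_mkcond /=; apply: eq_bigr => l _.
by rewrite /w /=; case: ifP; rewrite ?mul0r.
Qed.

Lemma PhiG_compat (T : finType) (G : pregraph T) n b : vwf G ->
  b_all (fun i => (i < n.+1)%N) b -> PhiG K n.+1 G b = PhiG K n G b.
Proof.
move=> vG; rewrite b_allE => bn; rewrite /PhiG; congr (_%:R).
pose W (l : {ffun T -> 'I_n.+1}) : {ffun T -> 'I_n.+2} :=
  [ffun h => widen_ord (leqnSn n.+1) (l h)].
have Winj : injective W.
  move=> l l' /ffunP e; apply/ffunP => h; have := e h; rewrite !ffunE => /(f_equal val).
  by move=> /= /val_inj.
rewrite -(card_imset _ Winj); apply: eq_card => k; rewrite inE.
have Wok l : lab_ok G (W l) = lab_ok G l.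
  rewrite /lab_ok; congr (_ && _).
    apply: eq_forallb => e; congr (_ ==> _); apply: eq_forallb => h.
    by congr (_ ==> _); apply: eq_forallb => h'; rewrite !ffunE -!val_eqE /=.
  by apply: eq_forallb => h; rewrite !ffunE -!val_eqE /=.
have Wlab l : labB G (fun h => val (W l h)) = labB G (fun h => val (l h)).
  by apply: eq_labB => // h _; rewrite ffunE.
apply/idP/imsetP => [/andP[ok lb]|[l]]; last first.
  rewrite inE => /andP[okl lbl] ->; apply/andP; split; first by rewrite Wok.
  by move: lbl; rewrite !(lab_basisE _ vG) Wlab.
(* The label of a half-edge of [G] occurs in [b], hence is at most [n]; outside [G] the label is
   [ord0]. *)
have kb h : (k h < n.+1)%N.
  have [hd|hd] := boolP (h \in hD G); last first.
    by case/andP: ok => _ /forall_inP/(_ h); rewrite inE hd => /(_ isT)/eqP ->.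
  move: lb; rewrite lab_basisE // => /eqP lb.
  have /allP := bn; apply; rewrite -lb (perm_mem (perm_blabels_labB vG _)).
  by apply/mapP; exists h; rewrite ?mem_enum.
pose l := [ffun h => Ordinal (kb h)] : {ffun T -> 'I_n.+1}.
have kl : k = W l by apply/ffunP => h; rewrite !ffunE; apply: val_inj.
exists l; [|exact: kl].
rewrite inE -Wok -kl ok /=; move: lb; rewrite !(lab_basisE _ vG) -Wlab -kl.
exact.
Qed.

Lemma Phi_compat c n b : wsupp c -> b_all (fun i => (i < n.+1)%N) b ->
  Phi c n.+1 b = Phi c n b.
Proof.
move=> wc bn; rewrite !(Phi_bdeg _ wc (erefl _)); apply: eq_bigr => G _.
have [->|cG] := eqVneq (c _ G) 0; first by rewrite !mul0r.
have /andP[wG _] := wc _ _ cG.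
by rewrite PhiG_compat // wf_vwf.
Qed.

Lemma Phi_in_linf (c : Hser K) : in_Hc c -> in_linf_plus (Phi c).
Proof.
move=> hc n; split; [exact: Phi_supp | split; [exact: Phi_Oinv|]].
by move=> b; apply: Phi_compat; apply: in_Hc_wsupp.
Qed.

Lemma Phi_linear (a : K) (c1 c2 : Hser K) : in_Hc c1 -> in_Hc c2 ->
  Phi (fun h G => a * c1 h G + c2 h G) = (fun n b => a * Phi c1 n b + Phi c2 n b).
Proof.
move=> /in_Hc_wsupp w1 /in_Hc_wsupp w2; apply: boolp.funext => n; apply: boolp.funext => b.
have w : wsupp (fun h G => a * c1 h G + c2 h G).
  move=> h G; have [e1|/w1//] := eqVneq (c1 h G) 0.
  by rewrite e1 mulr0 add0r => /w2.
rewrite !(Phi_bdeg _ _ (erefl _)) // mulr_sumr -big_split /=.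
apply: eq_bigr => G _; rewrite !mulrDl; congr (_ + _).
by rewrite !mulrA.
Qed.

(** One label per edge, the rank of the edge in an enumeration; there are at most #|T| edges. The
    labelling is not invariant under isomorphism, a defect that [stable_exact] repairs. *)
Definition lcan (T : finType) (G : pregraph T) (h : T) : 'I_#|T|.+1 :=
  inord (index (pblock (hE G) h) (enum (hE G))).

Lemma lcan_exact (T : finType) (G : pregraph T) : wf_graph G ->
  exact_lab G (fun h => val (lcan G h)).
Proof.
move=> wG h h' hd hd'; have pE := wf_partE wG.
have inE h1 : h1 \in hD G -> pblock (hE G) h1 \in enum (hE G).
  by move=> hd1; rewrite mem_enum pblock_mem // (cover_partition pE).
have bd h1 : h1 \in hD G -> (index (pblock (hE G) h1) (enum (hE G)) < #|T|.+1)%N.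
  move=> hd1; rewrite ltnS (leq_trans (index_size _ _)) // -cardE.
  rewrite (leq_trans (leq_pmull #|hE G| (isT : (0 < 2)%N))) // -card_D //.
  exact: max_card.
rewrite /= !inordK ?bd //; apply/eqP/eqP => [e|-> //].
by rewrite -(nth_index set0 (inE _ hd)) e nth_index // inE.
Qed.

Lemma PhiG_exact_neq0 (T : finType) (G : pregraph T) n (l : T -> 'I_n.+1) :
  wf_graph G -> exact_lab G (fun h => val (l h)) ->
  PhiG K n G (labB G (fun h => val (l h))) != 0.
Proof.
move=> wG ex; apply: natK_neq0; apply/card_gt0P.
pose k : {ffun T -> 'I_n.+1} := [ffun h => if h \in hD G then l h else ord0].
have kl h : h \in hD G -> k h = l h by move=> hd; rewrite ffunE hd.
exists k; rewrite inE lab_basisE ?wf_vwf //; apply/andP; split; last first.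
  by apply/eqP; apply: eq_labB; rewrite ?wf_vwf // => h hd; rewrite kl.
apply/andP; split; last first.
  by apply/offzP => h /negPf hd; rewrite ffunE hd.
apply/econstP => e h h' eE he he'.
have sD := subsetP (edge_subD wG eE); rewrite !kl ?sD //.
by apply: val_inj; apply: exact_lab_const ex eE he he'.
Qed.

(** By [exact_eiso] only graphs isomorphic to [G] reach this basis element, and [sum_class]
    evaluates the sum over their class. *)
Lemma Phi_exact c n h (t0 : 'I_h) (G : pregraph 'I_h) (l : 'I_h -> 'I_n.+1) :
  wsupp c -> isoinv c -> wf_graph G -> hD G = setT ->
  exact_lab G (fun i => val (l i)) ->
  Phi c n (labB G (fun i => val (l i))) = c h G * PhiG K n G (labB G (fun i => val (l i))).
Proof.
move=> wc ic wG DG ex; set b := labB G _.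
have bh : bdeg b = h by rewrite bdeg_labB ?wf_vwf // DG cardsT card_ord.
rewrite (Phi_bdeg n wc bh) (bigID (giso G)) /= [X in _ + X]big1 ?addr0; last first.
  move=> G' nG; have [->|cG] := eqVneq (c h G') 0; first by rewrite !mul0r.
  have /andP[wG' /eqP DG'] := wc _ _ cG.
  rewrite PhiGE ?wf_vwf // big1 ?mulr0 // => l' /andP[_ /econstP lc].
  case: eqP => // e; case/negP: nG.
  have [f fI] : exists f, eiso G' G f.
    apply: (exact_eiso t0 wG wG' ex _ e) => e0 x y eE xe ye.
    by rewrite (lc _ _ _ eE xe ye).
  by apply: (giso_sym t0 wG'); apply/gisoP; exists f.
transitivity (\sum_(G' | giso G G') (c h G' * PhiG K n G' b) / ncls K G').
  by apply: eq_bigr => G' _; rewrite mulrAC.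
apply: (sum_class t0 (F := fun G => c h G * PhiG K n G b) wG).
move=> G' GG'; rewrite -(ic _ _ _ GG'); congr (_ * _); apply/esym.
by have /gisoP[f fI] := GG'; apply: PhiG_iso fI; rewrite // (giso_wf GG').
Qed.

Lemma Phi_inj (c1 c2 : Hser K) : in_Hc c1 -> in_Hc c2 -> Phi c1 = Phi c2 -> c1 = c2.
Proof.
move=> h1 h2 e; apply: boolp.functional_extensionality_dep => h; apply: boolp.funext => G.
(* A series vanishes off full well-formed graphs by definition, and at h = 0 because the empty graph
   is not connected. *)
have out c : in_Hc c -> ~~ [&& wf_graph G, hD G == setT & (0 < h)%N] -> c h G = 0.
  move=> [sc _]; apply: contraNeq => /sc /and4P[-> -> /andP[D0 _] _] /=.
  case: (posnP h) => // h0; subst h; case/set0Pn: D0 => x _; by have := ltn_ord x.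
have [/and3P[wG /eqP DG h0]|no] := boolP [&& wf_graph G, hD G == setT & (0 < h)%N]; last first.
  by rewrite !out.
have := f_equal (fun P => P #|'I_h| (labB G (fun i => val (lcan G i)))) e => /=.
have ex := lcan_exact wG.
rewrite !(Phi_exact (Ordinal h0)) //; try exact: in_Hc_wsupp; try by case: h1; try by case: h2.
  by apply: mulIf; apply: PhiG_exact_neq0.
Qed.

End PhiTheory.

(** * The stable first fundamental theorem for the orthogonal groups *)

Section Relabel.

Definition relabel (p : nat -> nat) (b : basis) : basis :=
  mkb [seq map p (enum_mset y) | y <- enum_mset b.1] (map p (enum_mset b.2)).

Lemma relabel_mkb p ys q : relabel p (mkb ys q) = mkb (map (map p) ys) (map p q).
Proof.
rewrite /relabel /mkb; congr pair; apply/eq_seq_msetP; last first.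
  by apply: perm_map; apply: perm_eq_seq_mset.
rewrite -!map_comp (permPl (perm_map _ (perm_eq_seq_mset _))) -map_comp.
apply: perm_of_eq; apply/eq_map => y /=; apply/eq_seq_msetP; apply: perm_map.
exact: perm_eq_seq_mset.
Qed.

Lemma relabel_labB (T : finType) (G : pregraph T) p (l : T -> nat) :
  relabel p (labB G l) = labB G (fun h => p (l h)).
Proof.
rewrite /labB relabel_mkb -!map_comp; congr mkb.
by apply: eq_map => v /=; rewrite -map_comp.
Qed.

Lemma relabel_comp p q b : relabel p (relabel q b) = relabel (p \o q) b.
Proof.
rewrite [relabel q b]/relabel relabel_mkb /relabel -!map_comp; congr mkb.
by apply: eq_map => v /=; rewrite -map_comp.
Qed.

Lemma eq_relabel p q b : {in blabels b, p =1 q} -> relabel p b = relabel q b.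
Proof.
move=> pq; rewrite /relabel; congr mkb.
  apply/eq_in_map => y yb; apply/eq_in_map => i iy; apply: pq.
  by rewrite mem_cat; apply/orP; left; apply/flattenP; exists (enum_mset y); rewrite ?map_f.
by apply/eq_in_map => i iy; apply: pq; rewrite mem_cat iy orbT.
Qed.

Lemma relabel_id b : relabel id b = b.
Proof.
rewrite -[RHS]mkb_id /relabel map_id; congr mkb.
by apply: eq_map => y; rewrite map_id.
Qed.

Lemma perm_blabels_relabel p b : perm_eq (blabels (relabel p b)) (map p (blabels b)).
Proof.
rewrite (permPl (perm_blabels_mkb _ _)) /blabels map_cat map_flatten -map_comp.
exact: perm_refl.
Qed.

Lemma bdeg_relabel p b : bdeg (relabel p b) = bdeg b.
Proof. by rewrite !bdegE (perm_size (perm_blabels_relabel p b)) size_map. Qed.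

Lemma relabel_nmset0 p b : (mset0 \in (relabel p b).1) = (mset0 \in b.1).
Proof.
have nil0 (s : seq nat) : (mset0 == seq_mset s :> mono) = (s == [::]).
  apply/eqP/eqP => [e|->]; last by apply/msetP => x; rewrite mset_seqE mset0E.
  apply: size0nil; rewrite -(perm_size (perm_eq_seq_mset s)) -e.
  by rewrite enum_mset0.
have nil1 (y : mono) : (mset0 == y) = (enum_mset y == [::]).
  by rewrite -[in LHS](seq_mset_id y) nil0.
rewrite (perm_mem (perm_eq_seq_mset _)) -map_comp; apply/mapP/idP.
  case=> y yb /eqP; rewrite nil0 /= => /eqP e; suff -> : mset0 = y by [].
  by apply/eqP; rewrite nil1; case: (enum_mset y) e.
by move=> yb; exists mset0 => //=; rewrite enum_mset0; apply/eqP; rewrite nil0.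
Qed.

Lemma b_in_graph n b : b_in n.+1 b ->
  exists (G : pregraph 'I_(bdeg b)) (l : {ffun 'I_(bdeg b) -> 'I_n.+1}),
    [/\ vwf G, hD G = setT & b = labB G (fun h => val (l h))].
Proof.
case/andP => bn; rewrite b_allE => ba.
rewrite bdegE; exists (Gpos b), [ffun i => inord (blab i)]; split.
- exact: Gpos_vwf.
- by [].
rewrite -[LHS](Gpos_blab bn); apply: eq_labB; first exact: Gpos_vwf.
move=> i _; rewrite ffunE /= inordK //; apply: (allP ba).
by rewrite /blab mem_nth.
Qed.

Lemma b_in_enum n d : exists2 s : seq basis, uniq s &
  forall b, b_in n.+1 b -> bdeg b = d -> b \in s.
Proof.
exists (undup [seq labB i.1 (fun h => val (i.2 h)) |
   i : pregraph 'I_d * {ffun 'I_d -> 'I_n.+1}]); first exact: undup_uniq.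
move=> b /b_in_graph[G [l [_ _ e]]] bd; rewrite mem_undup.
move: G l e; rewrite bd => G l ->.
by apply/mapP; exists (G, l); rewrite ?mem_enum.
Qed.

End Relabel.

Section Invariants.
Variable K : fieldType.
Hypothesis charK : [pchar K] =i pred0.

(** If each column of g indexed by a label of [b] has at most one nonzero entry in the rows indexed
    by labels of [b'], only one relabelling can contribute. This covers signed permutations, and
    also the reflection when the new label does not occur in [b']. *)
Lemma act_coef_fun n (g : 'M[K]_n.+1) b b' p : b_in n.+1 b -> (0 < bdeg b)%N ->
  (forall j, j \in blabels b -> (p j < n.+1)%N) ->
  (forall i j, i \in blabels b' -> j \in blabels b -> gent g i j != 0 -> i = p j) ->
  act_coef g b b' = (relabel p b == b')%:R * \prod_(j <- blabels b) gent g (p j) j.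
Proof.
move=> bin b0 pn gp; have [G [l [vG DG e]]] := b_in_graph bin.
have D0 : hD G != set0 by rewrite -card_gt0 DG cardsT card_ord.
have lb h : val (l h) \in blabels b.
  rewrite [in blabels b]e (perm_mem (perm_blabels_labB vG _)); apply/mapP; exists h => //.
  by rewrite mem_enum DG inE.
pose k0 := [ffun h => inord (p (l h)) : 'I_n.+1].
have k0E h : val (k0 h) = p (l h) by rewrite ffunE /= inordK // pn // lb.
rewrite [in LHS]e act_coef_labB // (bigD1 k0) /=; last first.
  by apply/offzP => h; rewrite DG inE.
have eqg i j : g i j = gent g (val i) (val j).
  by rewrite /gent !ltn_ord /= !inord_val.
rewrite [X in _ + X]big1 ?addr0; last first.
  move=> k /andP[_ kk0]; case: eqP => [kb|_]; last by rewrite mul0r.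
  have /existsP[h hk] : [exists h, k h != k0 h].
    rewrite -negb_forall; apply: contraNN kk0 => /forallP H; apply/eqP/ffunP => h.
    exact/eqP.
  rewrite (bigD1 h) ?DG ?inE //= mul1r; suff -> : g (k h) (l h) = 0 by rewrite mul0r.
  apply/eqP; apply: contraNT hk; rewrite eqg => /gp H; apply/eqP/val_inj.
  rewrite k0E H // -kb (perm_mem (perm_blabels_labB vG _)); apply/mapP; exists h => //.
  by rewrite mem_enum DG inE.
apply: (f_equal2 *%R).
  rewrite [in relabel p b]e relabel_labB.
  apply: (f_equal (fun x : basis => (x == b')%:R : K)).
  by apply: eq_labB => // h _; rewrite k0E.
rewrite [in blabels b]e (perm_big _ (perm_blabels_labB vG _)) /= big_map big_enum /=.
by apply: eq_bigr => h _; rewrite eqg k0E.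
Qed.

Section Monomial.
Variables (n : nat) (s : 'S_n.+1) (u : 'I_n.+1 -> K).
Hypothesis u1 : forall i, u i * u i = 1.

(** Signed permutation matrices, as [u] takes the values 1 and -1; sign changes and permutations of
    labels are handled together. *)
Definition monmx : 'M[K]_n.+1 := \matrix_(i, j) (u j *+ (i == s j)).

Lemma monmx_orth : monmx *m monmx^T = 1%:M.
Proof.
apply/matrixP => i k; rewrite !mxE.
rewrite (bigD1 (s^-1%g i)) //= big1 ?addr0; last first.
  move=> j ji; rewrite !mxE; case: eqP => [e|_]; last by rewrite mulr0n mul0r.
  by rewrite e permK eqxx in ji.
rewrite !mxE permKV eqxx mulr1n [k == i]eq_sym.
by case: eqP => _; rewrite ?mulr1n ?mulr0n ?mulr0 // u1.
Qed.

Definition permn (i : nat) : nat := s (inord i).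

Lemma permn_lt i : (permn i < n.+1)%N. Proof. exact: ltn_ord. Qed.

Lemma monmx_coef b b' : b_in n.+1 b -> (0 < bdeg b)%N ->
  act_coef monmx b b' = (relabel permn b == b')%:R *
    \prod_(j <- blabels b) u (inord j).
Proof.
move=> bin b0; have /andP[_ ] := bin; rewrite b_allE => /allP ba.
rewrite (act_coef_fun (p := permn)) //; first last.
- move=> i j _ jb; rewrite /gent; case: ifP => [/andP[il jl]|]; last by rewrite eqxx.
  rewrite mxE; case: (inord i =P s (inord j)) => [e _|_]; last by rewrite mulr0n eqxx.
  by rewrite /permn -e inordK.
- by move=> j _; apply: permn_lt.
apply: (f_equal2 *%R) => //; rewrite big_seq [RHS]big_seq; apply: eq_bigr => j /ba jn.
by rewrite /gent permn_lt jn /= mxE /permn inord_val eqxx.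
Qed.

End Monomial.

Lemma permn1 n i : (i < n.+1)%N -> permn (1 : 'S_n.+1)%g i = i.
Proof. by move=> i_lt; rewrite /permn perm1 inordK. Qed.

Section Family.
Variable x : Linf K.
Hypothesis xP : in_linf_plus x.

Lemma linf_supp n b : x n b != 0 -> b_in n.+1 b.
Proof. by have [sx _] := xP n => /sx/andP[]. Qed.
Lemma linf_bdeg n b : x n b != 0 -> (0 < bdeg b)%N.
Proof.
by have [sx _] := xP n => /sx/andP[_ /andP[_]]; apply: leq_ltn_trans.
Qed.

Lemma linf_mono n (s : 'S_n.+1) (u : 'I_n.+1 -> K) b : (forall i, u i * u i = 1 :> K) ->
  b_in n.+1 b -> (0 < bdeg b)%N ->
  x n (relabel (permn s) b) = x n b * \prod_(j <- blabels b) u (inord j).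
Proof.
move=> u1 bin b0; have [_ [/(_ _ (monmx_orth s u1)) H _]] := xP n.
transitivity (x n b * act_coef (monmx s u) b (relabel (permn s) b)); last first.
  by rewrite monmx_coef // eqxx mul1r.
rewrite -[LHS]H; apply: fsum1 => b1 bb1.
have [->|xb1] := eqVneq (x n b1) 0; first by rewrite mul0r.
have bin1 := linf_supp xb1; rewrite monmx_coef ?(linf_bdeg xb1) //.
case: eqP => [e|_]; last by rewrite mul0r mulr0.
case/eqP: bb1; move: (f_equal (relabel (permn s^-1%g)) e); rewrite !relabel_comp.
have idr b2 : b_in n.+1 b2 -> relabel (permn s^-1 \o permn s)%g b2 = b2.
  case/andP => _; rewrite b_allE => /allP ba; rewrite -[RHS]relabel_id.
  apply: eq_relabel => i /ba ilt /=.
  by rewrite /permn inord_val permK inordK.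
by rewrite !idr.
Qed.

Lemma linf_perm n (s : 'S_n.+1) b : b_in n.+1 b ->
  x n (relabel (permn s) b) = x n b.
Proof.
move=> bin; have [b0|b0] := posnP (bdeg b).
  have z b1 : bdeg b1 = 0%N -> x n b1 = 0.
    by move=> b10; apply/eqP; apply: contraTT isT => /linf_bdeg; rewrite b10.
  by rewrite !z // bdeg_relabel.
rewrite (linf_mono s (u := fun _ => 1)) //; last by move=> _; rewrite mulr1.
by rewrite big1 ?mulr1.
Qed.

Lemma linf_odd n b a : odd (count_mem a (blabels b)) -> x n b = 0.
Proof.
move=> oa; apply/eqP/negPn/negP => x0; have bin := linf_supp x0.
have an : (a < n.+1)%N.
  case/andP: bin => _; rewrite b_allE => /allP; apply.
  by rewrite -has_pred1 has_count; case: (count _ _) oa.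
pose u (i : 'I_n.+1) : K := if val i == a then -1 else 1.
have := linf_mono 1%g (u := u) _ bin (linf_bdeg x0).
rewrite (_ : relabel _ b = b); last first.
  rewrite -[RHS]relabel_id; apply: eq_relabel => i ib; apply: permn1.
  by case/andP: bin => _; rewrite b_allE => /allP; apply.
have -> : \prod_(j <- blabels b) u (inord j) = -1.
  transitivity (\prod_(j <- blabels b) (if j == a then -1 else 1 : K)).
    rewrite big_seq [RHS]big_seq; apply: eq_bigr => j jb; rewrite /u /= inordK //.
    by case/andP: bin => _; rewrite b_allE => /allP; apply.
  rewrite -big_mkcond /= big_const_seq iter_mulr_1 -signr_odd.
  by rewrite (eq_count (a2 := pred1 a)) ?oa // expr1.
move=> H; case/eqP: x0; apply/eqP.
have {}H : x n b * 2%:R = 0.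
  rewrite mulr_natr mulr2n [X in _ + X]H ?mulrN1 ?subrr // => i.
  by rewrite /u; case: ifP; rewrite ?mulrNN mulr1.
by move/eqP: H; rewrite mulf_eq0 (negPf (natK_neq0 charK _)) // orbF.
Qed.

Definition nlab (b : basis) := size (undup (blabels b)).

Section Reflection.
Variables (n : nat) (a : nat).
Hypothesis an : (a < n.+1)%N.
Local Notation c := n.+1.

(** The vector e_a - 2 e_c has squared norm 5, so its reflection has the entries 1 - 2/5 = 3/5 and 2
    * 2/5 = 4/5. *)
Let v : 'rV[K]_n.+2 := \row_j ((val j == a)%:R - (val j == c)%:R *+ 2).
(* The reflection that maps x_a to (3 x_a + 4 x_c) / 5. *)
Definition refl_mx : 'M[K]_n.+2 := 1%:M - (2%:R / 5%:R) *: (v^T *m v).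

Let n5 : 5%:R != 0 :> K. Proof. exact: natK_neq0. Qed.

Let vv : v *m v^T = 5%:R%:M.
Proof.
apply/matrixP => i j; rewrite !ord1 !mxE /=.
have ac : (a < n.+2)%N by rewrite ltnW.
have neq : (a == c) = false by rewrite ltn_eqF.
rewrite (bigD1 (Ordinal ac)) //= (bigD1 (Ordinal (ltnSn n.+1))) /=; last first.
  by rewrite -val_eqE /= eq_sym neq.
rewrite big1 ?addr0; last first.
  move=> k /andP[ka kc]; rewrite !mxE.
  by move: ka kc; rewrite -!val_eqE /= => /negPf -> /negPf ->; rewrite mul0rn subrr mul0r.
rewrite !mxE /= !eqxx neq [c == a]eq_sym neq. rewrite /= ?mulr1n ?mulr0n. ring.
Qed.

Lemma refl_mx_orth : refl_mx *m refl_mx^T = 1%:M.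
Proof.
have -> : refl_mx^T = refl_mx.
  by rewrite /refl_mx linearB /= trmx1 linearZ /= trmx_mul trmxK.
rewrite {1}/refl_mx mulmxBl mul1mx -scalemxAl /refl_mx mulmxBr mulmx1.
rewrite -scalemxAr -mulmxA (mulmxA v) vv mul_scalar_mx -scalemxAr.
set w := v^T *m v; rewrite -!scalerA scalerBr !scalerA.
rewrite -{1}[w]scale1r.
apply/matrixP => i j; rewrite !mxE; field.
exact: n5.
Qed.

(** Row [c] is left out: rows are labels of the element whose coefficient is computed, and [c] is
    not among them. The entry -3/5 at (c, c) thus never enters. *)
Lemma refl_mx_ent i j : (i < n.+1)%N -> (j < n.+2)%N ->
  gent refl_mx i j =
    if j == c then (if i == a then 4%:R / 5%:R else 0)
    else if j == a then (if i == a then 3%:R / 5%:R else 0) else (i == j)%:R.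
Proof.
move=> il jl; rewrite /gent jl (leqW il) /= !mxE big_ord1 !mxE /= !inordK ?(leqW il) //.
rewrite -val_eqE /= !inordK ?(leqW il) //.
have -> : (i == c) = false by rewrite ltn_eqF.
have [->|jc] := eqVneq j c.
  rewrite [i == c]ltn_eqF // [c == a]gtn_eqF //.
  by case: (i == a); rewrite ?mul0rn ?mulr1n ?mulr0n; field; exact: n5.
have [->|ja] := eqVneq j a.
  by case: (i == a); rewrite ?mul0rn ?mulr1n ?mulr0n; field; exact: n5.
by case: (i == j); case: (i == a); rewrite ?mul0rn ?mulr1n ?mulr0n; field; exact: n5.
Qed.

(** Away from row [c], the only nonzero entry of column [j] is in row [down j]. The map [up] moves
    the label [a] to the fresh label. *)
Let down j := if j == c then a else j.
Let up j := if j == a then c else j.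

Lemma refl_mx_coef b1 b : b_in n.+2 b1 -> (0 < bdeg b1)%N -> b_in n.+1 b ->
  act_coef refl_mx b1 b = (relabel down b1 == b)%:R *
   ((3%:R / 5%:R) ^+ count_mem a (blabels b1) * (4%:R / 5%:R) ^+ count_mem c (blabels b1)).
Proof.
move=> bin1 b0 bin.
have l1 j : j \in blabels b1 -> (j < n.+2)%N.
  by case/andP: bin1 => _; rewrite b_allE => /allP; apply.
have l2 j : j \in blabels b -> (j < n.+1)%N.
  by case/andP: bin => _; rewrite b_allE => /allP; apply.
have dl j : (j < n.+2)%N -> (down j < n.+1)%N.
  by move=> jl; rewrite /down; case: eqP => // /eqP jc; rewrite ltn_neqAle jc -ltnS.
rewrite (act_coef_fun (p := down)) //; first last.
- move=> i j ib jb; rewrite refl_mx_ent ?l1 ?l2 // /down.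
  case: (j == c); first by case: (i =P a) => // _; rewrite eqxx.
  case: (j =P a) => [->|_]; first by case: (i =P a) => // _; rewrite eqxx.
  by case: (i =P j) => // _; rewrite eqxx.
- by move=> j /l1/dl; apply: ltnW.
apply: (f_equal2 *%R) => //.
have ac : (a == c) = false by rewrite ltn_eqF.
elim: (blabels b1) l1 => [|j s IH] l1; first by rewrite big_nil mulr1.
rewrite big_cons IH; last by move=> i iS; apply: l1; rewrite inE iS orbT.
have jl : (j < n.+2)%N by apply: l1; rewrite inE eqxx.
rewrite refl_mx_ent ?dl // /down /=.
have [->|jc] := eqVneq j c.
  by rewrite eqxx [c == a]eq_sym ac add0n add1n exprS; ring.
have [ja|ja] := eqVneq j a; first by rewrite add0n add1n exprS; ring.
by rewrite eqxx !add0n mul1r.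
Qed.

(* Apart from [b] itself and its copy with the fresh label [c] in place of [a], the
   elements contributing to the coefficient of [b] in the reflected family carry
   both labels, hence more distinct labels than [b]. *)
Lemma linf_refl b : b_in n.+1 b -> (0 < bdeg b)%N -> a \in blabels b ->
  (forall b1, bdeg b1 = bdeg b -> (nlab b < nlab b1)%N -> x n.+1 b1 = 0) ->
  x n.+1 b = x n.+1 b * ((3%:R / 5%:R) ^+ count_mem a (blabels b) +
     (4%:R / 5%:R) ^+ count_mem a (blabels b)).
Proof.
move=> bin b0 ab IH.
have l2 j : j \in blabels b -> (j < n.+1)%N.
  by case/andP: bin => _; rewrite b_allE => /allP; apply.
have ac : (a == c) = false by rewrite ltn_eqF.
have bin' : b_in n.+2 b.
  case/andP: bin => bm ba; rewrite /b_in bm b_allE; apply/allP => j /l2.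
  exact: ltnW.
have cb : count_mem c (blabels b) = 0%N.
  by apply/count_memPn; apply/negP => /l2; rewrite ltnn.
have upl j : j \in blabels b -> (up j < n.+2)%N.
  by move=> /l2 jl; rewrite /up; case: eqP => // _; apply: ltnW.
have binu : b_in n.+2 (relabel up b).
  case/andP: bin => bm ba; rewrite /b_in relabel_nmset0 bm b_allE.
  rewrite (perm_all _ (perm_blabels_relabel _ _)) all_map.
  by apply/allP => j /upl.
(* The two contributing elements have the same coefficient, being exchanged by the transposition of
   [a] and [c]. *)
have xu : x n.+1 (relabel up b) = x n.+1 b.
  pose s : 'S_n.+2 := tperm (inord a) (inord c).
  rewrite -(linf_perm s bin'); congr (x _ _); apply: eq_relabel => j jb.
  have jl2 : (j < n.+2)%N by exact: leqW (l2 _ jb).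
  have al2 : (a < n.+2)%N by exact: leqW an.
  rewrite /permn /s /up; case: (j =P a) => [->|ja].
    by rewrite tpermL inordK.
  rewrite tpermD; first by rewrite inordK.
    by apply/eqP => /(f_equal val) /=; rewrite !inordK // => /esym.
  apply/eqP => /(f_equal val) /=; rewrite !inordK // => jc.
  by have := l2 _ jb; rewrite -jc ltnn.
have db : relabel down b = b.
  rewrite -[RHS]relabel_id; apply: eq_relabel => j /l2 jl.
  by rewrite /down ltn_eqF.
have bu : b != relabel up b.
  apply/eqP => e; have /l2 : c \in blabels b; last by rewrite ltnn.
  rewrite e (perm_mem (perm_blabels_relabel _ _)); apply/mapP; exists a => //.
  by rewrite /up eqxx.
have [_ [/(_ _ refl_mx_orth b) H _]] := xP n.+1; rewrite -[LHS]H {H}.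
have -> : Defs.act refl_mx (x n.+1) b =
    \sum_(b1 <- [:: b; relabel up b]) x n.+1 b1 * act_coef refl_mx b1 b.
  apply: fsum_seq; first by rewrite /= inE bu.
  move=> b1; rewrite mulf_eq0 negb_or => /andP[x0 a0].
  have bin1 := linf_supp x0.
  move: a0; rewrite refl_mx_coef ?(linf_bdeg x0) //.
  case: (relabel down b1 =P b) => [db1|_]; last by rewrite mul0r eqxx.
  move=> _; rewrite !inE.
  have [cb1|cb1] := boolP (c \in blabels b1); last first.
    rewrite -{1}db1; apply/orP; left; apply/eqP; rewrite -[LHS]relabel_id.
    apply: eq_relabel => j jb; rewrite /down; case: eqP => // jc.
    by rewrite -jc jb in cb1.
  have [ab1|ab1] := boolP (a \in blabels b1); last first.
    apply/orP; right; rewrite -{1}db1 relabel_comp; apply/eqP.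
    rewrite -[LHS]relabel_id; apply: eq_relabel => j jb; rewrite /down /up /=.
    case: (j =P c) => [->|_]; first by rewrite eqxx.
    by case: eqP => // ja; rewrite -ja jb in ab1.
  case/eqP: x0; apply: IH; first by rewrite -db1 bdeg_relabel.
  rewrite /nlab -db1.
  have -> : size (undup (blabels (relabel down b1))) =
      size (undup (map down (blabels b1))).
    apply: perm_size; apply: uniq_perm; rewrite ?undup_uniq // => j.
    by rewrite !mem_undup (perm_mem (perm_blabels_relabel _ _)).
  (* Since [a] already occurs in [b1], merging [c] into it loses the label [c] and creates none, so
     [b] has strictly fewer distinct labels than [b1]. *)
  have sub : {subset undup (map down (blabels b1)) <= filter (predC1 c) (undup (blabels b1))}.
    move=> j; rewrite mem_undup mem_filter mem_undup => /mapP[i ib ->] /=.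
    rewrite /down; case: (i =P c) => [_|/eqP ic]; first by rewrite ac ab1.
    by rewrite ic ib.
  apply: leq_ltn_trans (uniq_leq_size (undup_uniq _) sub) _.
  rewrite size_filter -(count_predC (pred1 c) (undup (blabels b1))).
  rewrite (eq_count (a1 := predC (pred1 c)) (a2 := predC1 c)) //.
  by rewrite -[X in (X < _)%N]add0n ltn_add2r -has_count has_pred1 mem_undup.
rewrite big_cons big_seq1 xu !refl_mx_coef ?bdeg_relabel // db eqxx relabel_comp.
have -> : relabel (down \o up) b = b.
  rewrite -[RHS]relabel_id; apply: eq_relabel => j jb; rewrite /down /up /=.
  by case: (j =P a) => [->|_]; rewrite ?eqxx // ltn_eqF // l2.
rewrite eqxx cb expr0.
have cnt (p : pred nat) : count p (blabels (relabel up b)) = count (preim up p) (blabels b).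
  by rewrite (seq.permP (perm_blabels_relabel _ _)) count_map.
rewrite !cnt.
have -> : count (preim up (pred1 a)) (blabels b) = 0%N.
  apply/eqP; rewrite -leqn0 leqNgt -has_count; apply/hasPn => j jb /=.
  rewrite /up; case: (j =P a) => [_|/eqP//]; by rewrite eq_sym ac.
have -> : count (preim up (pred1 c)) (blabels b) = count_mem a (blabels b).
  apply: eq_in_count => j jb /=; rewrite /up; case: (j =P a) => [_|/eqP ja].
    by rewrite eqxx.
  by rewrite ltn_eqF // l2.
by rewrite expr0 !mulr1n !mul1r mulr1 -mulrDr.
Qed.

End Reflection.

Definition pairing_b (b : basis) :=
  all (fun i => count_mem i (blabels b) == 2%N) (blabels b).

(** For exponent 1 this is the equality 9 + 16 = 25, which is why labels of multiplicity two escape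
    the argument and all larger even multiplicities are excluded. *)
Lemma pow_ineq k : (9 ^ k.+2 + 16 ^ k.+2 < 25 ^ k.+2)%N.
Proof. elim: k => // k IH; rewrite !(expnS _ k.+2); lia. Qed.

Lemma refl_coef_neq1 m : ~~ odd m -> (2 < m)%N ->
  1 - ((3%:R / 5%:R) ^+ m + (4%:R / 5%:R) ^+ m) != 0 :> K.
Proof.
move=> em m2; have [k ->] : exists k, m = (2 * k.+2)%N.
  by exists (m./2 - 2)%N; move: (odd_double_half m); rewrite (negPf em) -muln2; lia.
(* Multiplication by 25^(k+2) leaves a positive natural number, nonzero in characteristic zero. *)
have n25 : (25 ^ k.+2)%N%:R != 0 :> K by apply: (natK_neq0 charK); rewrite expn_gt0.
rewrite -(mulIr_eq0 _ (mulIf n25)) mulrBl mul1r mulrDl !exprM !expr_div_n -!natrX.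
rewrite !mulfVK // -natrD -natrB; last exact/ltnW/pow_ineq.
by apply: (natK_neq0 charK); rewrite subn_gt0 pow_ineq.
Qed.

Lemma linf_compat m n b : b_in n.+1 b -> x (n + m)%N b = x n b.
Proof.
case/andP => _ ba; elim: m => [|m IH]; first by rewrite addn0.
rewrite addnS; have [_ [_ H]] := xP (n + m)%N; rewrite H //.
move: ba; rewrite !b_allE; apply: sub_all => i il.
by apply: leq_trans il _; rewrite ltnS leq_addr.
Qed.

(* Stable first fundamental theorem: an invariant family is determined by its
   coefficients on the basis elements in which each label occurs twice. *)
Lemma linf_eq0 : (forall n b, pairing_b b -> x n b = 0) -> forall n b, x n b = 0.
Proof.
(* The degree is fixed and bounds the number of distinct labels, so their difference is a measure
   for the descending induction. The index [n] stays general because the reflection lives in the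
   next component. *)
move=> H n b; have [N] := ubnP (bdeg b - nlab b).
elim: N n b => // N IH n b; rewrite ltnS => bN.
apply/eqP/negPn/negP => x0; have bin := linf_supp x0; have b0 := linf_bdeg x0.
have [/H e|/allPn[a ab c2]] := boolP (pairing_b b); first by rewrite e eqxx in x0.
have ea : ~~ odd (count_mem a (blabels b)).
  by apply: contraNN x0 => /linf_odd ->.
have c0 : (0 < count_mem a (blabels b))%N by rewrite -has_count has_pred1.
have c3 : (2 < count_mem a (blabels b))%N by move: ea c0 c2; lia.
have an : (a < n.+1)%N by case/andP: bin => _; rewrite b_allE => /allP; apply.
have xS : x n.+1 b = x n b by rewrite -(linf_compat 1 bin) addn1.
have := @linf_refl n a an b bin b0 ab.
rewrite xS => HH; case/negP: x0; rewrite -(mulIr_eq0 _ (mulIf (refl_coef_neq1 ea c3))).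
rewrite mulrBr mulr1 {1}HH ?subrr // => b1 e nl; apply: IH.
apply: leq_trans bN; rewrite e ltn_sub2l //; apply: leq_trans nl _.
by rewrite -e bdegE size_undup.
Qed.

End Family.
End Invariants.

(** * The coproduct *)

Section Join.

Definition join_b (b1 b2 : basis) : basis := (msetD b1.1 b2.1, msetD b1.2 b2.2).
Definition filter_b (m : nat) (b : basis) : basis :=
  (seq_mset [seq y <- enum_mset b.1 | all (fun i => (i < m)%N) (enum_mset y)],
   seq_mset [seq i <- enum_mset b.2 | (i < m)%N]).
(** The plain complement of [filter_b], so that [join_filter] holds for every [b]. A monomial kept
    here may still contain labels below [m]; their absence is a separate condition. *)
Definition filterC_b (m : nat) (b : basis) : basis :=
  (seq_mset [seq y <- enum_mset b.1 | ~~ all (fun i => (i < m)%N) (enum_mset y)],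
   seq_mset [seq i <- enum_mset b.2 | ~~ (i < m)%N]).

Lemma perm_msetD (A : choiceType) (P Q : multiset A) :
  perm_eq (enum_mset (msetD P Q)) (enum_mset P ++ enum_mset Q).
Proof.
apply/allP => x _ /=; rewrite count_cat.
by rewrite !count_mem_mset msetE2.
Qed.

Lemma seq_mset_cat (A : choiceType) (s t : seq A) :
  seq_mset (s ++ t) = msetD (seq_mset s) (seq_mset t).
Proof. by apply/msetP => x; rewrite msetE2 !mset_seqE count_cat. Qed.

Lemma perm_blabels_join b1 b2 :
  perm_eq (blabels (join_b b1 b2)) (blabels b1 ++ blabels b2).
Proof.
rewrite /blabels /=.
rewrite (permPl (perm_cat (perm_flatten (perm_map _ (perm_msetD _ _))) (perm_msetD _ _))).
rewrite map_cat flatten_cat -!catA perm_cat2l !catA perm_cat2r perm_catC.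
exact: perm_refl.
Qed.

Lemma join_filter m b : join_b (filter_b m b) (filterC_b m b) = b.
Proof.
case: b => P q; rewrite /join_b /= -!seq_mset_cat.
by congr pair; rewrite -[RHS]seq_mset_id; apply/eq_seq_msetP; rewrite perm_filterC.
Qed.

Lemma join1b b : join_b one_b b = b.
Proof. by case: b => P q; rewrite /join_b /one_b /= !mset0D. Qed.
Lemma joinb1 b : join_b b one_b = b.
Proof. by case: b => P q; rewrite /join_b /one_b /= !msetD0. Qed.

Lemma shift_bE m b : shift_b m b = relabel (fun i => i - m)%N b.
Proof. by rewrite /shift_b /relabel /mkb -map_comp. Qed.

Lemma relabel_up_shift m b : b_all (fun i => (m <= i)%N) b ->
  relabel (addn m) (shift_b m b) = b.
Proof.
rewrite b_allE => /allP ba; rewrite shift_bE relabel_comp -[RHS]relabel_id.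
by apply: eq_relabel => i /ba /= /subnKC.
Qed.

Lemma shift_up m b : shift_b m (relabel (addn m) b) = b.
Proof.
rewrite shift_bE relabel_comp -[RHS]relabel_id.
by apply: eq_relabel => i _ /=; rewrite addKn.
Qed.

Lemma bdeg0_one b : mset0 \notin b.1 -> bdeg b = 0%N -> b = one_b.
Proof.
case: b => P q /= Pn; rewrite bdegE => /size0nil; rewrite /blabels /= => e.
move: (f_equal size e); rewrite size_cat => /eqP; rewrite addn_eq0.
case/andP => /eqP/size0nil fP /eqP/size0nil q0.
have -> : q = mset0.
  by rewrite -(seq_mset_id q) q0; apply/msetP => x; rewrite mset_seqE mset0E.
have -> : P = mset0; last by [].
have P0 : enum_mset P = [::].
  case E : (enum_mset P) => [|y s] //.
  case/negP: Pn; have yP : y \in P by rewrite -[y \in P]/(y \in enum_mset P) E inE eqxx.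
  move: fP; rewrite E /=; case Ey : (enum_mset y) => [|i t] // _.
  suff -> : mset0 = y by [].
  by rewrite -(seq_mset_id y) Ey; apply/msetP => x; rewrite mset_seqE mset0E.
by rewrite -(seq_mset_id P) P0; apply/msetP => x; rewrite mset_seqE mset0E.
Qed.

Lemma map_nth_enum_filter (A : Type) (x0 : A) (s : seq A) (P : pred A) :
  [seq nth x0 s (val i) | i <- enum [set i : 'I_(size s) | P (nth x0 s (val i))]]
  = filter P s.
Proof.
transitivity (filter P [seq nth x0 s (val i) | i <- enum 'I_(size s)]).
  rewrite filter_map; congr map.
  rewrite enumT {1}/enum_mem; apply: eq_filter => i; exact: in_set.
congr filter.
by rewrite (map_comp (nth x0 s) val) val_enum_ord map_nth_iota0 // take_size.
Qed.

(** A constant monomial of [b''] would satisfy the test [all] vacuously and move to the first part,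
    hence the hypothesis on [b'']. *)
Lemma filter_join m b' b'' : mset0 \notin b''.1 -> b_all (fun i => (i < m)%N) b' ->
  filter_b m (join_b b' (relabel (addn m) b'')) = b' /\
  filterC_b m (join_b b' (relabel (addn m) b'')) = relabel (addn m) b''.
Proof.
move=> bn /andP[/allP a1 /allP a2].
pose P (y : mono) := all (fun i => (i < m)%N) (enum_mset y).
have u1 y : y \in (relabel (addn m) b'').1 -> ~~ P y.
  rewrite (perm_mem (perm_eq_seq_mset _)) -map_comp => /mapP[z zb ->] /=.
  rewrite /P (perm_all _ (perm_eq_seq_mset _)) all_map.
  case E : (enum_mset z) => [|i s] /=; last by rewrite ltnNge leq_addr.
  case/negP: bn; suff -> : mset0 = z by [].
  by rewrite -(seq_mset_id z) E; apply/msetP => x; rewrite mset_seqE mset0E.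
have u2 i : i \in (relabel (addn m) b'').2 -> ~~ (i < m)%N.
  rewrite (perm_mem (perm_eq_seq_mset _)) => /mapP[j _ ->].
  by rewrite -leqNgt leq_addr.
have F (A : choiceType) (X Y : multiset A) (Q : pred A) :
    (forall x, x \in X -> Q x) -> (forall y, y \in Y -> ~~ Q y) ->
    seq_mset (filter Q (enum_mset (msetD X Y))) = X /\
    seq_mset (filter (predC Q) (enum_mset (msetD X Y))) = Y.
  move=> hX hY.
  have fX : filter Q (enum_mset X) = enum_mset X by apply/all_filterP/allP.
  have fY : filter Q (enum_mset Y) = [::].
    by apply/eqP; rewrite -[_ == _]negbK -has_filter; apply/hasPn.
  have gX : filter (predC Q) (enum_mset X) = [::].
    apply/eqP; rewrite -[_ == _]negbK -has_filter; apply/hasPn => x /hX /= Qx.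
    by rewrite Qx.
  have gY : filter (predC Q) (enum_mset Y) = enum_mset Y by apply/all_filterP/allP.
  split; rewrite -[RHS]seq_mset_id; apply/eq_seq_msetP.
    rewrite (permPl (perm_filter _ (perm_msetD _ _))) filter_cat fX fY cats0.
    exact: perm_refl.
  rewrite (permPl (perm_filter _ (perm_msetD _ _))) filter_cat gX gY.
  exact: perm_refl.
have [e1 e2] := F _ b'.1 (relabel (addn m) b'').1 P a1 u1.
have [e3 e4] := F _ b'.2 (relabel (addn m) b'').2 (fun i => (i < m)%N) a2 u2.
rewrite /filter_b /filterC_b /=; split.
  by rewrite e1 e3; case: (b').
by rewrite e2 e4; case: (relabel _ _).
Qed.

End Join.

Section Delta.
Variable K : fieldType.

Lemma sum_pair1 (I J : finType) (f : I -> J -> K) i0 j0 :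
  (forall i j, (i != i0) || (j != j0) -> f i j = 0) ->
  \sum_i \sum_j f i j = f i0 j0.
Proof.
move=> f0; rewrite (bigD1 i0) //= (bigD1 j0) //=.
rewrite [X in _ + X + _]big1 ?addr0; last by move=> j jj; rewrite f0 ?jj ?orbT.
rewrite [X in _ + X]big1 ?addr0 // => i ii.
by apply: big1 => j _; rewrite f0 ?ii.
Qed.

(** The projections leave a single term of the coproduct: the factors with labels below [m] must go
    left and those with labels at least [m] right. The coefficient is therefore 0 or 1. *)
Lemma delta_coefE m b b' b'' : mset0 \notin b.1 ->
  delta_coef K m b b' b'' =
    (b_all (fun i => (i < m)%N) b' && (b == join_b b' (relabel (addn m) b'')))%:R.
Proof.
move=> bn; rewrite /delta_coef.
set Ps := enum_mset b.1; set qs := enum_mset b.2.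
pose P (y : mono) := all (fun i => (i < m)%N) (enum_mset y).
pose I0 := [set i : 'I_(size Ps) | P (nth mset0 Ps (val i))].
pose J0 := [set i : 'I_(size qs) | (nth 0%N qs (val i) < m)%N].
have E1 : [seq nth mset0 Ps (val i) | i <- enum I0] = filter P Ps.
  exact: map_nth_enum_filter.
have E2 : [seq nth 0%N qs (val i) | i <- enum J0] = filter (fun i => (i < m)%N) qs.
  exact: (map_nth_enum_filter 0%N qs (fun i => (i < m)%N)).
have E1' : [seq nth mset0 Ps (val i) | i <- enum (~: I0)] = filter (predC P) Ps.
  have -> : ~: I0 = [set i : 'I_(size Ps) | (predC P) (nth mset0 Ps (val i))].
    by apply/setP => i; rewrite !inE.
  exact: map_nth_enum_filter.
have E2' : [seq nth 0%N qs (val i) | i <- enum (~: J0)] = filter (fun i => ~~ (i < m)%N) qs.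
  have -> : ~: J0 = [set i : 'I_(size qs) | ~~ (nth 0%N qs (val i) < m)%N].
    by apply/setP => i; rewrite !inE.
  exact: (map_nth_enum_filter 0%N qs (fun i => ~~ (i < m)%N)).
pose c1 (I : {set 'I_(size Ps)}) (J : {set 'I_(size qs)}) : basis :=
  (seq_mset [seq nth mset0 Ps (val i) | i <- enum I],
   seq_mset [seq nth 0%N qs (val j) | j <- enum J]).
pose cond I J := [&& b_all (fun i => (i < m)%N) (c1 I J),
  b_all (fun i => (m <= i)%N) (c1 (~: I) (~: J)), c1 I J == b' &
  shift_b m (c1 (~: I) (~: J)) == b''].
have zero I J : (I != I0) || (J != J0) -> cond I J = false.
  apply: contraTF; rewrite /cond andbA => /andP[+ _].
  rewrite /b_all /c1 /= !(perm_all _ (perm_eq_seq_mset _)) !all_map.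
  case/andP => /andP[/allP h1 /allP h2] /andP[/allP h3 /allP h4].
  rewrite negb_or !negbK; apply/andP; split; apply/eqP/setP => i; rewrite inE.
    apply/idP/idP => [iI|]; first by apply: h1; rewrite mem_enum.
    apply: contraTT => iI; have /h3 /= : i \in enum (~: I) by rewrite mem_enum inE.
    rewrite /P; case E : (enum_mset _) => [|j s] /=; last by case/andP => mj _; rewrite ltnNge mj.
    (* Only a constant monomial meets both conditions on labels, and could go to either side. *)
    case/negP: bn; have : nth mset0 Ps (val i) \in b.1 by exact: mem_nth (ltn_ord i).
    suff -> : nth mset0 Ps (val i) = mset0 by [].
    by rewrite -(seq_mset_id (nth _ _ _)) E; apply/msetP => x; rewrite mset_seqE mset0E.
  apply/idP/idP => [iI|]; first by apply: h2; rewrite mem_enum.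
  apply: contraTT => iI; have /h4 /= : i \in enum (~: J) by rewrite mem_enum inE.
  by rewrite -leqNgt.
transitivity (\sum_I \sum_J (cond I J)%:R : K); first exact: erefl.
transitivity ((cond I0 J0)%:R : K).
  by apply: sum_pair1 => I J /zero ->.
rewrite /cond.
have -> : c1 I0 J0 = filter_b m b by rewrite /c1 E1 E2.
have -> : c1 (~: I0) (~: J0) = filterC_b m b by rewrite /c1 E1' E2'.
congr (_%:R); congr nat_of_bool.
apply/and4P/andP.
  case=> h1 h2 /eqP h3 /eqP h4; rewrite -h3 h1; split=> //.
  by rewrite -h4 relabel_up_shift // join_filter.
case=> h1 /eqP h2.
have bn2 : mset0 \notin b''.1.
  rewrite -(relabel_nmset0 (addn m)); apply: contraNN bn => bn2.
  by rewrite h2 /= in_msetD bn2 orbT.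
have [f1 f2] := filter_join bn2 h1; rewrite -h2 in f1 f2.
rewrite f1 f2 shift_up; split=> //.
rewrite b_allE (perm_all _ (perm_blabels_relabel _ _)) all_map.
by apply/allP => i _ /=; rewrite leq_addr.
Qed.

Lemma deltaE m (F : basis -> K) b' b'' : (forall b, F b != 0 -> mset0 \notin b.1) ->
  delta m F b' b'' = if b_all (fun i => (i < m)%N) b' then
    F (join_b b' (relabel (addn m) b'')) else 0.
Proof.
move=> Fn; set j := join_b _ _.
transitivity (F j * delta_coef K m j b' b'').
  apply: fsum1 => b bj; have [->|Fb] := eqVneq (F b) 0; first by rewrite mul0r.
  by rewrite delta_coefE ?Fn // (negPf bj) andbF mulr0.
have [->|Fj] := eqVneq (F j) 0; first by rewrite mul0r if_same.
by rewrite delta_coefE ?Fn // eqxx andbT; case: ifP; rewrite ?mulr1 ?mulr0.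
Qed.

End Delta.

(** * Primitive elements *)

Section Primitive.
Variable K : fieldType.

Lemma in_linf_plus0 : in_linf_plus (fun _ _ => 0 : K).
Proof.
move=> n; split; first by move=> b; rewrite eqxx.
split=> // g _ b; apply: fsum0 => b1; exact: mul0r.
Qed.

Lemma in_linf_plus_lin (a : K) (x y : Linf K) : in_linf_plus x -> in_linf_plus y ->
  in_linf_plus (fun n b => a * x n b + y n b).
Proof.
move=> xP yP n; have [sx [ox cx]] := xP n; have [sy [oy cy]] := yP n; split.
  move=> b; have [x0|/sx//] := eqVneq (x n b) 0.
  by rewrite x0 mulr0 add0r => /sy.
split; last by move=> b bn; rewrite cx ?cy.
move=> g gO b'; rewrite -(ox _ gO b') -(oy _ gO b').
have [s us sP] := b_in_enum n (bdeg b').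
have actE (F : basis -> K) : supp_plus n.+1 F ->
    Defs.act g F b' = \sum_(b <- s) F b * act_coef g b b'.
  move=> sF; apply: fsum_seq => // b; rewrite mulf_eq0 negb_or => /andP[F0 a0].
  by have /andP[bin _] := sF _ F0; apply: sP => //; apply: act_coef_bdeg a0.
rewrite !actE //; last first.
  move=> b; have [x0|/sx//] := eqVneq (x n b) 0.
  by rewrite x0 mulr0 add0r => /sy.
rewrite mulr_sumr -big_split /=; apply: eq_bigr => b _.
by rewrite mulrDl mulrA.
Qed.

Section One.
Variable x : Linf K.
Hypothesis xP : in_linf_plus x.

Lemma linf_nmset0 n b : x n b != 0 -> mset0 \notin b.1.
Proof. by case/(linf_supp xP)/andP. Qed.

Lemma linf_one n b : bdeg b = 0%N -> x n b = 0.
Proof.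
by move=> b0; apply/eqP; apply: contraTT isT => /(linf_bdeg xP); rewrite b0.
Qed.

Lemma linf_out n b : ~~ b_all (fun i => (i < n.+1)%N) b -> x n b = 0.
Proof. by apply: contraNeq => /(linf_supp xP)/andP[_]. Qed.

Lemma linf_compat_all m n b : b_all (fun i => (i < n.+1)%N) b -> x (n + m)%N b = x n b.
Proof.
move=> ba; have [bm|bm] := boolP (mset0 \in b.1).
  have z k : x k b = 0 by apply/eqP; apply: contraTT bm => /linf_nmset0.
  by rewrite !z.
by apply: linf_compat; rewrite // /b_in bm.
Qed.

Lemma linf_up m n b : x (m + n)%N.+1 (relabel (addn m.+1) b) = x n b.
Proof.
have [bm|bm] := boolP (mset0 \in b.1).
  have z k b1 : mset0 \in b1.1 -> x k b1 = 0.
    by move=> bm1; apply/eqP; apply: contraTT bm1 => /linf_nmset0.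
  by rewrite !z // relabel_nmset0.
have [ba|ba] := boolP (b_all (fun i => (i < n.+1)%N) b); last first.
  rewrite [RHS]linf_out // linf_out //; apply: contraNN ba.
  rewrite !b_allE (perm_all _ (perm_blabels_relabel _ _)) all_map.
  by apply: sub_all => i /=; lia.
have -> : x n b = x (m + n)%N.+1 b.
  by rewrite -(linf_compat_all m.+1 ba) addnS [(n + m)%N]addnC.
(* Addition of m + 1 modulo m + n + 2 permutes the labels, and it does not wrap around on labels at
   most [n]. *)
pose s : 'S_(m + n).+2 := perm (@addrI _ (inord m.+1)).
have ba' : b_all (fun i => (i < (m + n).+2)%N) b.
  move: ba; rewrite !b_allE; apply: sub_all => i il.
  by lia.
have bin : b_in (m + n)%N.+2 b by rewrite /b_in bm.
rewrite -(linf_perm xP s bin); congr (x _ _); apply: eq_relabel => i ib.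
have il : (i < n.+1)%N by move: ba; rewrite b_allE => /allP; apply.
rewrite /permn permE /= !inordK; last 2 first.
- lia.
- lia.
by rewrite modn_small //; lia.
Qed.

(** The coefficients with a factor [one_b] satisfy the primitivity equation automatically: by
    compatibility of the components on the left, by invariance under the shift of labels on the
    right, and by vanishing in degree 0 when both factors are trivial. Only the mixed coefficients
    impose a condition. *)
Lemma primitiveP : primitive x <-> forall n m (b1 b2 : basis),
  b_all (fun i => (i < m.+1)%N) b1 -> b1 != one_b -> b2 != one_b ->
  x (m + n)%N.+1 (join_b b1 (relabel (addn m.+1) b2)) = 0.
Proof.
have D m n b1 b2 : delta m.+1 (x n) b1 b2 = if b_all (fun i => (i < m.+1)%N) b1 then
    x n (join_b b1 (relabel (addn m.+1) b2)) else 0.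
  by apply: deltaE => b; apply: linf_nmset0.
have r1 m : relabel (addn m) one_b = one_b.
  by rewrite -(relabel_id one_b) relabel_comp; apply: eq_relabel => i;
     rewrite /blabels /= !enum_mset0.
have d1 : bdeg one_b = 0%N by rewrite bdegE /blabels /= !enum_mset0.
split=> [px n m b1 b2 ba n1 n2|H a c b1 b2].
  by have := px m n b1 b2; rewrite D ba (negPf n1) (negPf n2) mulr0 mul0r addr0.
rewrite D; case: (eqVneq b2 one_b) => [->|n2] /=; case: (eqVneq b1 one_b) => [->|n1] /=.
- by rewrite r1 join1b !(linf_one _ d1) if_same mul0r mulr0 addr0.
- rewrite r1 joinb1 mulr1 mul0r addr0; case: ifPn => [ba|/linf_out ->//].
  by rewrite -addnS linf_compat_all.
- rewrite mulr0 mul1r add0r join1b linf_up.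
  by rewrite b_allE /blabels /= !enum_mset0.
- by rewrite mulr0 mul0r addr0; case: ifPn => // ba; apply: H.
Qed.

End One.

Lemma Pl0 : Pl (fun _ _ => 0 : K).
Proof.
split; first exact: in_linf_plus0.
by apply/(primitiveP in_linf_plus0).
Qed.

Lemma Pl_lin (a : K) (x y : Linf K) : Pl x -> Pl y -> Pl (fun n b => a * x n b + y n b).
Proof.
move=> [xP /(primitiveP xP) px] [yP /(primitiveP yP) py].
have zP := in_linf_plus_lin a xP yP; split=> //; apply/(primitiveP zP) => n m b1 b2 ba n1 n2.
by rewrite px // py // mulr0 addr0.
Qed.

Hypothesis charK : [pchar K] =i pred0.

Lemma Phi_primitive (c : Hser K) : in_Hc c -> primitive (Phi c).
Proof.
move=> hc; have xP := Phi_in_linf hc; apply/(primitiveP xP) => n m b1 b2 ba n1 n2.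
apply/eqP/negPn/negP => P0.
have [h [G [l [cG wG DG /econstP lc e]]]] := Phi_witness (in_Hc_wsupp hc) P0.
have [/(_ _ _ cG) /and4P[_ _ coG _] _] := hc.
have bn := linf_nmset0 xP P0.
have bn1 : mset0 \notin b1.1 by apply: contraNN bn => bn; rewrite in_msetD bn.
have bn2 : mset0 \notin b2.1.
  by rewrite -(relabel_nmset0 (addn m.+1)); apply: contraNN bn => bn; rewrite in_msetD bn orbT.
have vG := wf_vwf wG; set u := relabel (addn m.+1) b2 in P0 e.
have pl : perm_eq (blabels b1 ++ blabels u) (map (fun i => val (l i)) (enum (hD G))).
  by rewrite -(permPl (perm_blabels_join _ _)) e; apply: perm_blabels_labB.
have ul i : i \in blabels u -> (m.+1 <= i)%N.
  by rewrite (perm_mem (perm_blabels_relabel _ _)) => /mapP[j _ ->]; rewrite leq_addr.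
have bl i : i \in blabels b1 -> (i < m.+1)%N.
  by move: ba; rewrite b_allE => /allP; apply.
(* An edge carries one label, and each vertex monomial comes entirely from [b1] or entirely from
   [u]; thus [S] is a union of components. Connectedness makes it empty or everything, and then one
   of the two factors is trivial. *)
pose S := [set i in hD G | (l i < m.+1)%N].
have clS : block_closed G S.
  move=> B i j /setUP[] BP iB jB; rewrite !inE => /andP[iD il]; last first.
    by rewrite -(lc _ _ _ BP iB jB) il (subsetP (edge_subD wG BP)).
  rewrite (subsetP (vwf_subD vG BP)) //=.
  have [BX|BX] := boolP (B \in hX G).
    have /eqP/cards1P[z Bz] := vwf_card1 vG BX.
    by move: iB jB; rewrite Bz !inE => /eqP <- /eqP ->.
  have BI : B \in Vint G by rewrite inE BX.
  pose y : mono := seq_mset [seq val (l k) | k <- enum B].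
  have yin : y \in (join_b b1 u).1.
    rewrite e (perm_mem (perm_eq_seq_mset _)); apply/mapP.
    by exists [seq val (l k) | k <- enum B] => //; apply: map_f; rewrite mem_enum.
  have ymem k : k \in B -> val (l k) \in enum_mset y.
    move=> kB; rewrite (perm_mem (perm_eq_seq_mset _)); apply/mapP; exists k => //.
    by rewrite mem_enum.
  have lab (b : basis) k : y \in b.1 -> k \in enum_mset y -> k \in blabels b.
    move=> yb ky; rewrite mem_cat; apply/orP; left; apply/flattenP.
    by exists (enum_mset y); rewrite ?map_f.
  move: yin; rewrite in_msetD => /orP[] yin.
    by apply/bl/(lab _ _ yin)/ymem.
  have := ul _ (lab _ _ yin (ymem _ iB)); by rewrite leqNgt il.
have [S0|S0] := eqVneq S set0.
  case/eqP: n1; apply: bdeg0_one => //; rewrite bdegE.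
  case E : (blabels b1) => [|i s] //.
  have ib : i \in blabels b1 by rewrite E inE eqxx.
  have : i \in map (fun i => val (l i)) (enum (hD G)).
    by rewrite -(perm_mem pl) mem_cat ib.
  case/mapP => k; rewrite mem_enum => kD il; move/setP/(_ k): S0.
  by rewrite !inE kD /= -[X in (X < _)%N]il bl.
have SD : S = hD G.
  by apply: connected_closed => //; apply/subsetP => i; rewrite inE => /andP[].
case/eqP: n2; apply: bdeg0_one => //; rewrite -(bdeg_relabel (addn m.+1)) -/u bdegE.
case E : (blabels u) => [|i s] //.
have iu : i \in blabels u by rewrite E inE eqxx.
have : i \in map (fun i => val (l i)) (enum (hD G)).
  by rewrite -(perm_mem pl) mem_cat iu orbT.
case/mapP => k; rewrite mem_enum -SD inE => /andP[_ kl] il.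
by have := ul _ iu; rewrite il leqNgt kl.
Qed.

End Primitive.

(** * The inverse of Phi *)

Section Surjective.
Variable K : fieldType.
Hypothesis charK : [pchar K] =i pred0.

Lemma perm_extend (T : finType) (D : {set T}) n (l l' : T -> 'I_n.+1) :
  (forall h h', h \in D -> h' \in D -> (l h == l h') = (l' h == l' h')) ->
  exists s : 'S_n.+1, forall h, h \in D -> s (l h) = l' h.
Proof.
move=> ll; pose phi i := if [pick h in D | l h == i] is Some h then l' h else ord0.
have phiE h : h \in D -> phi (l h) = l' h.
  move=> hD; rewrite /phi; case: pickP => [k /andP[kD /eqP kl]|/(_ h)].
    by apply/eqP; rewrite -ll // kl.
  by rewrite hD eqxx.
have phiI : {in l @: D &, injective phi}.
  move=> _ _ /imsetP[h hD ->] /imsetP[k kD ->]; rewrite !phiE // => /eqP.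
  by rewrite -ll // => /eqP.
have phiim : phi @: (l @: D) = l' @: D.
  rewrite -imset_comp; apply: eq_in_imset => h hD /=; exact: phiE.
have cC : #|~: (l @: D)| = #|~: (l' @: D)|.
  have := cardsC (l @: D); rewrite -(cardsC (l' @: D)).
  by rewrite -{1}phiim (card_in_imset phiI) => /addnI.
(* With constant values, [perm_map_fun] yields an arbitrary bijection between two sets of equal
   size. *)
have mapc (s : seq 'I_n.+1) : map (fun=> tt) s = nseq (size s) tt by elim: s => //= _ s ->.
have pC : perm_eq (map (fun=> tt) (enum (~: (l @: D)))) (map (fun=> tt) (enum (~: (l' @: D)))).
  by apply: perm_of_eq; rewrite !mapc -!cardE cC.
have [psi [psiI psip _]] := perm_map_fun ord0 (enum_uniq _) (enum_uniq _) pC.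
pose f i := if i \in l @: D then phi i else psi i.
have psiC i : i \notin l @: D -> psi i \notin l' @: D.
  move=> iA; rewrite -in_setC -mem_enum -(perm_mem psip) map_f // mem_enum inE.
  exact: iA.
have fI : injective f.
  move=> i j; rewrite /f; case: ifPn => iA; case: ifPn => jA.
  - exact: phiI.
  - by move=> e; case/negP: (psiC _ jA); rewrite -e -phiim imset_f.
  - by move=> e; case/negP: (psiC _ iA); rewrite e -phiim imset_f.
  - by apply: psiI; rewrite mem_enum inE.
exists (perm fI) => h hD; rewrite permE /f imset_f //; exact: phiE.
Qed.

(** The properties shared by an invariant family and by the family of all [PhiG] of one graph, which
    need not lie in the plus part. Both the numerator and the denominator of [inv_Phi] are treated
    through them. *)
Definition stable (y : Linf K) :=
  (forall n b, b_all (fun i => (i < n.+1)%N) b -> y n.+1 b = y n b) /\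
  (forall n (s : 'S_n.+1) b, b_in n.+1 b -> y n (relabel (permn s) b) = y n b).

Lemma stable_add y m n b : stable y -> b_all (fun i => (i < n.+1)%N) b ->
  y (n + m)%N b = y n b.
Proof.
move=> [H _] ba; elim: m => [|m IH]; first by rewrite addn0.
rewrite addnS H //; move: ba; rewrite !b_allE; apply: sub_all => i il.
by apply: leq_trans il _; rewrite ltnS leq_addr.
Qed.

(** Both labellings are moved to the common range of n + n' + 1 labels, where a permutation of
    labels relates them. So the value depends on the graph alone. *)
Lemma stable_exact y (T : finType) (G : pregraph T) n n' (l : T -> 'I_n.+1)
    (l' : T -> 'I_n'.+1) : stable y -> wf_graph G ->
  exact_lab G (fun h => val (l h)) -> exact_lab G (fun h => val (l' h)) ->
  y n (labB G (fun h => val (l h))) = y n' (labB G (fun h => val (l' h))).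
Proof.
move=> yS wG ex ex'; have vG := wf_vwf wG.
have ba k (f : T -> 'I_k.+1) : b_all (fun i => (i < k.+1)%N) (labB G (fun h => val (f h))).
  by have /andP[] := b_in_labB vG f.
rewrite -(stable_add n' yS (ba _ l)) -(stable_add n yS (ba _ l')) [(n' + n)%N]addnC.
have le1 : (n.+1 <= (n + n').+1)%N by rewrite ltnS leq_addr.
have le2 : (n'.+1 <= (n + n').+1)%N by rewrite ltnS leq_addl.
have [|s sP] := @perm_extend T (hD G) (n + n') (fun h => widen_ord le1 (l h))
   (fun h => widen_ord le2 (l' h)).
  by move=> h h' hD hD'; rewrite -!val_eqE /= ex // ex'.
rewrite -(yS.2 _ s); last first.
  exact: (b_in_labB vG (fun h => widen_ord le1 (l h))).
congr (y _ _); rewrite relabel_labB; apply: eq_labB => // h hD.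
rewrite /permn; have -> : inord (val (l h)) = widen_ord le1 (l h).
  by apply: val_inj; rewrite /= inordK // (leq_trans (ltn_ord _)).
by rewrite sP.
Qed.

Lemma linf_stable x : in_linf_plus x -> stable x.
Proof.
move=> xP; split=> [n b|n s b bin]; last exact: linf_perm.
by have [_ [_ H]] := xP n; apply: H.
Qed.

Lemma PhiG_stable (T : finType) (G : pregraph T) : wf_graph G -> hD G = setT ->
  stable (fun n b => PhiG K n G b).
Proof.
move=> wG DG; have vG := wf_vwf wG; split=> [n b|n s b bin]; first exact: PhiG_compat.
rewrite !PhiGE //.
rewrite (reindex (fun l : {ffun T -> 'I_n.+1} => [ffun h => s (l h)])) /=; last first.
  exists (fun l : {ffun T -> 'I_n.+1} => [ffun h => s^-1%g (l h)]) => l _;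
    by apply/ffunP => h; rewrite !ffunE ?permK ?permKV.
have off (l : {ffun T -> 'I_n.+1}) : offz (hD G) l.
  by apply/offzP => h; rewrite DG inE.
apply: eq_big => l.
  rewrite !off /=; apply/econstP/econstP => H e h h' eE he he'.
    by have := H _ _ _ eE he he'; rewrite !ffunE => /perm_inj.
  by rewrite !ffunE (H _ _ _ eE he he').
move=> _; congr (_%:R); congr nat_of_bool.
have -> : labB G (fun h => val ([ffun h => s (l h)] h)) =
    relabel (permn s) (labB G (fun h => val (l h))).
  rewrite relabel_labB; apply: eq_labB => // h _.
  by rewrite ffunE /permn inord_val.
apply/eqP/eqP => [e|-> //].
move: (f_equal (relabel (permn s^-1%g)) e); rewrite !relabel_comp.
have idr b2 : b_in n.+1 b2 -> relabel (permn s^-1 \o permn s)%g b2 = b2.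
  case/andP => _; rewrite b_allE => /allP ba; rewrite -[RHS]relabel_id.
  apply: eq_relabel => i /ba ilt /=.
  by rewrite /permn inord_val permK inordK.
by rewrite !idr //; apply: b_in_labB.
Qed.

Lemma giso_wfT h (t0 : 'I_h) (G G' : pregraph 'I_h) : giso G G' ->
  (wf_graph G' && (hD G' == setT)) = (wf_graph G && (hD G == setT)).
Proof.
move=> GG'.
have tr (H H' : pregraph 'I_h) : giso H H' -> wf_graph H && (hD H == setT) ->
    wf_graph H' && (hD H' == setT).
  move=> HH' /andP[wH /eqP DH]; rewrite (giso_wf HH') //=.
  have /gisoP[f [[fI fD _ _] _]] := HH'; rewrite eqEcard subsetT /= -fD.
  by rewrite card_in_imset // DH.
apply/idP/idP => [wd'|]; last exact: tr.
apply: (tr G' G _ (wd')).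
have /gisoP[f fI] := GG'; have [[finj fD _ _] _] := fI.
have DG : hD G = setT.
  apply/eqP; rewrite eqEcard subsetT cardsT card_ord /= -(card_in_imset finj) fD.
  by case/andP: wd' => _ /eqP ->; rewrite cardsT card_ord.
by apply/gisoP; apply: (eiso_sym_sub t0 _ fI) => S _; rewrite DG subsetT.
Qed.

Section Inverse.
Variable x : Linf K.
Hypotheses (xP : in_linf_plus x) (xprim : primitive x).

(** The quotient is forced by [Phi_exact]; its denominator counts the edge labellings of [G] with
    the chosen basis element. The condition on [h] discards the empty graph. *)
Definition inv_Phi : Hser K := fun h G =>
  if [&& wf_graph G, hD G == setT & (0 < h)%N] then
    x #|'I_h| (labB G (fun i => val (lcan G i))) /
    PhiG K #|'I_h| G (labB G (fun i => val (lcan G i)))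
  else 0.

Lemma inv_Phi_iso : isoinv inv_Phi.
Proof.
move=> h G G' GG'; rewrite /inv_Phi.
have [h0|h0] := posnP h; first by rewrite !andbF.
have t0 := Ordinal h0.
rewrite !andbT (giso_wfT t0 GG').
case: (boolP (wf_graph G && (hD G == setT))) => [/andP[wG /eqP DG]|_]; last by [].
have /andP[wG' /eqP DG'] : wf_graph G' && (hD G' == setT) by rewrite (giso_wfT t0 GG') wG DG eqxx.
have /gisoP[f fI] := GG'; case: (fI) => vf fE; case: (vf) => finj fD fV fX.
rewrite -(PhiG_iso _ _ _ wG wG' fI) (viso_labB (wf_vwf wG) _ vf).
(* The canonical labelling of [G'] pulled back along [f] is exact on [G], possibly different from
   [lcan G]. *)
have ex : exact_lab G (fun i => val (lcan G' (f i))).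
  move=> i j iD jD; have fD' k : k \in hD G -> f k \in hD G' by move=> kD; rewrite -fD imset_f.
  rewrite (lcan_exact wG') ?fD' //.
  have fb k : k \in hD G -> pblock (hE G') (f k) = f @: pblock (hE G) k.
    move=> kD; have pE := wf_partE wG.
    have kb : pblock (hE G) k \in hE G by rewrite pblock_mem // (cover_partition pE).
    apply: def_pblock; first exact: partition_trivIset (wf_partE wG').
      by rewrite -fE imset_f.
    by rewrite imset_f // mem_pblock (cover_partition pE).
  rewrite !fb //; apply/eqP/eqP => [|-> //].
  by apply: (imset_inj_in finj); rewrite inE /= edge_subD // pblock_mem // (cover_partition (wf_partE wG)).
rewrite -!(stable_exact (linf_stable xP) wG (lcan_exact wG) ex).
by rewrite -!(stable_exact (PhiG_stable wG DG) wG (lcan_exact wG) ex).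
Qed.

Lemma inv_Phi_exact h (G : pregraph 'I_h) n (l : 'I_h -> 'I_n.+1) :
  wf_graph G -> hD G = setT -> (0 < h)%N -> exact_lab G (fun i => val (l i)) ->
  x n (labB G (fun i => val (l i))) =
  inv_Phi G * PhiG K n G (labB G (fun i => val (l i))).
Proof.
move=> wG DG h0 ex; rewrite /inv_Phi wG DG eqxx h0 /=.
rewrite (stable_exact (linf_stable xP) wG ex (lcan_exact wG)).
rewrite (stable_exact (PhiG_stable wG DG) wG ex (lcan_exact wG)).
by rewrite mulfVK // PhiG_exact_neq0 //; apply: lcan_exact.
Qed.

Lemma inv_Phi_wsupp : wsupp inv_Phi.
Proof.
by move=> h G; rewrite /inv_Phi; case: ifP => [/and3P[-> -> _]|_]; rewrite ?eqxx.
Qed.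

Lemma inv_Phi_pos h (G : pregraph 'I_h) : inv_Phi G != 0 -> (0 < h)%N.
Proof. by rewrite /inv_Phi; case: ifP => [/and3P[]//|_]; rewrite eqxx. Qed.

(* A union of components and its complement can be given disjoint sets of
   labels, so that primitivity applies to the two parts. *)
Lemma inv_Phi_connected h (G : pregraph 'I_h) : inv_Phi G != 0 -> connectedg G.
Proof.
move=> c0; have /andP[wG /eqP DG] := inv_Phi_wsupp c0; have h0 := inv_Phi_pos c0.
have vG := wf_vwf wG; apply: closed_connected => //.
  by rewrite DG -card_gt0 cardsT card_ord.
move=> S SD S0 cl; apply/eqP/negPn/negP => SnD.
have [j jD jS] : exists2 j, j \in hD G & j \notin S.
  apply/subsetPn; apply: contraNN SnD => DS; by rewrite eqEsubset SD.
have [i iS] := set0Pn _ S0.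
pose m := #|'I_h|.
(* The labels are at most [m] on [S] and lie between m + 1 and 2m + 1 elsewhere, as required by
   [primitiveP] with both indices equal to [m]. *)
pose l k : 'I_(m + m).+2 :=
  if k \in S then inord (val (lcan G k)) else inord (m.+1 + val (lcan G k))%N.
have lS k : k \in S -> val (l k) = val (lcan G k).
  move=> kS; rewrite /l kS /= inordK //.
  by apply: leq_trans (ltn_ord _) _; rewrite ltnS -addnS leq_addr.
have lN k : k \notin S -> val (l k) = (m.+1 + val (lcan G k))%N.
  move=> /negPf kS; rewrite /l kS /= inordK //.
  by rewrite addSn !ltnS leq_add2l -ltnS ltn_ord.
have lt k : (val (l k) < m.+1)%N = (k \in S).
  have [kS|kS] := boolP (k \in S); first by rewrite lS // ltn_ord.
  by rewrite lN // ltnNge leq_addr.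
have ex : exact_lab G (fun k => val (l k)).
  move=> k k' kD kD'.
  have [kS|kS] := boolP (k \in S); have [kS'|kS'] := boolP (k' \in S).
  - by rewrite !lS // lcan_exact.
  - transitivity false.
      by apply/eqP => e; move: (lt k') (lt k); rewrite -e kS (negPf kS') => ->.
    apply/esym/eqP => e; case/negP: kS'.
    have kb z : z \in hD G -> z \in pblock (hE G) z.
      by move=> zD; rewrite mem_pblock (cover_partition (wf_partE wG)).
    apply: (cl (pblock (hE G) k) k) => //; [|exact: kb|by rewrite e kb].
    by rewrite inE pblock_mem ?orbT // (cover_partition (wf_partE wG)).
  - transitivity false.
      by apply/eqP => e; move: (lt k') (lt k); rewrite -e kS' (negPf kS) => ->.
    apply/esym/eqP => e; case/negP: kS.
    have kb z : z \in hD G -> z \in pblock (hE G) z.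
      by move=> zD; rewrite mem_pblock (cover_partition (wf_partE wG)).
    apply: (cl (pblock (hE G) k) k') => //; [|by rewrite e kb|exact: kb].
    by rewrite inE pblock_mem ?orbT // (cover_partition (wf_partE wG)).
  - by rewrite !lN // eqn_add2l lcan_exact.
pose b := labB G (fun k => val (l k)).
have x0 : x (m + m).+1 b != 0.
  by rewrite inv_Phi_exact // mulf_neq0 // PhiG_exact_neq0.
have memb k : k \in hD G -> val (l k) \in blabels b.
  move=> kD; rewrite (perm_mem (perm_blabels_labB vG _)); apply/mapP; exists k => //.
  by rewrite mem_enum.
have a1 : b_all (fun i => (i < m.+1)%N) (filter_b m.+1 b).
  rewrite /b_all !(perm_all _ (perm_eq_seq_mset _)); apply/andP; split; exact: filter_all.
have a2 : b_all (fun i => (m.+1 <= i)%N) (filterC_b m.+1 b).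
  rewrite /b_all !(perm_all _ (perm_eq_seq_mset _)); apply/andP; split; last first.
    apply/allP => k; rewrite mem_filter -leqNgt; by case/andP.
  apply/allP => y; rewrite mem_filter => /andP[ny].
  rewrite (perm_mem (perm_eq_seq_mset _)) => /mapP[_ /mapP[v + ->] yE].
  rewrite mem_enum => vV; move: ny; rewrite yE.
  rewrite !(perm_all _ (perm_eq_seq_mset _)) => /allPn[_ /mapP[k kv ->]].
  rewrite mem_enum in kv; rewrite lt => kS.
  apply/allP => _ /mapP[k' kv' ->]; rewrite mem_enum in kv'.
  rewrite leqNgt lt; apply: contraNN kS => kS'.
  by apply: (cl v k') => //; rewrite inE; case/setDP: vV => ->.
have pl : perm_eq (blabels b) (blabels (filter_b m.+1 b) ++ blabels (filterC_b m.+1 b)).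
  by rewrite -{1}(join_filter m.+1 b); apply: perm_blabels_join.
have nil1 : blabels one_b = [::] by rewrite /blabels /= !enum_mset0.
case/eqP: x0; rewrite -(join_filter m.+1 b) -(relabel_up_shift a2).
apply: (iffLR (primitiveP xP) xprim) => //; apply/eqP => e.
  have := memb i (subsetP SD _ iS); rewrite (perm_mem pl) e nil1 /=.
  by move: a2; rewrite b_allE => /allP H /H; rewrite leqNgt lt iS.
have c2 : filterC_b m.+1 b = one_b.
  rewrite -(relabel_up_shift a2) e -[RHS]relabel_id; apply: eq_relabel => k.
  by rewrite nil1.
have := memb j jD; rewrite (perm_mem pl) c2 nil1 cats0.
by move: a1; rewrite b_allE => /allP H /H; rewrite lt (negPf jS).
Qed.

(** If all edges were external, the choice of an external vertex on each edge would be injective,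
    and there would be at least as many external vertices as edges, against N > k. *)
Lemma inv_Phi_int_edge h (G : pregraph 'I_h) : inv_Phi G != 0 -> has_int_edge G.
Proof.
move=> c0; have /andP[wG /eqP DG] := inv_Phi_wsupp c0; have h0 := inv_Phi_pos c0.
have vG := wf_vwf wG; have pE := wf_partE wG.
have : x #|'I_h| (labB G (fun k => val (lcan G k))) != 0.
  have ex := lcan_exact wG.
  by rewrite inv_Phi_exact // mulf_neq0 // PhiG_exact_neq0.
have [sx _] := xP #|'I_h|; move=> /sx/andP[_ /andP[_]].
rewrite mdeg_labB2 // bdeg_labB // card_D // ltn_pmul2l //; apply: contraLR.
rewrite negb_exists_in => /forall_inP all_ext; rewrite -leqNgt.
pose u (e : {set 'I_h}) := odflt set0 [pick u in hX G | u \subset e].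
have uP e : e \in hE G -> u e \in hX G /\ u e \subset e.
  move=> /all_ext /negPn /exists_inP[w wX we]; rewrite /u.
  by case: pickP => [w' /andP[]|/(_ w)] //=; rewrite wX we.
have uI : {in hE G &, injective u}.
  move=> e e' eE eE' ue; have [uX ue1] := uP _ eE; have [_ ue2] := uP _ eE'.
  have /card_gt0P[z zu] : (0 < #|u e|)%N by rewrite (vwf_card1 vG uX).
  apply: (block_uniq pE eE eE' (subsetP ue1 _ zu)).
  by apply: (subsetP ue2); rewrite -ue.
rewrite -(card_in_imset uI); apply: subset_leq_card.
by apply/subsetP => _ /imsetP[e /uP[uX _] ->].
Qed.

Lemma inv_Phi_in_Hc : in_Hc inv_Phi.
Proof.
split=> [h G c0|]; last exact: inv_Phi_iso.
have /andP[-> ->] := inv_Phi_wsupp c0.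
by rewrite inv_Phi_connected ?inv_Phi_int_edge.
Qed.

(** The edges of [Gpos b] are the classes of positions with equal labels, which are pairs because
    each label occurs twice. *)
Lemma Gpos_wf b : mset0 \notin b.1 -> pairing_b b -> wf_graph (Gpos b).
Proof.
move=> bn /allP pb; have vG := Gpos_vwf bn; case/and3P: (vG) => h1 h2 h3.
apply/and5P; split=> //; first exact: preim_partitionP.
apply/forall_inP => e eE.
have pE : partition (hE (Gpos b)) setT by exact: preim_partitionP.
have /set0Pn[i ie] : e != set0.
  by apply: contraTneq eE => ->; case/and3P: pE.
have -> : e = [set j | blab j == blab i].
  have -> : e = pblock (hE (Gpos b)) i.
    by rewrite (def_pblock (partition_trivIset pE) eE ie).
  apply/setP => j; rewrite inE eq_sym.
  have := @pblock_equivalence_partition _ (fun i j => blab i == blab j) setT _ i j.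
  move=> -> //; try by rewrite inE.
  by split=> // /eqP ->.
have lb : blab i \in blabels b by rewrite /blab mem_nth.
rewrite -(eqP (pb _ lb)); apply/eqP.
have E : map (@blab b) (enum 'I_(size (blabels b))) = blabels b.
  rewrite /blab (map_comp (nth 0%N (blabels b)) val) val_enum_ord.
  by rewrite map_nth_iota0 // take_size.
transitivity (count_mem (blab i) (map (@blab b) (enum 'I_(size (blabels b))))).
  rewrite count_map cardsE cardE size_filter enumT; exact: eq_count.
by rewrite E.
Qed.

Lemma Phi_inv_Phi : Phi inv_Phi = x.
Proof.
(* The difference of [x] and its candidate is again an invariant family, so it is enough to compare
   them where each label occurs twice. *)
have yP := in_linf_plus_lin (-1) (Phi_in_linf inv_Phi_in_Hc) xP.
apply: boolp.funext => n; apply: boolp.funext => b.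
apply/eqP; rewrite -subr_eq0 -oppr_eq0 opprB addrC -mulN1r; apply/eqP.
apply: (linf_eq0 charK yP) => {n b} n b pb.
rewrite mulN1r addrC; apply/eqP; rewrite subr_eq0; apply/eqP.
have [bin|bin] := boolP (b_in n.+1 b); last first.
  transitivity (0 : K); first by apply/eqP; apply: contraNT bin => /(linf_supp xP).
  apply/esym/eqP; apply: contraNT bin => P0.
  exact: (linf_supp (Phi_in_linf inv_Phi_in_Hc) P0).
have [b0|b0] := posnP (bdeg b).
  by rewrite (linf_one xP) // (linf_one (Phi_in_linf inv_Phi_in_Hc)).
have /andP[bn ba] := bin; rewrite b_allE in ba.
have wG := Gpos_wf bn pb; have DG : hD (Gpos b) = setT by [].
have h0 : (0 < size (blabels b))%N by rewrite -bdegE.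
pose l (i : 'I_(size (blabels b))) : 'I_n.+1 := inord (blab i).
have lE i : val (l i) = blab i.
  by rewrite /l /= inordK //; apply: (allP ba); rewrite /blab mem_nth.
have bE : b = labB (Gpos b) (fun i => val (l i)).
  rewrite -[LHS](Gpos_blab bn); apply: eq_labB; first exact: Gpos_vwf.
  by move=> i _; rewrite lE.
(* By construction two positions share an edge exactly when their labels agree, so [b] is an exact
   labelling of its own graph of positions. *)
have ex : exact_lab (Gpos b) (fun i => val (l i)).
  move=> i j _ _; rewrite !lE.
  have pE : partition (hE (Gpos b)) setT by exact: preim_partitionP.
  have Q := @pblock_equivalence_partition _ (fun i j => blab i == blab j) setT.
  rewrite eq_pblock ?(partition_trivIset pE) ?(cover_partition pE) ?inE //.
  apply/esym; apply: Q; rewrite ?inE //.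
  by split=> // /eqP ->.
rewrite [in LHS]bE [in RHS]bE.
rewrite (Phi_exact charK (Ordinal h0) inv_Phi_wsupp inv_Phi_iso wG DG ex).
exact: inv_Phi_exact.
Qed.

End Inverse.
End Surjective.

(** * Insertion of graphs *)

Section Partitions.
Variable T : finType.

Lemma partition_subD (P Q : {set {set T}}) (D : {set T}) :
  partition P D -> Q \subset P -> partition (P :\: Q) (D :\: cover Q).
Proof.
move=> pP QP; apply/and3P; split; last 2 first.
- exact: trivIsetS (subsetDl _ _) (partition_trivIset pP).
- by rewrite inE negb_and; case/and3P: pP => _ _ ->; rewrite orbT.
apply/eqP/setP => x; apply/bigcupP/setDP.
  case=> B /setDP[BP BQ] xB; split.
    by rewrite -(cover_partition pP); apply/bigcupP; exists B.
  apply/negP => /bigcupP[C CQ xC]; case/negP: BQ.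
  by rewrite (block_uniq pP BP (subsetP QP _ CQ) xB xC).
case=> /(in_block pP)[B BP xB] xQ; exists B => //; rewrite inE BP andbT.
by apply: contraNN xQ => BQ; apply/bigcupP; exists B.
Qed.

Lemma partition_U (P Q : {set {set T}}) (A B : {set T}) :
  partition P A -> partition Q B -> [disjoint A & B] -> partition (P :|: Q) (A :|: B).
Proof.
move=> pP pQ dAB; apply/and3P; split.
- by rewrite /cover bigcup_setU -!/(cover _) (cover_partition pP) (cover_partition pQ).
- have sub (R : {set {set T}}) D C : partition R D -> C \in R -> C \subset D.
    by move=> pR CR; rewrite -(cover_partition pR); apply: (bigcup_max C).
  apply/trivIsetP => C C' /setUP[CP|CQ] /setUP[CP'|CQ'].
  + exact: (trivIsetP (partition_trivIset pP)).
  + move=> _; apply: disjointWl (sub _ _ _ pP CP) _.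
    exact: disjointWr (sub _ _ _ pQ CQ') dAB.
  + move=> _; rewrite disjoint_sym; apply: disjointWl (sub _ _ _ pP CP') _.
    exact: disjointWr (sub _ _ _ pQ CQ) dAB.
  + exact: (trivIsetP (partition_trivIset pQ)).
- by rewrite inE negb_or; case/and3P: pP => _ _ ->; case/and3P: pQ.
Qed.

End Partitions.

Section Insertion.
Variables (T1 T2 : finType) (G1 : pregraph T1) (G2 : pregraph T2).
Hypotheses (w1 : wf_graph G1) (w2 : wf_graph G2).
Hypotheses (co2 : connectedg G2) (ie2 : has_int_edge G2).
Local Notation X2 := (cover (hX G2)).
Local Notation Hext := (cover (Eext G2)).
Let v1 := wf_vwf w1.
Let v2 := wf_vwf w2.
Let pE1 := wf_partE w1.
Let pE2 := wf_partE w2.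

Lemma Eext_E e : e \in Eext G2 -> e \in hE G2.
Proof. by rewrite inE => /andP[]. Qed.

(** Connectedness and an internal edge enter through [ext_edge1]: without them both ends of an edge
    could be external and no inner half-edge would be left to attach. *)
Lemma EextP e : e \in Eext G2 -> exists x y, [/\ x \in X2, y \notin X2 & e = [set x; y]].
Proof.
rewrite inE => /andP[eE /exists_inP[u uX ue]].
have /eqP/cards1P[x xu] := vwf_card1 v2 uX; rewrite xu sub1set in ue uX.
have /eqP/cards2P[a [b [ab eab]]] := wf_card2 w2 eE.
have xX : x \in X2 by rewrite coverXE.
have main y : y \in e -> x != y -> exists x y, [/\ x \in X2, y \notin X2 & e = [set x; y]].
  move=> ye xy; exists x, y; split=> //; last exact: (edgeP w2 eE ue ye xy).
  by apply: contra_neqN xy => yX; apply: (ext_edge1 w2 co2 ie2 eE).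
have [xa|xa] := eqVneq x a; last by apply: (main a) => //; rewrite eab set21.
by apply: (main b); rewrite ?eab ?set22 // xa.
Qed.

Lemma X2_Hext : X2 \subset Hext.
Proof.
apply/subsetP => x xX; have xD := subsetP (coverX_sub v2) _ xX.
have [e eE xe] := in_block pE2 xD; apply/bigcupP; exists e => //.
by rewrite inE eE; apply/exists_inP; exists [set x]; rewrite ?sub1set // -coverXE.
Qed.

Lemma Hext_D : Hext \subset hD G2.
Proof. by apply/bigcupsP => e /Eext_E; apply: edge_subD. Qed.

Lemma card_Eext : #|Eext G2| = #|X2|.
Proof.
have inD x : x \in X2 -> x \in cover (hE G2).
  by move=> /(subsetP (coverX_sub v2)); rewrite (cover_partition pE2).
have pI : {in X2 &, injective (pblock (hE G2))}.
  move=> x y xX yX e; apply: (ext_edge1 w2 co2 ie2 (e := pblock (hE G2) x)) => //.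
  - by apply: pblock_mem; apply: inD.
  - by rewrite mem_pblock inD.
  - by rewrite e mem_pblock inD.
rewrite -(card_in_imset pI); apply: eq_card => e; apply/idP/imsetP.
  move=> eX; have [x [y [xX yX eE]]] := EextP eX; exists x => //.
  rewrite (def_pblock (partition_trivIset pE2) (Eext_E eX)) //.
  by rewrite eE set21.
case=> x xX ->; rewrite inE pblock_mem ?inD //; apply/exists_inP; exists [set x].
  by rewrite -coverXE.
by rewrite sub1set mem_pblock inD.
Qed.

Lemma inner_uniq e y y' : e \in Eext G2 -> y \in e -> y' \in e -> y \notin X2 ->
  y' \notin X2 -> y = y'.
Proof.
move=> /EextP[x [z [xX zX ->]]]; rewrite !inE.
by move=> /orP[] /eqP -> /orP[] /eqP -> //; rewrite xX.
Qed.

Section Fix.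
Variables (v : {set T1}) (s : {ffun T1 -> {set T2}}).
Hypotheses (vV : v \in Vint G1) (sP : valid_s G2 v s).
Local Notation ins := (insertg G1 G2 v s).

Lemma sE h : h \in v -> s h \in Eext G2.
Proof. by case/and4P: sP => /forall_inP H _ _ _; apply: H. Qed.
Lemma sI : {in v &, injective s}.
Proof.
case/and4P: sP => _ /forall_inP H _ _ h h' hv hv' e.
by have /forall_inP/(_ _ hv')/implyP := H _ hv; rewrite e eqxx => /(_ isT)/eqP.
Qed.
Lemma sS e : e \in Eext G2 -> exists2 h, h \in v & s h = e.
Proof.
case/and4P: sP => _ _ /forall_inP H _ /H/exists_inP[h hv /eqP]; by exists h.
Qed.

Lemma s_uniq h h' z : h \in v -> h' \in v -> z \in s h -> z \in s h' -> h = h'.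
Proof.
move=> hv hv' zh zh'; apply: sI => //.
by apply: (block_uniq pE2 _ _ zh zh'); apply/Eext_E/sE.
Qed.

(* Where an internal half-edge of [G2] ends up after the insertion. *)
Definition rho (z : T2) : T1 + T2 :=
  if [pick h in v | z \in s h] is Some h then inl h else inr z.

Lemma rho_in h z : h \in v -> z \in s h -> rho z = inl h.
Proof.
move=> hv zh; rewrite /rho; case: pickP => [h' /andP[hv' zh']|/(_ h)].
  by rewrite (s_uniq hv hv' zh zh').
by rewrite hv zh.
Qed.

Lemma rho_out z : z \notin Hext -> rho z = inr z.
Proof.
move=> zH; rewrite /rho; case: pickP => [h' /andP[hv' zh']|//].
by case/negP: zH; apply/bigcupP; exists (s h') => //; apply: sE.
Qed.

Lemma HextP z : z \in Hext -> exists2 h, h \in v & z \in s h.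
Proof. by case/bigcupP => e /sS[h hv <-] zh; exists h. Qed.

(** External half-edges are excluded because both ends of an external edge are sent to the same
    half-edge of [v]. *)
Lemma rho_inj : {in hD G2 :\: X2 &, injective rho}.
Proof.
move=> z z' /setDP[_ zX] /setDP[_ zX'].
have [zH|zH] := boolP (z \in Hext); have [zH'|zH'] := boolP (z' \in Hext).
- have [h hv zh] := HextP zH; have [h' hv' zh'] := HextP zH'.
  rewrite (rho_in hv zh) (rho_in hv' zh') => -[e]; rewrite -e in zh'.
  exact: inner_uniq (sE hv) _ _ _ _.
- by have [h hv zh] := HextP zH; rewrite (rho_in hv zh) rho_out.
- by have [h hv zh] := HextP zH'; rewrite (rho_in hv zh) rho_out.
- by rewrite !rho_out // => -[].
Qed.

Lemma s_inner h : h \in v -> exists2 y, y \in s h & y \notin X2.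
Proof. by move=> /sE/EextP[x [y [xX yX ->]]]; exists y; rewrite ?set22. Qed.

Lemma rho_im : rho @: (hD G2 :\: X2) = inl @: v :|: inr @: (hD G2 :\: Hext).
Proof.
apply/setP => t; apply/imsetP/setUP.
  case=> z /setDP[zD zX] ->; have [zH|zH] := boolP (z \in Hext).
    by have [h hv zh] := HextP zH; left; rewrite (rho_in hv zh) imset_f.
  by right; rewrite rho_out // imset_f // inE zH.
case=> /imsetP[].
  move=> h hv ->; have [y yh yX] := s_inner hv; exists y; rewrite ?(rho_in hv yh) //.
  rewrite inE yX; apply: (subsetP Hext_D); apply/bigcupP; exists (s h) => //.
  exact: sE.
move=> z /setDP[zD zH] ->; exists z; rewrite ?rho_out // inE zD andbT.
by apply: contraNN zH => /(subsetP X2_Hext).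
Qed.

Lemma vint2_X w : w \in Vint G2 -> w \subset hD G2 :\: X2.
Proof.
move=> wV; apply/subsetP => z zw; have zD := subsetP (vint_subD v2 wV) _ zw.
rewrite inE zD andbT; have := vint_or_X v2 zD.
have -> : [exists w in Vint G2, z \in w] by apply/exists_inP; exists w.
by rewrite addbT.
Qed.

Lemma rho_vertex w : w \in Vint G2 ->
  (@inr T1 T2 @: (w :\: \bigcup_(e in Eext G2) e)) :|:
  (@inl T1 T2 @: [set h in v | (s h :\: \bigcup_(u in hX G2) u) :&: w != set0]) = rho @: w.
Proof.
move=> wV; apply/setP => t; apply/setUP/imsetP.
  case=> /imsetP[].
    by move=> z /setDP[zw zH] ->; exists z; rewrite ?rho_out.
  move=> h; rewrite inE => /andP[hv /set0Pn[z /setIP[/setDP[zh _] zw]]] ->.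
  by exists z; rewrite ?(rho_in hv zh).
case=> z zw ->; have /setDP[zD zX] := subsetP (vint2_X wV) _ zw.
have [zH|zH] := boolP (z \in Hext); last first.
  by left; rewrite rho_out // imset_f // inE zH.
have [h hv zh] := HextP zH; right; rewrite (rho_in hv zh) imset_f // inE hv /=.
by apply/set0Pn; exists z; rewrite !inE zh zw !andbT.
Qed.

Lemma insV : hV ins = [set @inl T1 T2 @: w | w : {set T1} in hV G1 :\ v] :|:
  [set rho @: w | w : {set T2} in Vint G2].
Proof.
congr (_ :|: _); apply: eq_in_imset => w wV; exact: rho_vertex.
Qed.

Lemma vV1 : v \in hV G1. Proof. by case/setDP: vV. Qed.
Lemma vD1 : v \subset hD G1. Proof. exact: vwf_subD vV1. Qed.
Lemma v_neq0 : v != set0.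
Proof. by apply: contraTneq vV1 => ->; case/and3P: (vwf_part v1). Qed.

(** [insertg] sorts half-edges according to the edges, all of [G1] against the interior of [G2].
    Here they are sorted by vertices, [G1] away from [v] against the vertices of [G2], as the vertex
    partition requires. *)
Lemma insD : hD ins = @inl T1 T2 @: (hD G1 :\: v) :|: rho @: (hD G2 :\: X2).
Proof.
rewrite rho_im setUA -imsetU; congr (_ @: _ :|: _).
by rewrite setUC -{1}(setID (hD G1) v) (setIidPr vD1).
Qed.

Lemma inl_I (A : {set T1}) : {in A &, injective (@inl T1 T2)}.
Proof. by move=> x y _ _ []. Qed.
Lemma inr_I (A : {set T2}) : {in A &, injective (@inr T1 T2)}.
Proof. by move=> x y _ _ []. Qed.

Lemma pVint2 : partition (Vint G2) (hD G2 :\: X2).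
Proof. exact: partition_subD (vwf_part v2) (vwf_sub v2). Qed.

Lemma ins_disj : [disjoint (@inl T1 T2 @: (hD G1 :\: v)) & (rho @: (hD G2 :\: X2))].
Proof.
rewrite rho_im -setI_eq0; apply/eqP/setP => t; rewrite !inE.
apply/negP => /andP[/imsetP[h /setDP[_ hv] ->] /orP[] /imsetP[k kv []]] //.
by move=> e; rewrite -e (negPf hv) in kv.
Qed.

Lemma ins_wf : wf_graph ins.
Proof.
apply/and5P; split.
- apply: partition_U.
  + exact: (@partition_imset _ _ (@inl T1 T2) (hE G1) (hD G1) (@inl_I _) pE1).
  + apply: (@partition_imset _ _ (@inr T1 T2) _ _ (@inr_I _)).
    by apply: partition_subD pE2 _; apply/subsetP => e /Eext_E.
  + rewrite -setI_eq0; apply/eqP/setP => t; rewrite !inE.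
    by apply/negP => /andP[/imsetP[h _ ->] /imsetP[]].
- apply/forall_inP => _ /setUP[] /imsetP[e eE ->].
    by rewrite card_in_imset ?(wf_card2 w1 eE) //; apply: inl_I.
  rewrite card_in_imset; last exact: inr_I.
  by case/setDP: eE => eE _; rewrite (wf_card2 w2 eE).
- rewrite insV insD; apply: partition_U ins_disj.
    apply: (@partition_imset _ _ (@inl T1 T2) _ _ (@inl_I _)).
    exact: partitionD1 (vwf_part v1) vV1.
  exact: (@partition_imset _ _ rho _ _ rho_inj pVint2).
- rewrite insV; apply: subset_trans (subsetUl _ _).
  apply: imsetS; apply/subsetP => u uX; rewrite !inE (subsetP (vwf_sub v1)) // andbT.
  by apply: contraTneq uX => ->; case/setDP: vV.
- apply/forall_inP => _ /imsetP[u uX ->]; rewrite card_in_imset; last exact: inl_I.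
  by rewrite (vwf_card1 v1 uX).
Qed.

Lemma ins_Vint : Vint ins = [set @inl T1 T2 @: w | w : {set T1} in Vint G1 :\ v] :|:
  [set rho @: w | w : {set T2} in Vint G2].
Proof.
rewrite /Vint insV setDUl; congr (_ :|: _).
  have iI : injective (fun w : {set T1} => @inl T1 T2 @: w).
    by apply: imset_inj => x y [].
  apply/setP => t; apply/setDP/imsetP.
    case=> /imsetP[w /setD1P[wv wV] ->] wX; exists w => //; rewrite !inE wv wV andbT /=.
    by apply: contraNN wX => wX; apply: imset_f.
  case=> w; rewrite !inE => /and3P[wv wX wV] ->; split.
    by apply: imset_f; rewrite !inE wv.
  by apply: contraNN wX => /imsetP[u uX /iI ->].
apply/setDidPl; rewrite -setI_eq0; apply/eqP/setP => t; rewrite !inE.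
apply/negP => /andP[/imsetP[w wV ->] /imsetP[u uX e]].
have wn : w != set0 by apply: contraTneq wV => ->; case/and3P: pVint2.
case/set0Pn: wn => z zw; have : rho z \in rho @: w by rewrite imset_f.
have zD := subsetP (vint2_X wV) _ zw.
have : rho z \in rho @: (hD G2 :\: X2) by rewrite imset_f.
rewrite rho_im e => /setUP[] /imsetP[k kv ->] /imsetP[h hu [] // kh].
have uv : u = v.
  apply: (block_uniq (vwf_part v1) (subsetP (vwf_sub v1) _ uX) vV1 hu).
  by rewrite -kh.
by case/setDP: vV; rewrite -uv uX.
Qed.

(** The vertices are those of [G1] without [v] and those of [G2] transported by [rho], so the basis
    element has the shape produced by [circ_coef]: the monomial of [v] is removed once and the first
    factor of [G2] multiplied in. *)
Lemma ins_labB (l : T1 + T2 -> nat) :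
  labB ins l =
  (msetD (labB G2 (fun z => l (rho z))).1
     (msetB (labB G1 (fun h => l (inl h))).1
        (msetn 1 (seq_mset [seq l (inl h) | h <- enum v] : mono))),
   (labB G1 (fun h => l (inl h))).2).
Proof.
pose Y (T : finType) (k : T -> nat) (w : {set T}) : mono := seq_mset [seq k h | h <- enum w].
have labE (T : finType) (G : pregraph T) k :
    (labB G k).1 = seq_mset (map (Y T k) (enum (Vint G))).
  by rewrite /labB /mkb /= -map_comp.
have Yim (T T' : finType) (f : T -> T') (k : T' -> nat) (w : {set T}) :
   {in w &, injective f} -> Y _ k (f @: w) = Y _ (fun h => k (f h)) w.
  move=> fI; apply/eq_seq_msetP; rewrite (map_comp k f); apply: perm_map.
  exact: perm_enum_imset.
rewrite [LHS]surjective_pairing; congr pair; last first.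
  apply/eq_seq_msetP; rewrite (map_comp l inl); apply: perm_map.
  have -> : cover (hX ins) = @inl T1 T2 @: cover (hX G1).
    apply/setP => y; apply/bigcupP/imsetP.
      case=> _ /imsetP[u uX ->] /imsetP[x xu ->]; exists x => //.
      by apply/bigcupP; exists u.
    by case=> x /bigcupP[u uX xu] ->; exists (inl @: u); rewrite imset_f.
  by apply: perm_enum_imset; apply: inl_I.
rewrite !labE ins_Vint.
have dj : [disjoint [set @inl T1 T2 @: w | w : {set T1} in Vint G1 :\ v] &
    [set rho @: w | w : {set T2} in Vint G2]].
  rewrite -setI_eq0; apply/eqP/setP => t; rewrite !inE.
  apply/negP => /andP[/imsetP[w /setD1P[wv wV] ->] /imsetP[u uV e]].
  have un : u != set0 by apply: contraTneq uV => ->; case/and3P: pVint2.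
  case/set0Pn: un => z zu; have : rho z \in rho @: u by rewrite imset_f.
  have zD := subsetP (vint2_X uV) _ zu.
  have : rho z \in rho @: (hD G2 :\: X2) by rewrite imset_f.
  rewrite rho_im -e => /setUP[] /imsetP[k kv ->] /imsetP[h hu [] // kh].
  case/eqP: wv; case/setDP: wV => wV _.
  by apply: (block_uniq (vwf_part v1) wV vV1 hu); rewrite -kh.
have inlI : {in Vint G1 :\ v &, injective (fun w : {set T1} => @inl T1 T2 @: w)}.
  by move=> x y _ _; apply: imset_inj => a b [].
have rhoI : {in Vint G2 &, injective (fun w : {set T2} => rho @: w)}.
  move=> w w' wV wV' e; apply: (imset_inj_in rho_inj); rewrite ?inE //=; exact: vint2_X.
have pU (T : finType) (A B : {set T}) : [disjoint A & B] ->
    perm_eq (enum (A :|: B)) (enum B ++ enum A).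
  move=> dAB; apply: uniq_perm; first exact: enum_uniq.
    rewrite cat_uniq !enum_uniq andbT /=; apply/hasPn => x; rewrite !mem_enum => xA.
    by rewrite (disjointFr dAB xA).
  by move=> x; rewrite mem_cat !mem_enum inE orbC.
have -> : seq_mset (map (Y _ l) (enum ([set @inl T1 T2 @: w | w : {set T1} in Vint G1 :\ v] :|:
   [set rho @: w | w : {set T2} in Vint G2]))) =
  msetD (seq_mset (map (Y _ (fun z => l (rho z))) (enum (Vint G2))))
        (seq_mset (map (Y _ (fun h => l (inl h))) (enum (Vint G1 :\ v)))).
  rewrite -seq_mset_cat; apply/eq_seq_msetP.
  rewrite (permPl (perm_map _ (pU _ _ _ dj))) map_cat; apply: perm_cat.
    rewrite (permPl (perm_map _ (perm_enum_imset rhoI))) -map_comp.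
    apply: perm_of_eq; apply/eq_in_map => w; rewrite mem_enum => wV /=; apply: Yim.
    by move=> x y xw yw; apply: rho_inj; apply: (subsetP (vint2_X wV)).
  rewrite (permPl (perm_map _ (perm_enum_imset inlI))) -map_comp.
  apply: perm_of_eq; apply/eq_in_map => w _ /=; apply: Yim; exact: inl_I.
congr msetD.
have pv : perm_eq (enum (Vint G1)) (v :: enum (Vint G1 :\ v)).
  apply: uniq_perm; first exact: enum_uniq.
    by rewrite /= mem_enum !inE eqxx enum_uniq.
  move=> w; rewrite inE !mem_enum !inE; case: (w =P v) => [->|] //=.
  by move: vV; rewrite inE.
have /eq_seq_msetP -> := perm_map (Y _ (fun h => l (inl h))) pv.
by rewrite /= mset_cons msetD1K.
Qed.

End Fix.
End Insertion.

(** * Connectedness, size and labellings of the inserted graph *)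

Section InsertionLabels.
Variables (T1 T2 : finType) (G1 : pregraph T1) (G2 : pregraph T2).
Hypotheses (w1 : wf_graph G1) (w2 : wf_graph G2).
Hypotheses (co2 : connectedg G2) (ie2 : has_int_edge G2).
Local Notation X2 := (cover (hX G2)).
Local Notation Hext := (cover (Eext G2)).
Let v1 := wf_vwf w1.
Let v2 := wf_vwf w2.
Let pE2 := wf_partE w2.

Section Fix.
Variables (v : {set T1}) (s : {ffun T1 -> {set T2}}).
Hypotheses (vV : v \in Vint G1) (sP : valid_s G2 v s).
Local Notation ins := (insertg G1 G2 v s).
Local Notation rh := (rho v s).

Lemma ins_inl h : (inl h \in hD ins) = (h \in hD G1).
Proof.
apply/setUP/idP => [[] /imsetP[k kD []] // -> //|hD]; by left; apply: imset_f.
Qed.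
Lemma ins_inr z : (inr z \in hD ins) = (z \in hD G2 :\: Hext).
Proof.
apply/setUP/idP => [[] /imsetP[k kD []] // -> //|hD]; by right; apply: imset_f.
Qed.

Lemma ins_connected : connectedg G1 -> connectedg ins.
Proof.
move=> co1; have wi := ins_wf w1 w2 co2 ie2 vV sP.
have /set0Pn[h0 h0v] := v_neq0 w1 vV.
have h0D : h0 \in hD G1 by apply: (subsetP (vD1 w1 vV)).
apply: closed_connected => //; first by apply/set0Pn; exists (inl h0); rewrite ins_inl.
move=> S SD S0 cl.
pose S2 := [set z in hD G2 | rh z \in S].
pose S1 := [set h in hD G1 | inl h \in S].
have cl2 : block_closed G2 S2.
  move=> B z z' BP zB zB'; rewrite !inE => /andP[zD rz].
  rewrite (subsetP (block_subD w2 BP)) //=.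
  case/setUP: BP => BP; last first.
    (* Both ends of an external edge have the same image under [rho], so an edge that disappears
       causes no loss of connectedness. *)
    have [BX|BX] := boolP (B \in Eext G2).
      have [h hv hB] := sS sP BX; rewrite -hB in zB zB'.
      by rewrite (rho_in w2 sP hv zB') -(rho_in w2 sP hv zB).
    have nH y : y \in B -> y \notin Hext.
      move=> yB; apply/negP => /bigcupP[e eX ye]; case/negP: BX.
      by rewrite (block_uniq pE2 BP (Eext_E eX) yB ye).
    rewrite (rho_out sP) ?nH //; rewrite (rho_out sP) ?nH // in rz.
    apply: (cl (inr @: B) (inr z)) => //; try exact: imset_f.
    by rewrite !inE; apply/orP; right; apply/orP; right; rewrite imset_f // inE BX.
  have [BX|BX] := boolP (B \in hX G2).
    have /eqP/cards1P[y By] := vwf_card1 v2 BX.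
    by move: zB zB'; rewrite By !inE => /eqP <- /eqP ->.
  have BI : B \in Vint G2 by rewrite inE BX.
  apply: (cl (rh @: B) (rh z)) => //; try exact: imset_f.
  rewrite inE insV //; apply/orP; left; rewrite inE; apply/orP; right; exact: imset_f.
have S2P : S2 != set0 -> S2 = hD G2.
  move=> S2n; apply: connected_closed => //.
  by apply/subsetP => z; rewrite inE => /andP[].
have shD h z : h \in v -> z \in s h -> z \in hD G2.
  move=> hv zh; apply: (subsetP (Hext_D w2)); apply/bigcupP; exists (s h) => //.
  exact: (sE sP hv).
(* The vertex [v] is gone, but its half-edges are now linked through [G2], which is connected. *)
have vS h h' : h \in v -> h' \in v -> inl h \in S -> inl h' \in S.
  move=> hv hv' hS; have [y yh _] := s_inner w2 co2 ie2 sP hv.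
  have [y' yh' _] := s_inner w2 co2 ie2 sP hv'.
  have : y' \in S2.
    rewrite S2P ?(shD h') //; apply/set0Pn; exists y.
    by rewrite inE (shD h) // (rho_in w2 sP hv yh).
  by rewrite inE (rho_in w2 sP hv' yh') => /andP[].
have cl1 : block_closed G1 S1.
  move=> B h h' BP hB hB'; rewrite !inE => /andP[hD hS].
  rewrite (subsetP (block_subD w1 BP)) //=.
  have [Bv|Bv] := eqVneq B v; first by apply: (vS h); rewrite -?Bv.
  apply: (cl (inl @: B) (inl h)) => //; try exact: imset_f.
  rewrite inE insV // inE; case/setUP: BP => BP.
    by apply/orP; left; apply/orP; left; rewrite imset_f // !inE Bv.
  by apply/orP; right; rewrite inE imset_f.
have S1P : S1 != set0 -> S1 = hD G1.
  move=> S1n; apply: connected_closed => //.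
  by apply/subsetP => z; rewrite inE => /andP[].
have [y0 y0h _] := s_inner w2 co2 ie2 sP h0v.
have y0D : y0 \in hD G2 by apply: shD y0h.
have both : inl h0 \in S.
  case/set0Pn: S0 => -[h|z] tS; have := subsetP SD _ tS.
    rewrite ins_inl => hD; have : h0 \in S1.
      by rewrite S1P //; apply/set0Pn; exists h; rewrite inE hD.
    by rewrite inE => /andP[].
  rewrite ins_inr => /setDP[zD zH]; have : y0 \in S2.
    by rewrite S2P //; apply/set0Pn; exists z; rewrite inE zD (rho_out sP).
  by rewrite inE (rho_in w2 sP h0v y0h) => /andP[].
apply/eqP; rewrite eqEsubset SD; apply/subsetP => -[h|z].
  rewrite ins_inl => hD; have : h \in S1.
    by rewrite S1P //; apply/set0Pn; exists h0; rewrite inE h0D.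
  by rewrite inE => /andP[].
rewrite ins_inr => /setDP[zD zH]; have : z \in S2.
  rewrite S2P //; apply/set0Pn; exists y0.
  by rewrite inE y0D (rho_in w2 sP h0v y0h).
by rewrite inE (rho_out sP) // => /andP[].
Qed.

Lemma ins_int_edge : has_int_edge G1 -> has_int_edge ins.
Proof.
case/exists_inP => e eE /negP ne; apply/exists_inP; exists (inl @: e).
  by rewrite inE imset_f.
apply/negP => /exists_inP[_ /imsetP[u uX ->] /subsetP ue].
apply: ne; apply/exists_inP; exists u => //; apply/subsetP => x xu.
by have /ue/imsetP[y ye [->]] : @inl T1 T2 x \in inl @: u by apply: imset_f.
Qed.

Lemma card_ins_D1 : (#|hD G1| <= #|hD ins|)%N.
Proof.
have inlI : injective (@inl T1 T2) by move=> x y [].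
rewrite -(card_imset _ inlI).
by apply: subset_leq_card; apply: subsetUl.
Qed.

(** An insertion deletes two half-edges of [G2] for each half-edge of [v]. With [card_ins_D1] this
    bounds the sizes of both factors by that of the result. *)
Lemma card_ins_D2 : (#|hD G2| <= #|hD ins| + 2 * #|hD G1|)%N.
Proof.
rewrite -(cardsID Hext (hD G2)) addnC; apply: leq_add.
  have inrI : injective (@inr T1 T2) by move=> x y [].
  rewrite -(card_imset _ inrI).
  by apply: subset_leq_card; apply: subsetUr.
apply: (@leq_trans #|Hext|); first by apply: subset_leq_card; apply: subsetIr.
have tX : trivIset (Eext G2).
  by apply: trivIsetS (partition_trivIset pE2); apply/subsetP => e /Eext_E.
rewrite -(eqP tX) (eq_bigr (fun _ => 2%N)); last first.
  by move=> e /Eext_E; apply: wf_card2.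
rewrite sum_nat_const mulnC leq_mul2l /=.
apply: (@leq_trans #|v|); last by apply: subset_leq_card; apply: vD1 vV.
rewrite -(card_in_imset (sI sP)); apply: subset_leq_card.
by apply/subsetP => e /(sS sP)[h hv <-]; apply: imset_f.
Qed.

Section Count.
Variables (K : fieldType) (n : nat).

Definition compat_s (l1 : {ffun T1 -> 'I_n.+1}) (l2 : {ffun T2 -> 'I_n.+1}) := [forall h in v, forall z in s h, l2 z == l1 h].

Lemma compatP (l1 : {ffun T1 -> 'I_n.+1}) (l2 : {ffun T2 -> 'I_n.+1}) : reflect (forall h z, h \in v -> z \in s h -> l2 z = l1 h)
  (compat_s l1 l2).
Proof.
apply: (iffP forall_inP) => [H h z hv zh|H h hv].
  by have /forall_inP/(_ _ zh)/eqP := H _ hv.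
by apply/forall_inP => z zh; rewrite (H h).
Qed.

Definition circ_b (b1 b2 : basis) (y : mono) : basis :=
  (msetD b2.1 (msetB b1.1 (msetn 1 y)), b1.2).

Definition vmono (l1 : {ffun T1 -> 'I_n.+1}) : mono := seq_mset [seq val (l1 h) | h <- enum v].

Lemma PhiG_ins b :
  PhiG K n ins b =
  \sum_(p : {ffun T1 -> 'I_n.+1} * {ffun T2 -> 'I_n.+1}
    | [&& offz (hD G1) p.1 && econst (hE G1) p.1,
          offz (hD G2) p.2 && econst (hE G2) p.2 & compat_s p.1 p.2])
  (circ_b (labB G1 (fun h => val (p.1 h))) (labB G2 (fun h => val (p.2 h)))
     (vmono p.1) == b)%:R.
Proof.
have wi := ins_wf w1 w2 co2 ie2 vV sP.
rewrite PhiGE ?wf_vwf //.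
pose fwd (l : {ffun T1 + T2 -> 'I_n.+1}) : {ffun T1 -> 'I_n.+1} * {ffun T2 -> 'I_n.+1} :=
  ([ffun h => l (inl h)], [ffun z => l (rh z)]).
(* The half-edges of external edges of [G2] do not belong to the inserted graph, so they get the
   default label; their true labels are recovered through [rho] from those on [v]. *)
pose back (p : {ffun T1 -> 'I_n.+1} * {ffun T2 -> 'I_n.+1}) : {ffun T1 + T2 -> 'I_n.+1} :=
  [ffun t => match t with inl h => p.1 h | inr z => if z \in Hext then ord0 else p.2 z end].
have bkrho (l1 : {ffun T1 -> 'I_n.+1}) (l2 : {ffun T2 -> 'I_n.+1}) z : compat_s l1 l2 -> back (l1, l2) (rh z) = l2 z.
  move=> /compatP cp; have [zH|zH] := boolP (z \in Hext).
    by have [h hv zh] := HextP sP zH; rewrite (rho_in w2 sP hv zh) ffunE /= (cp h).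
  by rewrite (rho_out sP) // ffunE (negPf zH).
rewrite (reindex_onto back fwd) /=; last first.
  move=> l /andP[/offzP lo _]; apply/ffunP => -[h|z]; rewrite !ffunE //=.
  case: ifPn => zH; last by rewrite (rho_out sP).
  by rewrite lo // ins_inr inE zH.
apply: eq_big => [[l1 l2]|[l1 l2]] /=; last first.
  move=> /andP[_ /eqP [_ e2]]; apply: (f_equal (fun x : basis => (x == b)%:R : K)).
  rewrite (ins_labB w1 w2 co2 ie2 vV sP).
  have E2 : labB G2 (fun z => val (back (l1, l2) (rh z))) = labB G2 (fun z => val (l2 z)).
    by apply: eq_labB => // z _; rewrite -{2}e2 ffunE.
  have E1 : labB G1 (fun h => val (back (l1, l2) (inl h))) = labB G1 (fun h => val (l1 h)).
    by apply: eq_labB => // h _; rewrite ffunE.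
  have E3 : [seq val (back (l1, l2) (inl h)) | h <- enum v] = [seq val (l1 h) | h <- enum v].
    by apply: eq_map => h; rewrite ffunE.
  by rewrite E1 E2 E3.
apply/idP/idP.
  case/andP=> /andP[/offzP lo /econstP lc] /eqP [_ e2].
  have cp : compat_s l1 l2.
    apply/compatP => h z hv zh.
    by rewrite -e2 ffunE (rho_in w2 sP hv zh) ffunE.
  rewrite cp andbT; apply/andP; split; apply/andP; split.
  - by apply/offzP => h hD; have := lo (inl h); rewrite ins_inl ffunE; apply.
  - apply/econstP => e h h' eE he he'.
    have := lc (inl @: e) (inl h) (inl h'); rewrite !ffunE; apply; try exact: imset_f.
    by rewrite inE imset_f.
  - apply/offzP => z zD; have zH : z \notin Hext by apply: contraNN zD => /(subsetP (Hext_D w2)).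
    by have := lo (inr z); rewrite ins_inr ffunE (negPf zH); apply; rewrite inE (negPf zD) andbF.
  - apply/econstP => e z z' eE ze ze'.
    have [eX|eX] := boolP (e \in Eext G2).
      have [h hv he] := sS sP eX; rewrite -he in ze ze'.
      by have /compatP cp' := cp; rewrite (cp' h z) // (cp' h z').
    have nH y : y \in e -> (y \in Hext) = false.
      move=> ye; apply/negP => /bigcupP[e' eX' ye']; case/negP: eX.
      by rewrite (block_uniq pE2 eE (Eext_E eX') ye ye').
    have := lc (inr @: e) (inr z) (inr z'); rewrite !ffunE !nH //.
    by apply; rewrite ?imset_f // inE; apply/orP; right; rewrite imset_f // inE eX.
case/and3P => /andP[/offzP lo1 /econstP lc1] /andP[/offzP lo2 /econstP lc2] cp.
apply/andP; split; last first.
  rewrite /fwd; apply/eqP; congr pair; apply/ffunP => t; first by rewrite !ffunE.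
  by rewrite ffunE bkrho.
apply/andP; split.
  apply/offzP => -[h|z]; rewrite ?ins_inl ?ins_inr ffunE; first exact: lo1.
  rewrite inE negb_and negbK; case: ifP => //= _; exact: lo2.
apply/econstP => B t t' /setUP[] /imsetP[e eE ->] /imsetP[x xe ->] /imsetP[y ye ->].
  by rewrite !ffunE; apply: (lc1 e).
case/setDP: eE => eE eX; have nH z : z \in e -> (z \in Hext) = false.
  move=> ze; apply/negP => /bigcupP[e' eX' ze']; case/negP: eX.
  by rewrite (block_uniq pE2 eE (Eext_E eX') ze ze').
by rewrite !ffunE !nH //; apply: (lc2 e).
Qed.

End Count.
End Fix.
End InsertionLabels.

(** * The pairing as a count of bijections *)

Section CircLabels.
Variables (T1 T2 : finType) (G1 : pregraph T1) (G2 : pregraph T2).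
Hypotheses (w1 : wf_graph G1) (w2 : wf_graph G2).
Hypotheses (co2 : connectedg G2) (ie2 : has_int_edge G2).
Local Notation X2 := (cover (hX G2)).
Let v1 := wf_vwf w1.
Let v2 := wf_vwf w2.
Let pE2 := wf_partE w2.
Variables (K : fieldType) (n : nat).

Section Pairing.
Variables (l1 : {ffun T1 -> 'I_n.+1}) (l2 : {ffun T2 -> 'I_n.+1}) (v : {set T1}).
Hypothesis lc2 : econst (hE G2) l2.

Let inD x : x \in X2 -> x \in cover (hE G2).
Proof. by move=> /(subsetP (coverX_sub v2)); rewrite (cover_partition pE2). Qed.

Let pbX x : x \in X2 -> pblock (hE G2) x \in Eext G2.
Proof.
move=> xX; rewrite inE pblock_mem ?inD //; apply/exists_inP; exists [set x].
  by rewrite -coverXE.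
by rewrite sub1set mem_pblock inD.
Qed.

Let pbI : {in X2 &, injective (pblock (hE G2))}.
Proof.
move=> x y xX yX e; apply: (ext_edge1 w2 co2 ie2 (e := pblock (hE G2) x)) => //.
- by apply: pblock_mem; apply: inD.
- by rewrite mem_pblock inD.
- by rewrite e mem_pblock inD.
Qed.

Lemma valid_card s : valid_s G2 v s -> #|v| = #|X2|.
Proof.
move=> sP; rewrite -(card_Eext w2 co2 ie2) -(card_in_imset (sI sP)).
apply: eq_card => e; apply/imsetP/idP => [[h hv ->]|/(sS sP)[h hv <-]]; last by exists h.
exact: (sE sP hv).
Qed.

(** Each external edge of [G2] has one external half-edge, so a valid [s] is a bijection from [v] to
    [X2]. Once both sets are ordered as the labels in the two monomials, it is a permutation, and
    its summand in the pairing is 1 exactly when the labels agree along [s]. If the sizes differ no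
    [s] is valid. *)
Lemma pairing_count :
  pairing K (labB G2 (fun z => val (l2 z))).2 (vmono v l1) =
  \sum_(s | valid_s G2 v s) (compat_s v s l1 l2)%:R.
Proof.
have /set0Pn[x0 _] : hD G2 != set0 by case/andP: co2.
have lcE := econstP _ _ lc2.
rewrite /pairing.
set ws := enum_mset _; set ys := enum_mset _.
have pw : perm_eq ws (map (fun z => val (l2 z)) (enum X2)) by apply: perm_eq_seq_mset.
have py : perm_eq ys (map (fun h => val (l1 h)) (enum v)) by apply: perm_eq_seq_mset.
have sw : size ws = #|X2| by rewrite (perm_size pw) size_map cardE.
have sy : size ys = #|v| by rewrite (perm_size py) size_map cardE.
case: eqP => [szE|szE]; last first.
  by rewrite big1 // => s /valid_card e; case: szE; rewrite sw sy.
have [tX wE pX] := perm_map_preim x0 pw.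
have stX : size tX = size ys by rewrite -szE wE size_map.
have mX x : (x \in tX) = (x \in X2) by rewrite (perm_mem pX) mem_enum.
have uX : uniq tX by rewrite (perm_uniq pX) enum_uniq.
have [tv [yE pv]] : exists tv, ys = map (fun h => val (l1 h)) tv /\ perm_eq tv (enum v).
  have [v0|[h0 _]] := set_0Vmem v.
    exists [::]; rewrite v0 enum_set0; split=> //; apply: size0nil.
    by rewrite sy v0 cards0.
  by have [tv e1 e2] := perm_map_preim h0 py; exists tv.
have stv : size tv = size ys by rewrite yE size_map.
have mv h : (h \in tv) = (h \in v) by rewrite (perm_mem pv) mem_enum.
have uv : uniq tv by rewrite (perm_uniq pv) enum_uniq.
pose k := size ys; rewrite -/k in stX stv *.
pose iv h : option 'I_k := insub (index h tv).
have ivE h : h \in v -> exists2 i : 'I_k, iv h = Some i & val i = index h tv.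
  rewrite -mv -index_mem stv => hv; exists (Ordinal hv) => //.
  by rewrite /iv insubT.
have ivN (i : 'I_k) d : iv (nth d tv i) = Some i.
  by rewrite /iv index_uniq ?stv // valK.
pose xs (i : 'I_k) := nth x0 tX i.
have xsX i : xs i \in X2 by rewrite -mX mem_nth // stX.
(* The permutation [t] sends the i-th half-edge of [v] to the edge of the external half-edge number
   [t i]. *)
pose hs (t : 'S_k) : {ffun T1 -> {set T2}} :=
  [ffun h => if h \in v then (if iv h is Some i then pblock (hE G2) (xs (t i)) else set0)
             else set0].
have hsE t h i : h \in v -> iv h = Some i -> hs t h = pblock (hE G2) (xs (t i)).
  by move=> hv e; rewrite ffunE hv e.
have hsV t : valid_s G2 v (hs t).
  apply/and4P; split.
  - apply/forall_inP => h hv; have [i e _] := ivE _ hv.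
    by rewrite (hsE _ _ _ hv e) pbX.
  - apply/forall_inP => h hv; apply/forall_inP => h' hv'; apply/implyP.
    have [i e ei] := ivE _ hv; have [i' e' ei'] := ivE _ hv'.
    rewrite (hsE _ _ _ hv e) (hsE _ _ _ hv' e') => /eqP /pbI.
    move=> /(_ (xsX _) (xsX _)) /eqP; rewrite nth_uniq ?stX // => /eqP /val_inj /perm_inj ii.
    by rewrite -(nth_index h (etrans (mv h) hv)) -ei ii ei' nth_index ?mv.
  - apply/forall_inP => e eX; have [x [y [xX yX eE]]] := EextP w2 co2 ie2 eX.
    have xt : (index x tX < k)%N by rewrite -stX index_mem mX.
    pose j := Ordinal xt; pose i := (t^-1)%g j.
    have itv : (i < size tv)%N by rewrite stv.
    (* The list has a position [i], so it is not empty, and its head serves as default for [nth]. *)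
    case: tv uv mv stv iv ivE ivN hs hsE itv {yE pv} => // h0 tv' uv mv stv iv ivE ivN hs hsE itv.
    apply/exists_inP; exists (nth h0 (h0 :: tv') i); first by rewrite -mv mem_nth.
    rewrite (hsE _ _ i); [|by rewrite -mv mem_nth|exact: ivN].
    rewrite permKV /xs /= nth_index ?mX //; apply/eqP.
    apply: def_pblock (partition_trivIset pE2) (Eext_E eX) _.
    by rewrite eE set21.
  - by apply/forall_inP => h; rewrite inE => /negPf hv; rewrite ffunE hv.
have hsI : injective hs.
  move=> t t' /ffunP e; apply/permP => i.
  have itv : (i < size tv)%N by rewrite stv.
  case: tv uv mv stv iv ivE ivN hs hsE hsV e itv {yE pv} =>
    // h0 tv' uv mv stv iv ivE ivN hs hsE hsV e itv.
  have hv : nth h0 (h0 :: tv') i \in v by rewrite -mv mem_nth.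
  have := e (nth h0 (h0 :: tv') i); rewrite !(hsE _ _ i) ?ivN // => /pbI.
  by move=> /(_ (xsX _) (xsX _)) /eqP; rewrite nth_uniq ?stX // => /eqP /val_inj.
have hsC t : compat_s v (hs t) l1 l2 =
    [forall i : 'I_k, nth 0%N ws (t i) == nth 0%N ys i].
  apply/compatP/forallP => [H i|H h z hv].
    have itv : (i < size tv)%N by rewrite stv.
    move: H hsE; rewrite wE yE (nth_map x0) ?stX //.
    case: tv uv mv stv iv ivE ivN hs hsV hsI itv {yE pv} =>
      // h0 tv' uv mv stv iv ivE ivN hs hsV hsI itv H hsE.
    rewrite (nth_map h0) //; apply/eqP; apply: (f_equal val).
    have hv : nth h0 (h0 :: tv') i \in v by rewrite -mv mem_nth.
    apply: H => //; rewrite (hsE _ _ i) ?ivN //.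
    rewrite mem_pblock; exact: inD (xsX _).
  have [i e ei] := ivE _ hv; rewrite (hsE _ _ _ hv e) => zp.
  have := H i; rewrite wE yE (nth_map x0) ?stX // (nth_map h) ?stv // ei nth_index ?mv //.
  move/eqP/val_inj => <-; apply: lcE zp _; first by rewrite pblock_mem //; exact: inD (xsX _).
  rewrite mem_pblock; exact: inD (xsX _).
transitivity (\sum_(t : 'S_k) (compat_s v (hs t) l1 l2)%:R : K).
  apply: eq_bigr => t _; rewrite hsC.
  case: (boolP [forall i, _]) => [/forallP H|].
    by rewrite big1 // => i _; rewrite (eqP (H i)) eqxx.
  rewrite negb_forall => /existsP[i /negPf ni].
  by rewrite (bigD1 i) //= ni mul0r.
rewrite -(big_imset (fun s => (compat_s v s l1 l2)%:R : K)) /=; last by move=> t t' _ _; apply: hsI.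
apply: eq_bigl => s; apply/imsetP/idP => [[t _ ->]|sP]; first exact: hsV.
pose xe (e : {set T2}) := odflt x0 [pick x in X2 | x \in e].
have xeP e : e \in Eext G2 -> xe e \in X2 /\ xe e \in e.
  move=> eX; have [x [y [xX yX eE]]] := EextP w2 co2 ie2 eX; rewrite /xe.
  case: pickP => [z /andP[]//|/(_ x)]; by rewrite xX eE set21.
have tvv (i : 'I_k) d : nth d tv i \in v by rewrite -mv mem_nth // stv.
have [v0|[h0 h0v]] := set_0Vmem v.
  exists 1%g => //; apply/ffunP => h; rewrite ffunE v0 inE.
  by case/and4P: sP => _ _ _ /forall_inP/(_ h); rewrite v0 setC0 inE => /(_ isT)/eqP.
have xlt (i : 'I_k) : (index (xe (s (nth h0 tv i))) tX < k)%N.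
  suff : (index (xe (s (nth h0 tv i))) tX < size tX)%N by rewrite stX.
  by rewrite index_mem mX; case: (xeP _ (sE sP (tvv i h0))).
pose f i := Ordinal (xlt i).
have xsf i : xs (f i) = xe (s (nth h0 tv i)).
  by rewrite /xs nth_index // mX; case: (xeP _ (sE sP (tvv i h0))).
have fI : injective f.
  move=> i j e; have := xsf i; rewrite e xsf => e2.
  have [_ m1] := xeP _ (sE sP (tvv i h0)); have [_ m2] := xeP _ (sE sP (tvv j h0)).
  rewrite e2 in m2; have := s_uniq w2 sP (tvv i h0) (tvv j h0) m1 m2.
  by move=> /eqP; rewrite nth_uniq ?stv // => /eqP /val_inj.
exists (perm fI) => //; apply/ffunP => h; have [hv|hv] := boolP (h \in v); last first.
  rewrite ffunE (negPf hv); case/and4P: sP => _ _ _ /forall_inP/(_ h).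
  by rewrite inE hv => /(_ isT)/eqP.
have [i e ei] := ivE _ hv; rewrite (hsE _ _ _ hv e) permE xsf.
have -> : nth h0 tv i = h by rewrite ei nth_index // mv.
have [_ m1] := xeP _ (sE sP hv).
by rewrite (def_pblock (partition_trivIset pE2) _ m1) //; apply: Eext_E; exact: (sE sP hv).
Qed.

End Pairing.

(** The positions in the multiset of vertex monomials correspond to the internal vertices, so
    vertices with equal monomials are counted separately on both sides. *)
Lemma circ_coef_labB (l1 : {ffun T1 -> 'I_n.+1}) (l2 : {ffun T2 -> 'I_n.+1}) b :
  econst (hE G2) l2 ->
  circ_coef K (labB G1 (fun h => val (l1 h))) (labB G2 (fun h => val (l2 h))) b =
  \sum_(v in Vint G1) \sum_(s | valid_s G2 v s) (compat_s v s l1 l2)%:R *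
    (circ_b (labB G1 (fun h => val (l1 h))) (labB G2 (fun h => val (l2 h))) (vmono v l1)
      == b)%:R.
Proof.
move=> lc2; rewrite /circ_coef.
set b1 := labB G1 _; set b2 := labB G2 _.
pose F (y : mono) : K := pairing K b2.2 y *
   (msetD b2.1 (msetB b1.1 (msetn 1 y)) == b.1)%:R.
transitivity ((b1.2 == b.2)%:R * \sum_(y <- enum_mset b1.1) F y).
  apply: (f_equal2 *%R) => //; rewrite (big_nth mset0) big_mkord.
  by apply: eq_bigr.
have -> : \sum_(y <- enum_mset b1.1) F y = \sum_(v in Vint G1) F (vmono v l1).
  rewrite (perm_big _ (perm_eq_seq_mset _)) big_map big_map big_enum /=.
  by apply: eq_bigr.
rewrite mulr_sumr; apply: eq_bigr => v _.
rewrite /F (pairing_count l1 v lc2) mulr_suml mulr_sumr; apply: eq_bigr => s _.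
rewrite mulrCA; apply: (f_equal2 *%R) => //.
rewrite -natrM mulnb; congr (_%:R); congr nat_of_bool.
by rewrite andbC; case: (b) => P q; rewrite /circ_b /= xpair_eqE.
Qed.

Lemma sum_circ_labB b :
  \sum_(l1 : {ffun T1 -> 'I_n.+1} | offz (hD G1) l1 && econst (hE G1) l1)
   \sum_(l2 : {ffun T2 -> 'I_n.+1} | offz (hD G2) l2 && econst (hE G2) l2)
    circ_coef K (labB G1 (fun h => val (l1 h))) (labB G2 (fun h => val (l2 h))) b =
  \sum_(v in Vint G1) \sum_(s | valid_s G2 v s) PhiG K n (insertg G1 G2 v s) b.
Proof.
transitivity (\sum_(p : {ffun T1 -> 'I_n.+1} * {ffun T2 -> 'I_n.+1} |
    (offz (hD G1) p.1 && econst (hE G1) p.1) && (offz (hD G2) p.2 && econst (hE G2) p.2))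
   \sum_(v in Vint G1) \sum_(s | valid_s G2 v s) (compat_s v s p.1 p.2)%:R *
    (circ_b (labB G1 (fun h => val (p.1 h))) (labB G2 (fun h => val (p.2 h))) (vmono v p.1)
      == b)%:R : K).
  rewrite pair_big /=; apply: eq_bigr => -[l1 l2] /= /andP[_ /andP[_ lc2]].
  exact: circ_coef_labB.
rewrite exchange_big /=; apply: eq_bigr => v vV.
rewrite exchange_big /=; apply: eq_bigr => s sP.
rewrite (PhiG_ins w1 w2 co2 ie2 vV sP) [RHS]big_mkcond [LHS]big_mkcond /=.
apply: eq_bigr => -[l1 l2] _ /=.
case: (offz (hD G1) l1 && econst (hE G1) l1) => //=.
case: (offz (hD G2) l2 && econst (hE G2) l2) => //=.
by case: (compat_s v s l1 l2); rewrite ?mul1r ?mul0r.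
Qed.

End CircLabels.

(** * Compatibility with the pre-Lie products *)

Section Morphism.
Variable K : fieldType.
Hypothesis charK : [pchar K] =i pred0.

Lemma fsum_neq0 (T : choiceType) (f : T -> K) : fsum f != 0 -> exists i, f i != 0.
Proof.
move=> f0; apply: boolp.contrapT => H; case/eqP: f0; apply: fsum0 => i.
by apply/eqP/negPn/negP => fi; apply: H; exists i.
Qed.

Lemma sum_neq0 (I : finType) (P : pred I) (f : I -> K) :
  \sum_(i | P i) f i != 0 -> exists2 i, P i & f i != 0.
Proof.
move=> f0; apply/exists_inP; apply: contraNT f0 => /exists_inPn H.
by rewrite big1 // => i /H; rewrite negbK => /eqP.
Qed.

Lemma pairing_mdeg (w y : mono) : pairing K w y != 0 -> mdeg w = mdeg y.
Proof. by rewrite /pairing; case: ifP => [/eqP //|_]; rewrite eqxx. Qed.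

(** The removed monomial has the degree of the second factor of [b2], which by N > k is less than
    the degree of its first factor. Hence only finitely many pairs contribute to a given
    coefficient. *)
Lemma circ_coef_bound (b1 b2 b : basis) : b_plus b2 -> circ_coef K b1 b2 b != 0 ->
  (bdeg b1 <= bdeg b)%N /\ (bdeg b2 <= 2 * bdeg b)%N.
Proof.
case/andP => _ bp; rewrite /circ_coef; case: (b1.2 =P b.2) => [e2|_]; last first.
  by rewrite mul0r eqxx.
rewrite mul1r => /sum_neq0[i _]; rewrite mulf_eq0 negb_or => /andP[/pairing_mdeg].
set y := nth _ _ _ => my.
set e := (X in (nat_of_bool X)%:R); case: (boolP e) => [/eqP e1 _|_]; last by rewrite eqxx.
have yb : y \in b1.1 by exact: mem_nth (ltn_ord i).
pose d (P : multiset mono) := (\sum_(z <- enum_mset P) mdeg z)%N.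
have dD P Q : d (msetD P Q) = (d P + d Q)%N.
  by rewrite /d (perm_big _ (perm_msetD _ _)) big_cat.
have d1 : d b1.1 = (mdeg y + d (msetB b1.1 (msetn 1 y)))%N.
  by rewrite -{1}(msetB1K yb) dD /d enum_msetn big_seq1.
have db : d b.1 = (d b2.1 + d (msetB b1.1 (msetn 1 y)))%N by rewrite -dD e1.
move: bp; rewrite /bdeg -!/(d _) e2 d1 db my; lia.
Qed.

Lemma b_in_enum_lt n M : exists2 s : seq basis, uniq s &
  forall b, (b \in s) = b_in n.+1 b && (bdeg b < M)%N.
Proof.
suff [s sP] : exists s : seq basis, forall b, b_in n.+1 b -> (bdeg b < M)%N -> b \in s.
  exists (undup [seq b <- s | b_in n.+1 b && (bdeg b < M)%N]); first exact: undup_uniq.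
  move=> b; rewrite mem_undup mem_filter; apply/andP/idP => [[]//|bb].
  by split=> //; case/andP: bb => h1 h2; apply: sP.
elim: M => [|M [s sP]]; first by exists [::].
have [t _ tP] := b_in_enum n M; exists (t ++ s) => b bin; rewrite ltnS leq_eqVlt mem_cat.
by case/orP => [/eqP /(tP _ bin) ->|/(sP _ bin) ->]; rewrite ?orbT.
Qed.

Lemma Phi_trunc c n b M : wsupp c -> (bdeg b < M)%N ->
  Phi c n b = \sum_(h < M) \sum_(G : pregraph 'I_h) c h G / ncls K G * PhiG K n G b.
Proof.
move=> wc bM; apply: fsum_ord => h hM; rewrite big1 // => G _.
have [->|cG] := eqVneq (c h G) 0; first by rewrite !mul0r.
have /andP[wG /eqP DG] := wc _ _ cG.
rewrite PhiG_bdeg ?mulr0 ?wf_vwf // DG cardsT card_ord neq_ltn.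
by rewrite (leq_trans bM hM).
Qed.

(** [circ] is bilinear in the coefficients, so this applies to each argument in turn and turns sums
    over basis elements into sums over labelled graphs. *)
Lemma Phi_functional c n M (s : seq basis) (F : basis -> K) : wsupp c -> uniq s ->
  (forall b, (b \in s) = b_in n.+1 b && (bdeg b < M)%N) ->
  \sum_(b <- s) Phi c n b * F b =
  \sum_(h < M) \sum_(G : pregraph 'I_h) c h G / ncls K G *
    \sum_(l : {ffun 'I_h -> 'I_n.+1} | offz (hD G) l && econst (hE G) l)
      F (labB G (fun i => val (l i))).
Proof.
move=> wc us sP; rewrite big_seq.
under eq_bigr => b bs do [rewrite (@Phi_trunc c n b M wc); last (by move: bs; rewrite sP => /andP[]); rewrite mulr_suml].
rewrite -big_seq exchange_big /=; apply: eq_bigr => h _.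
under eq_bigr => b _ do rewrite mulr_suml.
rewrite exchange_big /=; apply: eq_bigr => G _.
under eq_bigr => b _ do rewrite -mulrA.
rewrite -mulr_sumr.
have [->|cG] := eqVneq (c h G) 0; first by rewrite !mul0r.
have /andP[wG /eqP DG] := wc _ _ cG; apply: (f_equal2 *%R) => //.
transitivity (\sum_(b <- s) \sum_(l : {ffun 'I_h -> 'I_n.+1} | offz (hD G) l && econst (hE G) l)
    (labB G (fun i => val (l i)) == b)%:R * F b).
  by apply: eq_bigr => b _; rewrite (PhiGE _ _ _ (wf_vwf wG)) mulr_suml.
rewrite exchange_big /=; apply: eq_bigr => l _.
rewrite (bigD1_seq (labB G (fun i => val (l i)))) //=; last first.
  by rewrite sP b_in_labB ?wf_vwf //= bdeg_labB ?wf_vwf // DG cardsT card_ord.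
rewrite eqxx mul1r big1 ?addr0 // => b bb.
by rewrite eq_sym (negPf bb) mul0r.
Qed.

(** The cut-off is larger than [circ_coef_bound] demands; it is chosen equal to the one for the
    insertion product, where h1 <= h and h2 <= h + 2 h1 <= 3 h. *)
Lemma circ_Phi c1 c2 n b (M := (3 * bdeg b).+1) : in_Hc c1 -> in_Hc c2 ->
  circ (Phi c1 n) (Phi c2 n) b =
  \sum_(h1 < M) \sum_(G1 : pregraph 'I_h1) c1 h1 G1 / ncls K G1 *
  \sum_(h2 < M) \sum_(G2 : pregraph 'I_h2) c2 h2 G2 / ncls K G2 *
  \sum_(v in Vint G1) \sum_(s | valid_s G2 v s) PhiG K n (insertg G1 G2 v s) b.
Proof.
move=> hc1 hc2; have wc1 := in_Hc_wsupp hc1; have wc2 := in_Hc_wsupp hc2.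
have [s us sP] := b_in_enum_lt n M.
transitivity (\sum_(p <- [seq (p1, p2) | p1 <- s, p2 <- s])
    Phi c1 n p.1 * Phi c2 n p.2 * circ_coef K p.1 p.2 b).
  apply: fsum_seq; first by apply: allpairs_uniq => // -[? ?] [? ?] _ _ [-> ->].
  move=> [p1 p2] /=; rewrite mulf_eq0 negb_or => /andP[+ C0].
  rewrite mulf_eq0 negb_or => /andP[P1 P2].
  have /andP[bin1 _] := Phi_supp hc1 P1; have /andP[bin2 bp2] := Phi_supp hc2 P2.
  have [d1 d2] := circ_coef_bound bp2 C0.
  apply/allpairsP; exists (p1, p2); rewrite !sP bin1 bin2 /=; split=> //; rewrite /M ltnS.
    by lia.
  by lia.
rewrite big_allpairs /=.
transitivity (\sum_(p1 <- s) Phi c1 n p1 *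
    \sum_(p2 <- s) Phi c2 n p2 * circ_coef K p1 p2 b).
  apply: eq_bigr => p1 _; rewrite mulr_sumr; apply: eq_bigr => p2 _.
  by rewrite mulrA.
rewrite (Phi_functional _ wc1 us sP); apply: eq_bigr => h1 _; apply: eq_bigr => G1 _.
have [->|cG1] := eqVneq (c1 h1 G1) 0; first by rewrite !mul0r.
have [/(_ _ _ cG1) /and4P[wG1 _ _ _] _] := hc1; apply: (f_equal2 *%R) => //.
transitivity (\sum_(l1 : {ffun 'I_h1 -> 'I_n.+1} | offz (hD G1) l1 && econst (hE G1) l1)
  \sum_(h2 < M) \sum_(G2 : pregraph 'I_h2) c2 h2 G2 / ncls K G2 *
  \sum_(l2 : {ffun 'I_h2 -> 'I_n.+1} | offz (hD G2) l2 && econst (hE G2) l2)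
   circ_coef K (labB G1 (fun i => val (l1 i))) (labB G2 (fun i => val (l2 i))) b).
  apply: eq_bigr => l1 _.
  exact: (Phi_functional (fun p2 => circ_coef K (labB G1 (fun i => val (l1 i))) p2 b) wc2 us sP).
rewrite exchange_big /=; apply: eq_bigr => h2 _.
rewrite exchange_big /=; apply: eq_bigr => G2 _.
rewrite -mulr_sumr.
have [->|cG2] := eqVneq (c2 h2 G2) 0; first by rewrite !mul0r.
have [/(_ _ _ cG2) /and4P[wG2 _ co2 ie2] _] := hc2; apply: (f_equal2 *%R) => //.
exact: sum_circ_labB.
Qed.

Lemma iso_ord (T : finType) (G : pregraph T) H : hD G != set0 -> #|hD G| = H ->
  exists2 G0 : pregraph 'I_H, giso G G0 & hD G0 = setT.
Proof.
move=> /set0Pn[h0 h0D] <-; pose f := enum_rank_in h0D.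
have fI : {in hD G &, injective f} by exact: enum_rank_in_inj.
have fD : f @: hD G = setT.
  apply/eqP; rewrite eqEcard subsetT cardsT card_ord (card_in_imset fI) /=. exact: leqnn.
exists ((f @: hD G, [set f @: e | e : {set T} in hE G]),
  [set f @: e | e : {set T} in hV G], [set f @: e | e : {set T} in hX G]) => //.
by apply/gisoP; exists f.
Qed.

Lemma sum_iso_class (T : finType) (I : pregraph T) n b (H := bdeg b) :
  wf_graph I -> hD I != set0 ->
  \sum_(G : pregraph 'I_H) ((wf_graph G && (hD G == setT))%:R * (giso I G)%:R) /
     ncls K G * PhiG K n G b = PhiG K n I b.
Proof.
move=> wI D0; have [DH|DH] := eqVneq #|hD I| H; last first.
  rewrite PhiG_bdeg ?wf_vwf //; last by rewrite eq_sym.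
  rewrite big1 // => G _; case: (boolP (_ && _)) => [/andP[wG /eqP DG]|_]; last by rewrite !mul0r.
  case: (boolP (giso I G)) => [/gisoP[f /eiso_D]|_]; last by rewrite mulr0 !mul0r.
  by rewrite DG cardsT card_ord => e; rewrite -e eqxx in DH.
have [G0 IG0 DG0] := iso_ord D0 DH; have /set0Pn[i0 _] := D0.
have wG0 := giso_wf IG0 wI.
have t0 : 'I_H.
  by have H0 : (0 < H)%N; [rewrite -DH card_gt0 | exact: Ordinal H0].
have iso (G : pregraph 'I_H) : giso I G = giso G0 G.
  apply/idP/idP; last exact: giso_trans.
  by apply: giso_trans; apply: giso_sym IG0.
transitivity (\sum_(G : pregraph 'I_H | giso G0 G) PhiG K n G b / ncls K G).
  rewrite [RHS]big_mkcond /=; apply: eq_bigr => G _; rewrite iso.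
  case: (boolP (giso G0 G)) => GG; last by rewrite mulr0 !mul0r.
  by rewrite (giso_wfT t0 GG) wG0 DG0 eqxx mul1r div1r mulrC.
have inv (G : pregraph 'I_H) : giso G0 G -> PhiG K n G b = PhiG K n G0 b.
  by move=> GG; have /gisoP[f fI] := GG; rewrite (PhiG_iso _ _ _ wG0 _ fI) // (giso_wf GG).
rewrite (sum_class charK t0 (F := fun G => PhiG K n G b) wG0 inv).
by have /gisoP[f fI] := IG0; rewrite (PhiG_iso _ _ _ wI _ fI).
Qed.

Lemma Hcirc_wsupp (c1 c2 : Hser K) : wsupp (Hcirc c1 c2).
Proof.
by move=> h G; rewrite /Hcirc; case: (_ && _); rewrite // mul0r eqxx.
Qed.

Definition ins_set h1 h2 h (G1 : pregraph 'I_h1) (G2 : pregraph 'I_h2) (G : pregraph 'I_h) :=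
  [set vs : {set 'I_h1} * {ffun 'I_h1 -> {set 'I_h2}} |
          [&& vs.1 \in Vint G1, valid_s G2 vs.1 vs.2 &
              giso (insertg G1 G2 vs.1 vs.2) G]].

Lemma Hcirc_trunc (c1 c2 : Hser K) h (G : pregraph 'I_h) (M := (3 * h).+1) :
  in_Hc c1 -> in_Hc c2 ->
  Hcirc c1 c2 G = (wf_graph G && (hD G == setT))%:R *
   \sum_(h1 < M) \sum_(h2 < M) \sum_(G1 : pregraph 'I_h1) \sum_(G2 : pregraph 'I_h2)
      (c1 h1 G1 / ncls K G1) * (c2 h2 G2 / ncls K G2) * #|ins_set G1 G2 G|%:R.
Proof.
move=> hc1 hc2; rewrite /Hcirc.
case: (boolP (_ && _)) => [/andP[wG /eqP DG]|_]; last by rewrite !mul0r.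
have z h1 h2 (G1 : pregraph 'I_h1) (G2 : pregraph 'I_h2) : (M <= h1)%N || (M <= h2)%N ->
   (c1 h1 G1 / ncls K G1) * (c2 h2 G2 / ncls K G2) * #|ins_set G1 G2 G|%:R = 0.
  move=> hM; have [->|cG1] := eqVneq (c1 h1 G1) 0; first by rewrite !mul0r.
  have [->|cG2] := eqVneq (c2 h2 G2) 0; first by rewrite mul0r mulr0 mul0r.
  have [/(_ _ _ cG1) /and4P[wG1 /eqP DG1 _ _] _] := hc1.
  have [/(_ _ _ cG2) /and4P[wG2 /eqP DG2 co2 ie2] _] := hc2.
  suff -> : ins_set G1 G2 G = set0 by rewrite cards0 mulr0.
  apply/eqP; rewrite -subset0; apply/subsetP => -[v s]; rewrite in_set /=.
  case/and3P => vV sP /gisoP[f /eiso_D].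
  move=> e; exfalso; have d1 := card_ins_D1 G1 G2 v s.
  have := card_ins_D2 wG1 wG2 vV sP; move: d1 hM; rewrite -e DG DG1 DG2 /M.
  by rewrite !cardsT !card_ord; lia.
apply: (f_equal2 *%R) => //; rewrite (@fsum_ord _ _ M); last first.
  move=> h1 hM; apply: fsum0 => h2; apply: big1 => G1 _; apply: big1 => G2 _.
  by apply: z; rewrite hM.
apply: eq_bigr => h1 _; rewrite (@fsum_ord _ _ M) // => h2 hM.
by apply: big1 => G1 _; apply: big1 => G2 _; apply: z; rewrite hM orbT.
Qed.

Lemma Phi_Hcirc (c1 c2 : Hser K) : in_Hc c1 -> in_Hc c2 ->
  Phi (Hcirc c1 c2) = circ_inf (Phi c1) (Phi c2).
Proof.
move=> hc1 hc2; apply: boolp.funext => n; apply: boolp.funext => b.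
rewrite /circ_inf circ_Phi // (Phi_bdeg n (@Hcirc_wsupp c1 c2) (erefl _)).
set H := bdeg b; set M := (3 * H).+1.
pose t h1 (G1 : pregraph 'I_h1) h2 (G2 : pregraph 'I_h2) (G : pregraph 'I_H) : K :=
  (wf_graph G && (hD G == setT))%:R * #|ins_set G1 G2 G|%:R / ncls K G * PhiG K n G b.
transitivity (\sum_(h1 < M) \sum_(h2 < M) \sum_(G1 : pregraph 'I_h1)
  \sum_(G2 : pregraph 'I_h2) (c1 h1 G1 / ncls K G1) * (c2 h2 G2 / ncls K G2) *
   \sum_(G : pregraph 'I_H) t h1 G1 h2 G2 G).
  under eq_bigr => G _ do rewrite Hcirc_trunc // -/M mulr_sumr !mulr_suml.
  rewrite exchange_big /=; apply: eq_bigr => h1 _.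
  under eq_bigr => G _ do rewrite mulr_sumr !mulr_suml.
  rewrite exchange_big /=; apply: eq_bigr => h2 _.
  under eq_bigr => G _ do rewrite mulr_sumr !mulr_suml.
  rewrite exchange_big /=; apply: eq_bigr => G1 _.
  under eq_bigr => G _ do rewrite mulr_sumr !mulr_suml.
  rewrite exchange_big /=; apply: eq_bigr => G2 _.
  rewrite mulr_sumr; apply: eq_bigr => G _.
  by rewrite /t mulrCA -!mulrA.
apply: eq_bigr => h1 _; rewrite exchange_big /=; apply: eq_bigr => G1 _.
rewrite mulr_sumr; apply: eq_bigr => h2 _; rewrite mulr_sumr; apply: eq_bigr => G2 _.
rewrite -mulrA.
have [->|cG1] := eqVneq (c1 h1 G1) 0; first by rewrite !mul0r.
have [->|cG2] := eqVneq (c2 h2 G2) 0; first by rewrite !mul0r.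
have [/(_ _ _ cG1) /and4P[wG1 _ co1 _] _] := hc1.
have [/(_ _ _ cG2) /and4P[wG2 _ co2 ie2] _] := hc2.
do 2! apply: (f_equal2 *%R) => //.
(* The number of insertions isomorphic to [G] is expanded into a sum over (v, s); summing over [G]
   first then gives the value of [PhiG] on each inserted graph. *)
transitivity (\sum_(v in Vint G1) \sum_(s | valid_s G2 v s)
  \sum_(G : pregraph 'I_H) ((wf_graph G && (hD G == setT))%:R *
     (giso (insertg G1 G2 v s) G)%:R) / ncls K G * PhiG K n G b); last first.
  apply: eq_bigr => v vV; apply: eq_bigr => s sP.
  have wi := ins_wf wG1 wG2 co2 ie2 vV sP.
  apply: sum_iso_class => //.
  by case/andP: (ins_connected wG1 wG2 co2 ie2 vV sP co1).
under [RHS]eq_bigr => v _ do rewrite exchange_big.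
rewrite [RHS]exchange_big /=; apply: eq_bigr => G _.
under [RHS]eq_bigr => v _ do rewrite -mulr_suml -mulr_suml -mulr_sumr.
rewrite -mulr_suml -mulr_suml -mulr_sumr /t.
do 3! apply: (f_equal2 *%R) => //.
rewrite -sum1_card natr_sum pair_big_dep /= [LHS]big_mkcond [RHS]big_mkcond /=.
apply: eq_bigr => -[v s] _; rewrite in_set /=.
by case: (v \in Vint G1); case: (valid_s G2 v s) => //=; case: (giso _ _).
Qed.

Lemma Hcirc_in_Hc (c1 c2 : Hser K) : in_Hc c1 -> in_Hc c2 -> in_Hc (Hcirc c1 c2).
Proof.
move=> hc1 hc2.
have supp h (G : pregraph 'I_h) : Hcirc c1 c2 G != 0 ->
     [&& wf_graph G, hD G == setT, connectedg G & has_int_edge G].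
  move=> H0; have /andP[wG DG] := Hcirc_wsupp H0; rewrite wG DG /=.
  move: H0; rewrite /Hcirc mulf_eq0 negb_or => /andP[_ /fsum_neq0[h1 /fsum_neq0[h2]]].
  move=> /sum_neq0[G1 _ /sum_neq0[G2 _]].
  rewrite !mulf_eq0 !negb_or => /andP[/andP[/andP[cG1 _] /andP[cG2 _]]].
  have [/(_ _ _ cG1) /and4P[wG1 /eqP DG1 co1 ie1] _] := hc1.
  have [/(_ _ _ cG2) /and4P[wG2 /eqP DG2 co2 ie2] _] := hc2.
  rewrite -/(ins_set G1 G2 G); have [->|[[v s]]] := set_0Vmem (ins_set G1 G2 G).
    by rewrite cards0 eqxx.
  rewrite in_set /= => /and3P[vV sP /gisoP[f fI]] _.
  have wi := ins_wf wG1 wG2 co2 ie2 vV sP.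
  rewrite (eiso_connected wi fI) ?(ins_connected wG1 wG2 co2 ie2 vV sP co1) //=.
  by apply: (eiso_int_edge wi fI); apply: ins_int_edge.
split=> // h G G' GG'.
have [h0|h0] := posnP h.
  have z (G1 : pregraph 'I_h) : Hcirc c1 c2 G1 = 0.
    apply/eqP/negPn/negP => /supp/and4P[_ _ /andP[D0 _] _].
    by subst h; case/set0Pn: D0 => x _; have := ltn_ord x.
  by rewrite !z.
have t0 := Ordinal h0.
rewrite !Hcirc_trunc // (giso_wfT t0 GG').
case: (boolP (_ && _)) => [/andP[wG _]|_]; last by rewrite !mul0r.
apply: (f_equal2 *%R) => //; apply: eq_bigr => h1 _; apply: eq_bigr => h2 _.
apply: eq_bigr => G1 _; apply: eq_bigr => G2 _; apply: (f_equal2 *%R) => //.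
congr (_%:R); apply: eq_card => vs; rewrite !in_set; do 2! congr (_ && _).
apply/idP/idP => iso; first exact: giso_trans iso GG'.
by apply: giso_trans iso _; apply: giso_sym GG'.
Qed.

End Morphism.

Theorem theorem3p13 (K : fieldType) (charK : [pchar K] =i pred0) :
  (* P l^oo_+ is a pre-Lie subalgebra of (l^oo_+, o) *)
  ((@Pl K (fun _ _ => 0)) /\
   (forall (a : K) (x y : Linf K), Pl x -> Pl y -> Pl (fun n b => a * x n b + y n b)) /\
   (forall x y : Linf K, Pl x -> Pl y -> Pl (circ_inf x y))) /\
  (* Phi : \hat H^+_c -> P l^oo_+ is a linear bijection ... *)
  (forall c : Hser K, in_Hc c -> Pl (Phi c)) /\
  (forall (a : K) (c1 c2 : Hser K), in_Hc c1 -> in_Hc c2 ->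
     Phi (fun h G => a * c1 h G + c2 h G) = (fun n b => a * Phi c1 n b + Phi c2 n b)) /\
  (forall c1 c2 : Hser K, in_Hc c1 -> in_Hc c2 -> Phi c1 = Phi c2 -> c1 = c2) /\
  (forall x : Linf K, Pl x -> exists c : Hser K, in_Hc c /\ Phi c = x) /\
  (* ... which is a morphism of pre-Lie algebras *)
  (forall c1 c2 : Hser K, in_Hc c1 -> in_Hc c2 ->
     Phi (Hcirc c1 c2) = circ_inf (Phi c1) (Phi c2)).
Proof.
have circP c1 c2 : in_Hc c1 -> in_Hc c2 -> Pl (circ_inf (Phi c1) (@Phi K c2)).
  move=> h1 h2; rewrite -Phi_Hcirc //.
  have hc := Hcirc_in_Hc h1 h2; split; first exact: Phi_in_linf.
  exact: Phi_primitive.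
split; [split; [exact: Pl0 | split; [exact: Pl_lin |]] | split; [| split; [| split; [| split]]]].
- move=> x y [xP xprim] [yP yprim].
  rewrite -(Phi_inv_Phi charK xP xprim) -(Phi_inv_Phi charK yP yprim).
  by apply: circP; apply: inv_Phi_in_Hc.
- by move=> c hc; split; [exact: Phi_in_linf | exact: Phi_primitive].
- exact: Phi_linear.
- exact: Phi_inj.
- move=> x [xP xprim]; exists (inv_Phi x); split; first exact: inv_Phi_in_Hc.
  exact: Phi_inv_Phi.
- exact: Phi_Hcirc.
Qed.
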